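(* Let $n\ge1$, $0<p<1$, $0<\tau_0\le\infty$, $\sigma\in J_n^+$, $\Lambda$ a continuous positive function, $\underline\vartheta,\overline\vartheta>0$ constants, and $V\ge0$ continuous with $$V(x,t)\ge\underline\vartheta\Lambda(t)|x|^\sigma\ (|x|\ge1,\,0<t<\tau_0),\qquad V(x,t)\le\overline\vartheta\Lambda(t)|x|^\sigma\ (x\in\mathbb{R}^n,\,0<t<\tau_0).$$ Let $a\ge\frac{\sigma}{1-p}$ and let $\varepsilon_0>0$ be any constant such that $\int_{\{|x-y|\ge1\}}B(y)|x-y|^{\sigma+d}dy\ge\varepsilon_0|x|^{\sigma+d}$ for all $x\in\mathbb{R}^n$ and all $d\in[0,\frac{\sigma p}{1-p}]$. Let $0\le u_0,v_0\in BC_a$ and let $0\le u,v\in\mathcal{Z}_{\tau_0,a}$ be such that $\mu=e^tu$, $\omega=e^tv$ satisfy on $Q_{\tau_0}$ $$\mu(t)\ge u_0+\int_0^t\mathcal{B}\mu(\tau)d\tau+\int_0^te^{(1-p)\tau}\mathcal{B}(V\mu^p)(\tau)d\tau,\quad \omega(t)\le v_0+\int_0^t\mathcal{B}\omega(\tau)d\tau+\int_0^te^{(1-p)\tau}\mathcal{B}(V\omega^p)(\tau)d\tau.$$ If $0<p<\varepsilon_0\,\underline\vartheta/\overline\vartheta$ and $u_0\ge v_0\ge0$ with $u_0\not\equiv0$, then $u\ge v$ on $Q_{\tau_0}$.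
   Context: $J_n^+=\{0\}\cup[1,\infty)$ if $n=1$, $J_n^+=[0,\infty)$ if $n\ge2$. $B=\mathcal{F}^{-1}((1+|\xi|^2)^{-1})$, $\mathcal{B}\varphi=B*\varphi=(I-\Delta)^{-1}\varphi$. $BC_a$: continuous functions on $\mathbb{R}^n$ with $|\varphi(x)|\le C|x|^a$ for large $|x|$, norm $\|\varphi\|_{R,a}=\sup_x(R^2+|x|^2)^{-a/2}|\varphi(x)|$. $\mathcal{Z}_{T,a}=C([0,T);BC_a)$, $Q_T=\mathbb{R}^n\times[0,T)$. *)

(* Defs.v *)
From HB Require Import structures.
From mathcomp Require Import all_boot all_order all_algebra.
From mathcomp Require Import all_classical all_reals all_analysis.
Set Implicit Arguments. Unset Strict Implicit. Unset Printing Implicit Defensive.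
Import Order.TTheory GRing.Theory Num.Theory.
Import numFieldNormedType.Exports.
Local Open Scope classical_set_scope.
Local Open Scope ring_scope.

Section Defs.
Variable R : realType.

Definition enorm n (x : 'rV[R]_n) : R := Num.sqrt (\sum_i (x ord0 i) ^+ 2).
Definition edot n (x y : 'rV[R]_n) : R := \sum_i x ord0 i * y ord0 i.

Fixpoint iint (m : nat) (g : (nat -> R) -> \bar R) : \bar R :=
  match m with
  | 0 => g (fun _ => 0)
  | m'.+1 => (\int[@lebesgue_measure R]_(t in setT)
                iint m' (fun x => g (fun k => if k == m' then t else x k)))%E
  end.

(* Lebesgue integral over R^n (as iterated integral, Fubini/Tonelli) *)
Definition intRn n (f : 'rV[R]_n -> \bar R) : \bar R :=
  iint n (fun x => f (\row_i x (nat_of_ord i))).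

(* B is the Bessel kernel F^{-1}((1+|xi|^2)^{-1}): an integrable function
   (continuous off the origin, hence measurable) whose Fourier transform
   int B(x) e^{-i x.xi} dx equals (1+|xi|^2)^{-1}. *)
Definition is_bessel_kernel n (B : 'rV[R]_n -> R) : Prop :=
  (forall x, x != 0 -> {for x, continuous B}) /\
  (intRn (fun x => (`|B x|)%:E) < +oo)%E /\
  (forall xi, intRn (fun x => (B x * cos (edot x xi))%:E)
                = ((1 + enorm xi ^+ 2)^-1)%:E) /\
  (forall xi, intRn (fun x => (B x * sin (edot x xi))%:E) = 0%E).

Definition bconv n (B phi : 'rV[R]_n -> R) (x : 'rV[R]_n) : \bar R :=
  intRn (fun y => (B (x - y) * phi y)%:E).

Definition Jplus (n : nat) (s : R) : Prop :=
  if n == 1%N then s = 0 \/ 1 <= s else 0 <= s.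

Definition BC n (a : R) (phi : 'rV[R]_n -> R) : Prop :=
  continuous phi /\
  exists C M : R, forall x, M <= enorm x -> `|phi x| <= C * (enorm x `^ a).

Definition wnorm n (a : R) (phi : 'rV[R]_n -> R) : R :=
  sup [set ((1 + enorm x ^+ 2) `^ (- (a / 2))) * `|phi x| | x in [set: 'rV[R]_n]].

Definition inI (T : \bar R) (t : R) : Prop := 0 <= t /\ (t%:E < T)%E.

Definition Zspace n (T : \bar R) (a : R) (u : 'rV[R]_n -> R -> R) : Prop :=
  (forall t, inI T t -> BC a (fun x => u x t)) /\
  (forall t, inI T t -> forall e : R, 0 < e -> exists2 d : R, 0 < d &
     forall s, inI T s -> `|s - t| < d -> wnorm a (fun x => u x s - u x t) < e).

Definition tint (t : R) (F : R -> \bar R) : \bar R :=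
  (\int[@lebesgue_measure R]_(s in [set s : R | (0 <= s <= t)%R]) F s)%E.

End Defs.

(* Main.v *)
Require Import Defs.
From HB Require Import structures.
From mathcomp Require Import all_boot all_order all_algebra.
From mathcomp Require Import all_classical all_reals all_analysis.
From mathcomp Require Import measurable_realfun lebesgue_measure ring lra.
Set Implicit Arguments. Unset Strict Implicit. Unset Printing Implicit Defensive.
Import Order.TTheory GRing.Theory Num.Theory.
Import numFieldNormedType.Exports.
Local Open Scope classical_set_scope.
Local Open Scope ring_scope.

(** The Bessel kernel is recovered from its Fourier transform as a superposition
of heat kernels, [B = int_0^oo e^-s h_s ds] off the origin; this gives
[B y >= k e^(-C|y|_1)] and [B * e^(k.x) <= e^(k.x) / (1 - |k|^2)] for [|k| < 1].
Write [g = 1 / (1 - p)] and let [L] be the primitive of [e^((1-p)t) Lam t].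

Lower bound: the positive mass of [u0] spreads to [mu >= c L^g e^(-C|x|_1)]; feeding
this back into the inequality replaces the decay rate [C] by [C p^j], and in the limit
[mu >= m L^g].  A second bootstrap, through the [eps0]-inequality, upgrades this to
[mu >= (D L |x|^sigma)^g] with [D = eps0 thl / g].

Comparison: fix a weight [rho] (a sum of exponentials with small rate) dominating
[(1+|x|^2)^(a/2)], with [B * rho <= C1 rho] and [C1] so close to [1] that
[C1 p thu / (eps0 thl) < 1].  Using [(x+z)^p <= x^p + z^p], an estimate
[om <= mu + m e^(Kt) (L+eta)^g rho] improves itself down to a fixed [m], uniformly in
[eta], so that [eta = 0] is allowed.  Then [(mu+z)^p <= mu^p + p mu^(p-1) z] together with
the lower bound on [mu] turns [m] into [theta m] with [theta < 1], hence [om <= mu]. *)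

(** [intRn] is an iterated integral, whereas the arguments need Fubini, Fatou and linearity; so it
    is represented by one sigma-finite measure [mu] and a measurable row [X]. The Fourier transform
    of [B] shows neither its sign nor its size, and Fourier inversion need not converge absolutely.
    Everything is therefore smoothed by a heat kernel of time [t > 0], where Fubini applies, before
    [t] tends to 0. The lower bound on [mu] vanishes at time 0 like [L^g], so the excess of [om]
    over [mu] must be measured on that scale. The a priori bound on [om] does not vanish there: it
    only compares with [(L + eta)^g], with a constant that blows up as [eta] tends to 0. The
    sublinear step forgets this constant, because its attracting range does not depend on [eta]. The
    linear step divides by [L] and so has to wait for [eta = 0]. The factor [e^(Kt)] reduces the
    cost of the linear convolution to [C1 / K]. Exponential weights have the explicit convolution
    constant [1 / (1 - |k|^2)]; it can be brought as close to 1 as the strict inequality on [p]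
    demands. *)

(* The library attaches the sigma-finite structure of [m1 \x m2] only to
   products of subprobabilities, hence this copy. *)
Section SigmaFiniteProduct.
Context d1 d2 (T1 : measurableType d1) (T2 : measurableType d2) (R : realType).
Variables (m1 : {sigma_finite_measure set T1 -> \bar R})
  (m2 : {sigma_finite_measure set T2 -> \bar R}).

Definition sfprod := (m1 \x m2)%E.

HB.instance Definition _ := Measure.on sfprod.

Let sfprod_sigma_finite : sigma_finite setT sfprod.
Proof.
have /sigma_finiteP[F [TF ndF Foo]] := sigma_finiteT m1.
have /sigma_finiteP[G [TG ndG Goo]] := sigma_finiteT m2.
exists (fun n => F n `*` G n) => [|n].
  apply/esym/seteqP; split=> // -[x y] _.
  have [i _ Fx] : (\bigcup_k F k) x by rewrite -TF.
  have [j _ Gy] : (\bigcup_k G k) y by rewrite -TG.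
  exists (maxn i j) => //; split=> /=.
    by move/subsetPset: (ndF _ _ (leq_maxl i j)); apply.
  by move/subsetPset: (ndG _ _ (leq_maxr i j)); apply.
have [[mF F1] [mG G1]] := (Foo n, Goo n).
split; first exact: measurableX.
by rewrite /sfprod product_measure1E// lte_mul_pinfty// ge0_fin_numE.
Qed.

HB.instance Definition _ := Measure_isSigmaFinite.Build _ _ _ sfprod
  sfprod_sigma_finite.

End SigmaFiniteProduct.

(** * Iterated integrals as integrals against one sigma-finite measure *)

Section IteratedIntegral.
Variable R : realType.

(* Semantic joint measurability: substituting measurable functions for the
   parameter and for all coordinates yields a measurable function. *)
Definition jmeas d (T : measurableType d) (G : T -> (nat -> R) -> \bar R) :=
  forall d' (T' : measurableType d') (f : T' -> T) (X : nat -> T' -> R),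
    measurable_fun setT f -> (forall k, measurable_fun setT (X k)) ->
    measurable_fun setT (fun w => G (f w) (X ^~ w)).

Lemma measurable_integralT d (T : measurableType d) (h : T * R -> \bar R) :
  measurable_fun setT h ->
  measurable_fun setT (fun w => (\int[@lebesgue_measure R]_t h (w, t))%E).
Proof.
move=> mh.
have -> : (fun w => (\int[@lebesgue_measure R]_t h (w, t))%E) =
  ((fun w => (\int[@lebesgue_measure R]_t h^\+ (w, t))%E) \-
   (fun w => (\int[@lebesgue_measure R]_t h^\- (w, t))%E))%E.
  apply/funext => w; rewrite [LHS]integralE.
  under eq_integral do rewrite funepos_comp/=.
  by under [X in (_ - X)%E = _]eq_integral do rewrite funeneg_comp/=.
apply: emeasurable_funB.
  by apply: measurable_fun_fubini_tonelli_F => //; exact: measurable_funepos.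
by apply: measurable_fun_fubini_tonelli_F => //; exact: measurable_funeneg.
Qed.

Lemma jmeas_upd d (T : measurableType d) (G : T -> (nat -> R) -> \bar R) m :
  jmeas G ->
  jmeas (fun wt : T * R => fun x => G wt.1 (fun k => if k == m then wt.2 else x k)).
Proof.
move=> mG d' T' f X mf mX.
apply: (mG _ _ (fst \o f) (fun k w => if k == m then (f w).2 else X k w)).
  exact: measurableT_comp.
by move=> k; case: (k == m); [exact: measurableT_comp|exact: mX].
Qed.

Lemma measurable_iint m d (T : measurableType d) (G : T -> (nat -> R) -> \bar R) :
  jmeas G -> measurable_fun setT (fun w => iint m (G w)).
Proof.
elim: m d T G => [|m IH] d T G mG /=.
  by apply: (mG _ _ id (fun=> cst 0)).
apply: (measurable_integralT (h := fun wt : T * R =>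
  iint m (fun x => G wt.1 (fun k => if k == m then wt.2 else x k)))).
exact: (IH _ _ _ (@jmeas_upd _ _ _ m mG)).
Qed.

(** [jmeas] without parameter. Testing by substitution avoids choosing a sigma-algebra on
    [nat -> R]. *)
Definition pmeas (g : (nat -> R) -> \bar R) :=
  forall d' (T' : measurableType d') (X : nat -> T' -> R),
    (forall k, measurable_fun setT (X k)) ->
    measurable_fun setT (fun w => g (X ^~ w)).

Lemma pmeas_upd g m : pmeas g ->
  jmeas (fun (t : R) x => g (fun k => if k == m then t else x k)).
Proof.
move=> mg d' T' f X mf mX.
apply: (mg _ _ (fun k w => if k == m then f w else X k w)) => k.
by case: (k == m).
Qed.

Lemma pmeas_updc g m (t : R) : pmeas g ->
  pmeas (fun x => g (fun k => if k == m then t else x k)).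
Proof.
move=> mg d' T' X mX; apply: (mg _ _ (fun k w => if k == m then t else X k w)) => k.
by case: (k == m).
Qed.

(** Induction on [m]: each new variable multiplies the measure by Lebesgue measure. Tonelli serves
    nonnegative integrands and Fubini integrable ones, hence the two clauses. *)
Lemma iint_model m : exists d (T : measurableType d)
  (mu : {sigma_finite_measure set T -> \bar R}) (X : nat -> T -> R),
  [/\ forall k, measurable_fun setT (X k),
      forall g, pmeas g -> (forall x, (0 <= g x)%E) ->
        iint m g = (\int[mu]_w g (X ^~ w))%E &
      forall g, pmeas g -> mu.-integrable setT (fun w => g (X ^~ w)) ->
        iint m g = (\int[mu]_w g (X ^~ w))%E].
Proof.
elim: m => [|m [d [T [mu [X [mX H1 H2]]]]]].
  exists default_measure_display, unit.
  exists (dirac tt : {sigma_finite_measure set unit -> \bar R}), (fun=> cst 0).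
  split=> // g mg _ /=; rewrite integral_dirac// diracT mul1e//.
exists _, (measurableTypeR R * T)%type.
exists (sfprod (@lebesgue_measure R) mu).
pose Y k (w : R * T) := if k == m then w.1 else X k w.2.
have mY k : measurable_fun setT (Y k).
  by rewrite /Y; case: (k == m) =>//; exact: measurableT_comp.
exists Y; split=> //= g mg g0.
  pose h (w : measurableTypeR R * T) := g (Y ^~ w).
  have mh : measurable_fun setT h by exact: (mg _ _ Y).
  rewrite [RHS](@fubini_tonelli1 _ _ (measurableTypeR R) T R
    (@lebesgue_measure R) mu h mh)//; last by move=> w; exact: g0.
  by apply: eq_integral => t _; rewrite H1//; exact: pmeas_updc.
have E := integral12_prod_meas1 g0.
rewrite -[RHS]E; apply: ae_eq_integral => //.
- by apply: (measurable_iint m); exact: pmeas_upd.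
- exact: (measurable_fubini_F g0).
have := ae_integrable1 g0.
apply: filterS => t it _ /=; rewrite H2//; exact: pmeas_updc.
Qed.

End IteratedIntegral.

(** * Measurability of continuous functions through rounding to grids *)

Section Discretisation.
Variable R : realType.

Lemma measurable_fun_countable d (T : measurableType d) (C : countType)
    (Z : T -> C) (h : C -> R) :
  (forall c, measurable (Z @^-1` [set c])) -> measurable_fun setT (h \o Z).
Proof.
move=> mZ _ A mA; rewrite setTI.
have -> : (h \o Z) @^-1` A =
    \bigcup_c (if pselect (A (h c)) then Z @^-1` [set c] else set0).
  apply/seteqP; split=> w /=.
    by move=> Aw; exists (Z w) => //; case: pselect.
  by move=> [c _]; case: pselect => //= Ac ->.
apply: countable_bigcupT_measurable => // c.
by case: (pselect (A (h c))) => _ /=; [exact: mZ|exact: measurable0].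
Qed.

(** Rounding down to the grid of mesh [1/(k+1)]. Arguments rounded this way take countably many
    values, so any function of them is measurable; continuity is needed only for the limit in
    [k]. *)
Definition dsc (k : nat) (r : R) : R :=
  (Num.floor (r * k.+1%:R))%:~R / k.+1%:R.

Lemma dsc_le k r : dsc k r <= r.
Proof. by rewrite /dsc ler_pdivrMr// floor_le_tmp. Qed.

Lemma dsc_ge k r : r - k.+1%:R^-1 <= dsc k r.
Proof.
rewrite /dsc ler_pdivlMr// mulrBl mulVf// lerBlDr ltW//.
by have := floorD1_gt (r * k.+1%:R); rewrite intrD.
Qed.

Lemma dsc_ge0 k r : 0 <= r -> 0 <= dsc k r.
Proof. by move=> r0; rewrite divr_ge0// ler0z floor_ge0 mulr_ge0. Qed.

Lemma dsc0 k : dsc k 0 = 0.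
Proof. by rewrite /dsc mul0r floor0 mul0r. Qed.

Lemma cvg_dsc r : dsc k r @[k --> \oo] --> r.
Proof.
apply: (@squeeze_cvgr _ _ _ _ (fun k => r - k.+1%:R^-1) (cst r)).
- by near=> k; rewrite dsc_ge dsc_le.
- rewrite -[X in _ --> X]subr0; apply: cvgB; first exact: cvg_cst.
  exact: cvg_harmonic.
- exact: cvg_cst.
Unshelve. all: by end_near. Qed.

Definition mrow n d (T : measurableType d) (Y : T -> 'rV[R]_n) :=
  forall i, measurable_fun setT (fun w => Y w ord0 i).

Lemma measurable_floor_fiber d (T : measurableType d) (g : T -> R) (z : int) :
  measurable_fun setT g -> measurable [set w | Num.floor (g w) = z].
Proof.
move=> mg.
have -> : [set w | Num.floor (g w) = z] = g @^-1` `[z%:~R, (z + 1)%:~R[.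
  apply/seteqP; split=> w /=; rewrite in_itv/=.
    by move=> <-; rewrite floor_le_tmp floorD1_gt.
  by move=> H; apply/floor_def.
by rewrite -[X in measurable X]setTI; apply: mg.
Qed.

Lemma measurable_dsc n d (T : measurableType d) (Y : T -> 'rV[R]_n) (S : T -> R)
    (f : 'rV[R]_n -> R -> R) k :
  mrow Y -> measurable_fun setT S ->
  measurable_fun setT (fun w => f (map_mx (dsc k) (Y w)) (dsc k (S w))).
Proof.
move=> mY mS.
pose fl (r : R) : int := Num.floor (r * k.+1%:R).
pose Z w : 'rV[int]_n * int := (map_mx fl (Y w), fl (S w)).
pose h (z : 'rV[int]_n * int) :=
  f (map_mx (fun i : int => i%:~R / k.+1%:R) z.1) (z.2%:~R / k.+1%:R).
have -> : (fun w => f (map_mx (dsc k) (Y w)) (dsc k (S w))) = h \o Z.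
  apply/funext => w; rewrite /h /Z /=; congr f.
  by apply/rowP => i; rewrite !mxE.
apply: measurable_fun_countable => -[z s].
have -> : Z @^-1` [set (z, s)] =
    (\bigcap_(i in setT) [set w | fl (Y w ord0 i) = z ord0 i]) `&`
    [set w | fl (S w) = s].
  apply/seteqP; split=> w /=.
    by case=> <- <-; split=> // i _ /=; rewrite mxE.
  by move=> [H1 H2]; congr pair => //; apply/rowP => i; rewrite mxE; exact: H1.
apply: measurableI; last by apply: measurable_floor_fiber; exact: measurable_funM.
apply: fin_bigcap_measurable => [|i _]; first exact: finite_finset.
by apply: measurable_floor_fiber; exact: measurable_funM.
Qed.

Lemma measurable_dsc_cvg n d (T : measurableType d) (Y : T -> 'rV[R]_n)
    (S : T -> R) (f : 'rV[R]_n -> R -> R) :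
  mrow Y -> measurable_fun setT S ->
  (forall w, f (map_mx (dsc k) (Y w)) (dsc k (S w)) @[k --> \oo] --> f (Y w) (S w)) ->
  measurable_fun setT (fun w => f (Y w) (S w)).
Proof.
move=> mY mS H.
apply: (measurable_fun_cvg (h := fun k w =>
  f (map_mx (dsc k) (Y w)) (dsc k (S w)))) => [k|w _]; last exact: H.
exact: measurable_dsc.
Qed.

Lemma row_norm_le n (x : 'rV[R]_n) (e : R) : 0 <= e ->
  (forall i, `|x ord0 i| <= e) -> `|x| <= e.
Proof.
move=> e0 H; rewrite /Num.norm/= mx_normrE; apply: bigmax_le => // -[i j] _ /=.
by rewrite (ord1 i).
Qed.

Lemma cvg_dsc_row n (x : 'rV[R]_n) : map_mx (dsc k) x @[k --> \oo] --> x.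
Proof.
apply/cvgrPdist_le => e e0.
have : \forall k \near \oo, (k.+1%:R^-1 : R) <= e.
  have /cvgrPdist_le/(_ _ e0) := @cvg_harmonic R.
  by apply: filterS => k; rewrite sub0r normrN /harmonic/= ger0_norm.
apply: filterS => k ke; apply: row_norm_le => [|i]; first exact: ltW.
rewrite !mxE ger0_norm ?subr_ge0 ?dsc_le//.
by rewrite lerBlDr -lerBlDl (le_trans _ (dsc_ge _ _))// lerB.
Qed.

(** The origin belongs to every grid: where [Y w = 0] the approximants are constantly [f 0], and
    continuity there is not called upon. *)
Lemma measurable_continuous_off0 n d (T : measurableType d) (Y : T -> 'rV[R]_n)
    (f : 'rV[R]_n -> R) : (forall x, x != 0 -> {for x, continuous f}) ->
  mrow Y -> measurable_fun setT (fun w => f (Y w)).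
Proof.
move=> cf mY.
apply: (measurable_dsc_cvg (S := cst 0) (f := fun x _ => f x)) => // w.
have [->|/cf cw] := eqVneq (Y w) 0.
  rewrite (_ : (fun k => _) = cst (f 0)); first exact: cvg_cst.
  apply/funext => k; congr f; apply/rowP => i; rewrite !mxE; exact: dsc0.
apply: (@cvg_comp _ _ _ (fun k => map_mx (dsc k) (Y w)) f _ _ _ _ cw).
exact: cvg_dsc_row.
Qed.

Lemma measurable_continuous_row n d (T : measurableType d) (Y : T -> 'rV[R]_n)
    (f : 'rV[R]_n -> R) : continuous f ->
  mrow Y -> measurable_fun setT (fun w => f (Y w)).
Proof. by move=> cf; apply: measurable_continuous_off0 => x _; exact: cf. Qed.

End Discretisation.

(** * The integral over R^n: representation, reflection, negligible points *)

Section SpaceIntegral.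
Variable R : realType.
Local Notation leb := (@lebesgue_measure R).

Definition vmeas n (f : 'rV[R]_n -> \bar R) :=
  forall d (T : measurableType d) (Y : T -> 'rV[R]_n), mrow Y ->
    measurable_fun setT (fun w => f (Y w)).

Lemma mrow_row n d (T : measurableType d) (X : nat -> T -> R) :
  (forall k, measurable_fun setT (X k)) -> mrow (fun w => \row_(i < n) X i w).
Proof.
move=> mX i; rewrite (_ : (fun w => _) = X i)//.
by apply/funext => w; rewrite mxE.
Qed.

Lemma vmeas_pmeas n (f : 'rV[R]_n -> \bar R) : vmeas f ->
  pmeas (fun x => f (\row_(i < n) x i)).
Proof.
move=> mf d T X mX; apply: (mf _ _ (fun w => \row_(i < n) X i w)).
exact: mrow_row.
Qed.

Lemma intRn_model n : exists d (T : measurableType d)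
  (mu : {sigma_finite_measure set T -> \bar R}) (X : T -> 'rV[R]_n),
  [/\ mrow X,
      forall f, vmeas f -> (forall x, (0 <= f x)%E) ->
        intRn f = (\int[mu]_w f (X w))%E &
      forall f, vmeas f -> mu.-integrable setT (fun w => f (X w)) ->
        intRn f = (\int[mu]_w f (X w))%E].
Proof.
have [d [T [mu [X [mX H1 H2]]]]] := iint_model R n.
exists d, T, mu, (fun w => \row_(i < n) X i w); split=> [|f mf f0|f mf fi].
- exact: mrow_row.
- by rewrite /intRn H1//; exact: vmeas_pmeas.
- by rewrite /intRn H2//; exact: vmeas_pmeas.
Qed.

Lemma lebesgue_reflect (c : R) (A : set R) : measurable A ->
  leb ((fun t => c - t) @^-1` A) = leb A.
Proof.
move=> mA.
have mphi : measurable_fun setT (fun t : measurableTypeR R => c - t : measurableTypeR R).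
  exact: measurable_funB.
pose phi : {mfun measurableTypeR R >-> measurableTypeR R} :=
  HB.pack (fun t : measurableTypeR R => c - t : measurableTypeR R)
    (isMeasurableFun.Build _ _ _ _ _ mphi).
apply/esym.
rewrite (@lebesgue_measure_unique R (pushforward leb phi))//.
move=> X [[a b]] /= _ <-.
have E : (fun t => c - t) @^-1` `]a, b] = `[c - b, c - a[%classic :> set R.
  apply/seteqP; split=> t /=; rewrite !in_itv/= => /andP[h1 h2]; apply/andP; lra.
rewrite /pushforward/= E !lebesgue_measure_itv/= !lte_fin.
have -> : (c - b < c - a) = (a < b) by rewrite ltrD2l ltrN2.
case: ifP => // _; rewrite -!EFinB; congr EFin; lra.
Qed.

Lemma integral_reflect (c : R) (h : R -> \bar R) :
  measurable_fun setT h -> (forall t, (0 <= h t)%E) ->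
  (\int[leb]_t h (c - t)%R = \int[leb]_t h t)%E.
Proof.
move=> mh h0.
have mphi : measurable_fun setT (fun t : measurableTypeR R => c - t : measurableTypeR R).
  exact: measurable_funB.
pose phi : {mfun measurableTypeR R >-> measurableTypeR R} :=
  HB.pack (fun t : measurableTypeR R => c - t : measurableTypeR R)
    (isMeasurableFun.Build _ _ _ _ _ mphi).
transitivity (\int[pushforward leb phi]_t h t)%E.
  rewrite (ge0_integral_pushforward mphi)//.
by apply: eq_measure_integral => A mA _; exact: lebesgue_reflect.
Qed.

Lemma iint_reflect m (x : nat -> R) (g : (nat -> R) -> \bar R) :
  pmeas g -> (forall z, (0 <= g z)%E) ->
  iint m (fun y => g (fun k => if (k < m)%N then x k - y k else y k)) = iint m g.
Proof.
elim: m g => [//|m IH] g mg g0 /=.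
pose h t := iint m (fun z => g (fun k => if k == m then t else z k)).
transitivity (\int[leb]_t h (x m - t)%R)%E.
  apply: eq_integral => t _; rewrite /h -[RHS]IH//; last exact: pmeas_updc.
  congr (iint m _); apply/funext => y; congr g; apply/funext => k.
  have [->|km] := eqVneq k m; first by rewrite ltnSn.
  by rewrite ltnS leq_eqVlt (negbTE km).
apply: integral_reflect; first by apply: (measurable_iint m); exact: pmeas_upd.
move=> t; rewrite /h; have [d [T [mu [X [mX H1 H2]]]]] := iint_model R m.
rewrite H1//; [exact: integral_ge0|exact: pmeas_updc].
Qed.

Lemma intRn_reflect n (x : 'rV[R]_n) (f : 'rV[R]_n -> \bar R) :
  vmeas f -> (forall z, (0 <= f z)%E) ->
  intRn (fun y => f (x - y)) = intRn f.
Proof.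
move=> mf f0; rewrite /intRn -[RHS](@iint_reflect n
  (fun k => oapp (fun i => x ord0 i) 0 (insub k : option 'I_n))) => //.
  congr (iint n _); apply/funext => y; congr f; apply/rowP => i; rewrite !mxE.
  by rewrite ltn_ord valK.
exact: vmeas_pmeas.
Qed.

(** The point is already negligible in the outermost variable: the inner integrals agree unless [t]
    is the last coordinate of [c]. In dimension zero a point has mass one, hence [n.+1]. *)
Lemma intRn_eq_off n (c : 'rV[R]_n.+1) (f g : 'rV[R]_n.+1 -> \bar R) :
  vmeas f -> vmeas g -> (forall x, x != c -> f x = g x) -> intRn f = intRn g.
Proof.
move=> mf mg fg; rewrite /intRn/=.
have [mf' mg'] := (vmeas_pmeas mf, vmeas_pmeas mg).
apply: ae_eq_integral => //.
- exact: (measurable_iint n (@pmeas_upd R _ n mf')).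
- exact: (measurable_iint n (@pmeas_upd R _ n mg')).
exists [set c ord0 ord_max]; split; [exact: measurable_set1|exact: lebesgue_measure_set1|].
move=> t /= H; apply/eqP/negPn/negP => tc; apply: H => _.
congr (iint n _); apply/funext => x; apply: fg.
apply/negP => /eqP/rowP/(_ ord_max); rewrite !mxE eqxx => /eqP.
exact/negP.
Qed.

End SpaceIntegral.

(** * Differentiation rules on the real line *)

Section RealDerivatives.
Variable R : realType.
Implicit Types (f g : R -> R) (x a b : R).

Lemma derD f g x a b : is_derive x 1 f a -> is_derive x 1 g b ->
  is_derive x 1 (fun y => f y + g y) (a + b).
Proof. by move=> ? ?; exact: is_deriveD. Qed.

Lemma derM f g x a b : is_derive x 1 f a -> is_derive x 1 g b ->
  is_derive x 1 (fun y => f y * g y) (a * g x + f x * b).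
Proof.
move=> df dg; have H := is_deriveM df dg.
by apply: (is_derive_eq H); rewrite addrC /GRing.scale/= (mulrC a).
Qed.

Lemma derC c x : is_derive x 1 (fun=> c : R) (0 : R).
Proof. exact: is_derive_cst. Qed.

Lemma derI x : is_derive x 1 (fun y => y) (1 : R).
Proof. exact: is_derive_id. Qed.

Lemma der_comp (h : R -> R) f x a c : is_derive (f x) 1 h c ->
  is_derive x 1 f a -> is_derive x 1 (fun y => h (f y)) (a * c).
Proof.
move=> dh df; have H := is_derive1_comp dh df.
by apply: (is_derive_eq H); rewrite mulrC.
Qed.

Lemma der_exp f x a : is_derive x 1 f a ->
  is_derive x 1 (fun y => expR (f y)) (a * expR (f x)).
Proof. exact: der_comp. Qed.

Lemma der_continuous f x a : is_derive x 1 f a -> {for x, continuous f}.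
Proof.
by move=> [d _]; apply: differentiable_continuous; exact/derivable1_diffP.
Qed.

End RealDerivatives.

(** * Fourier transform of the one-dimensional Gaussian *)

Section GaussFourier.
Variable R : realType.
Local Notation leb := (@lebesgue_measure R).

(** The fundamental theorem on [[-(n+1), n+1]], then dominated convergence. *)
Lemma integral_derive_line (f g : R -> R) :
  (forall x : R, is_derive x 1 f (g x)) -> continuous g ->
  leb.-integrable setT (EFin \o g) ->
  (f n.+1%:R - f (- n.+1%:R) @[n --> \oo] --> 0) ->
  (\int[leb]_x (g x)%:E = 0)%E.
Proof.
move=> df cg ig f0.
pose D n : set R := `[- n.+1%:R, n.+1%:R]%classic.
pose h n := (EFin \o g) \_ (D n).
have hn n : (\int[leb]_x h n x)%E = (f n.+1%:R - f (- n.+1%:R))%:E.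
  rewrite -integral_mkcond /D.
  rewrite (@continuous_FTC2 _ g f)//.
  - by rewrite gtrN.
  - exact: continuous_subspaceT.
  - have cf x : {for x, continuous f} by exact: der_continuous (df x).
    split.
    + by move=> x _; exact: ex_derive.
    + by apply: cvg_at_right_filter; exact: cf.
    + by apply: cvg_at_left_filter; exact: cf.
  - by move=> x _; rewrite derive1E; exact: derive_val.
have mg : measurable_fun setT (EFin \o g) by exact: measurable_int ig.
have : (\int[leb]_x h n x)%E @[n --> \oo] --> (\int[leb]_x (g x)%:E)%E.
  apply: (@dominated_cvg _ _ _ leb setT measurableT h _ (fun x => `|(g x)%:E|%E)).
  - move=> n; apply/(measurable_restrictT _ _).1 => //; first exact: measurable_itv.
    exact: measurable_funTS.
  - move=> x _; apply: cvg_near_cst.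
    have [k kx] : exists k : nat, `|x| <= k%:R.
      by exists (Num.truncn `|x|).+1; rewrite ltW// truncnS_gt.
    exists k => // n /= kn; rewrite /h patchE mem_set//= /D/=.
    rewrite in_itv/= -ler_norml (le_trans kx)// ler_nat.
    exact: leqW.
  - by [].
  - exact: integrable_abse.
  - by move=> n x _; rewrite /h patchE; case: ifP => _ //; rewrite abse0.
under eq_fun do rewrite hn.
move=> H.
have H0 : (f n.+1%:R - f (- n.+1%:R))%:E @[n --> \oo] --> (0%:E : \bar R).
  by apply: cvg_EFin => //; exact: nearW.
exact: (cvg_unique _ H H0).
Qed.

Variable t : R.
Hypothesis t0 : 0 < t.

Lemma integral_gauss (c : R) :
  (\int[leb]_x (expR (- t * (x - c) ^+ 2))%:E = (Num.sqrt (pi / t))%:E)%E.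
Proof.
(* The normal law of variance [1/(2t)] has exponent [-t(x-c)^2]. *)
pose s := Num.sqrt ((t *+ 2)^-1).
have s2 : s ^+ 2 = (t *+ 2)^-1 by rewrite sqr_sqrtr// invr_ge0 mulrn_wge0// ltW.
have s0 : s != 0 by rewrite gt_eqF// sqrtr_gt0 invr_gt0 mulrn_wgt0.
have := @integral_normal_pdf R c s; rewrite normal_pdfE//.
have -> : Num.sqrt (pi / t) = (normal_peak s)^-1.
  rewrite /normal_peak invrK s2; congr Num.sqrt.
  by field; rewrite gt_eqF.
have pk : 0 < normal_peak s by exact: normal_peak_gt0.
under eq_integral do rewrite EFinM.
rewrite ge0_integralZl_EFin//; last 3 first.
- by move=> x _; rewrite lee_fin expR_ge0.
- by apply/measurable_EFinP; exact: measurable_normal_fun.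
- exact: ltW.
move=> H; have -> : (\int[leb]_x (expR (- t * (x - c) ^+ 2))%:E =
    \int[leb]_x (normal_fun c s x)%:E)%E.
  apply: eq_integral => x _; rewrite /normal_fun s2; congr (expR _)%:E.
  by field; rewrite gt_eqF.
have : (((normal_peak s)^-1)%:E * ((normal_peak s)%:E * \int[leb]_x (normal_fun c s x)%:E) =
  ((normal_peak s)^-1)%:E)%E by rewrite H mule1.
by rewrite muleA -EFinM mulVf ?gt_eqF// mul1e.
Qed.

Lemma continuous_gausst (c : R) : continuous (fun x : R => expR (- c * x ^+ 2)).
Proof.
by move=> x; apply: der_continuous.
Qed.

End GaussFourier.

Section GaussFourier2.
Variable R : realType.
Local Notation leb := (@lebesgue_measure R).
Variable t : R.
Hypothesis t0 : 0 < t.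

Lemma integrable_gausst (c : R) : 0 < c ->
  leb.-integrable setT (EFin \o (fun x => expR (- c * x ^+ 2))).
Proof.
move=> c0; apply/integrableP; split.
  apply/measurable_EFinP; apply: continuous_measurable_fun => x.
  exact: continuous_gausst.
rewrite (_ : integral _ _ _ = (Num.sqrt (pi / c))%:E) ?ltry//.
rewrite -(@integral_gauss R c c0 0); apply: eq_integral => x _ /=.
by rewrite subr0 ger0_norm ?expR_ge0.
Qed.

Lemma gauss_dominated (h : R -> R) (c M : R) : 0 < c -> continuous h ->
  (forall x, `|h x| <= M * expR (- c * x ^+ 2)) ->
  leb.-integrable setT (EFin \o h).
Proof.
move=> c0 ch hM.
apply: (@le_integrable _ _ _ leb setT measurableT _
  (EFin \o (fun x => M * expR (- c * x ^+ 2)))).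
- by apply/measurable_EFinP; exact: continuous_measurable_fun.
- by move=> x _ /=; rewrite lee_fin (le_trans (hM x))// ler_norm.
- have -> : EFin \o (fun x => M * expR (- c * x ^+ 2)) =
     (fun x => M%:E * (EFin \o (fun x => expR (- c * x ^+ 2))) x)%E by [].
  by apply: integrableZl => //; exact: integrable_gausst.
Qed.

Let f (th w y : R) := expR (- t * y ^+ 2) * cos (th + w * y).
Let fs (th w y : R) := expR (- t * y ^+ 2) * sin (th + w * y).

Let der_cosw (th y w : R) : is_derive w 1 (fun w => cos (th + w * y)) (- (y * sin (th + w * y))).
Proof.
by apply: is_derive_eq; rewrite /GRing.scale/=; ring.
Qed.

Let der_f_w (th w y : R) : is_derive w 1 (f th ^~ y) (- (y * fs th w y)).
Proof.
by apply: is_derive_eq; rewrite /GRing.scale/= /fs; ring.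
Qed.

Let der_fs_y (th w y : R) : is_derive y 1 (fs th w)
  (w * f th w y - 2 * t * (y * fs th w y)).
Proof.
by apply: is_derive_eq; rewrite /GRing.scale/= /fs /f; ring.
Qed.

Let cf th w : continuous (f th w).
Proof.
by move=> y; apply: der_continuous.
Qed.

Let cyfs (th w : R) : continuous (fun y : R => y * fs th w y).
Proof.
by move=> y; apply: der_continuous.
Qed.

Let if_ th w : leb.-integrable setT (EFin \o f th w).
Proof.
apply: (@gauss_dominated _ t 1) => //.
move=> y; rewrite mul1r /f normrM ger0_norm ?expR_ge0// ler_piMr ?expR_ge0//.
by rewrite ler_norml cos_geN1 cos_le1.
Qed.

(** Majorant of [y * fs th w y] that is uniform in [w]: half of the Gaussian absorbs the factor
    [y]. *)
Let G (y : R) := (1 + 2 / t) * expR (- (t / 2) * y ^+ 2).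

Let yfs_le th w y : `|y * fs th w y| <= G y.
Proof.
rewrite /fs /G mulrA normrM.
have e0 : 0 < expR (- (t / 2) * y ^+ 2) by exact: expR_gt0.
apply: (@le_trans _ _ `|y * expR (- t * y ^+ 2)|).
  by rewrite ler_piMr// ler_norml sin_geN1 sin_le1.
rewrite normrM (ger0_norm (expR_ge0 _)).
have -> : expR (- t * y ^+ 2) = expR (- (t / 2) * y ^+ 2) * expR (- (t / 2) * y ^+ 2).
  by rewrite -expRD; congr expR; field.
rewrite mulrA ler_wpM2r ?expR_ge0//.
rewrite mulNr expRN ler_pdivrMr ?expR_gt0//.
have e1 := expR_ge1Dx (t / 2 * y ^+ 2).
have y2 : `|y| <= 1 + y ^+ 2.
  by rewrite -real_normK ?num_real//; have := sqr_ge0 (`|y| - 1); nra.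
have t2 : 0 < t^-1 by rewrite invr_gt0.
apply: (le_trans y2); apply: (@le_trans _ _ ((1 + 2 / t) * (1 + t / 2 * y ^+ 2))).
  have -> : (1 + 2 / t) * (1 + t / 2 * y ^+ 2) = 1 + y ^+ 2 + (2 / t + t / 2 * y ^+ 2).
    by field; rewrite gt_eqF.
  by rewrite lerDl addr_ge0// mulr_ge0 ?sqr_ge0 ?divr_ge0 ?(ltW t0)// ltW.
by rewrite ler_wpM2l// addr_ge0// divr_ge0// ltW.
Qed.

Let iG : leb.-integrable setT (EFin \o G).
Proof.
apply: (@gauss_dominated _ (t / 2) (1 + 2 / t)); first by rewrite divr_gt0.
- by move=> x; apply: der_continuous.
- by move=> x; rewrite ger0_norm// mulr_ge0 ?expR_ge0// addr_ge0// divr_ge0// ltW.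
Qed.

Let iyfs th w : leb.-integrable setT (EFin \o (fun y => y * fs th w y)).
Proof.
apply: (@gauss_dominated _ (t / 2) (1 + 2 / t)); first by rewrite divr_gt0.
- exact: cyfs.
- exact: yfs_le.
Qed.

Let F th w := (\int[leb]_y f th w y)%R.

(** Integration by parts: the [y]-derivative of [fs th w] has integral zero. *)
Let F_parts th w :
  (\int[leb]_y (y * fs th w y))%R = w / (2 * t) * F th w.
Proof.
pose g y := w * f th w y - 2 * t * (y * fs th w y).
have i1 : leb.-integrable setT (EFin \o (fun y => w * f th w y)).
  by apply: (integrableZl measurableT w (if_ th w)).
have i2 : leb.-integrable setT (EFin \o (fun y => 2 * t * (y * fs th w y))).
  by apply: (integrableZl measurableT (2 * t) (iyfs th w)).
have ig : leb.-integrable setT (EFin \o g) by exact: (integrableB measurableT i1 i2).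
have : (\int[leb]_y (g y)%:E = 0)%E.
  apply: (@integral_derive_line _ (fs th w)).
  - by move=> y; exact: der_fs_y.
  - by move=> y; apply: der_continuous.
  - exact: ig.
  - apply: norm_cvg0.
    apply: (@squeeze_cvgr _ _ _ _ (cst 0) (fun n => 2 / t * n.+1%:R^-1)).
    + near=> n; rewrite normr_ge0/= /fs sqrrN.
      rewrite -mulrBr normrM (ger0_norm (expR_ge0 _)).
      have hs x : `|sin x| <= 1 :> R by rewrite ler_norml sin_geN1 sin_le1.
      have h2 (x y : R) : `|sin x - sin y| <= 2.
        by rewrite (le_trans (ler_normB _ _))// -[2]/(1 + 1) lerD.
      rewrite mulNr expRN [leRHS](_ : _ = (t * n.+1%:R)^-1 * 2); last first.
        by rewrite invfM [RHS]mulrC mulrA.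
      rewrite ler_pM ?invr_ge0 ?expR_ge0//.
      rewrite lef_pV2 ?posrE ?expR_gt0 ?mulr_gt0//.
      apply: le_trans (expR_ge1Dx _).
      apply: (@le_trans _ _ (t * n.+1%:R ^+ 2)); last by rewrite lerDr.
      rewrite ler_pM2l// expr2 ler_peMr//.
      by rewrite (ler_nat R 1 n.+1).
    + exact: cvg_cst.
    + rewrite -[X in _ --> X](mulr0 (2 / t)); apply: cvgM; first exact: cvg_cst.
      exact: cvg_harmonic.
move=> H.
have : (\int[leb]_y g y)%R = 0 by rewrite /Rintegral H.
rewrite /g RintegralB// !RintegralZl//.
move=> /eqP; rewrite subr_eq0 => /eqP E.
rewrite /F mulrAC E; field; rewrite gt_eqF//.
Unshelve. all: by end_near. Qed.

Let dF (th w : R) : is_derive w 1 (F th) (- (w / (2 * t) * F th w)).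
Proof.
have Ia : (`](w - 1), (w + 1)[%classic : set R) w.
  by rewrite /= in_itv/=; apply/andP; split; lra.
have d1 x y : partial1of2 (f th) x y = - (y * fs th x y).
  by rewrite partial1of2E; exact: derive_val.
have H1 x : (`](w - 1), (w + 1)[%classic : set R) x ->
  leb.-integrable setT (EFin \o f th x).
  by move=> _; exact: if_.
have H2 x y : (`](w - 1), (w + 1)[%classic : set R) x -> setT y ->
  derivable (f th ^~ y) x 1 by move=> _ _; exact: ex_derive.
have H3 x y : (`](w - 1), (w + 1)[%classic : set R) x -> setT y ->
  `|partial1of2 (f th) x y| <= G y by move=> _ _; rewrite d1 normrN.
have G0 y : 0 <= G y.
  by rewrite mulr_ge0 ?expR_ge0// addr_ge0// divr_ge0// ltW.
apply: DeriveDef.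
  exact: (derivable_under_integral measurableT Ia H1 H2 G0 iG H3).
rewrite -derive1E.
rewrite (differentiation_under_integral measurableT Ia H1 H2 G0 iG H3).
under eq_Rintegral do rewrite d1.
rewrite -F_parts -[RHS]mulN1r -RintegralZl//.
by under [in RHS]eq_Rintegral do rewrite mulN1r.
Qed.

(** As a function of [w] the integral solves [F' = -(w/(2t)) F], so its product with [e^(w^2/(4t))]
    is constant. The phase [th] will carry the remaining coordinates in the induction on dimension,
    which keeps all integrals real. *)
Lemma gauss_fourier (th w : R) :
  (\int[leb]_y (expR (- t * y ^+ 2) * cos (th + w * y))%:E =
   (cos th * (Num.sqrt (pi / t) * expR (- (w ^+ 2) / (4 * t))))%:E)%E.
Proof.
have F0 : F th 0 = cos th * Num.sqrt (pi / t).
  rewrite /F /Rintegral /f.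
  under eq_integral do rewrite mul0r addr0 mulrC EFinM.
  rewrite integralZl//; last exact: (integrable_gausst t0).
  rewrite (_ : (\int[leb]_x _)%E = (Num.sqrt (pi / t))%:E) -?EFinM//.
  by rewrite -(integral_gauss t0 0); under [RHS]eq_integral do rewrite subr0.
have HF : F th w * expR (w ^+ 2 / (4 * t)) = F th 0 * expR (0 ^+ 2 / (4 * t)).
  apply: (@is_derive_0_is_cst _ (fun w => F th w * expR (w ^+ 2 / (4 * t)))) => x.
  have dFx := dF th x.
  apply: (is_derive_eq (derM dFx (der_exp (derM (derM (derI x) (derI x)) (derC _ x))))).
  by field; rewrite gt_eqF.
have -> : (\int[leb]_y (f th w y)%:E)%E = (F th w)%:E.
  by rewrite /F /Rintegral fineK//; exact: (integrable_fin_num measurableT (if_ th w)).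
congr EFin.
rewrite expr0n/= mul0r expR0 mulr1 F0 in HF.
rewrite mulrA -HF -mulrA -expRD mulNr subrr expR0 mulr1//.
Qed.

Lemma integrable_gauss_fourier (th w : R) : leb.-integrable setT
  (fun y : R => (expR (- t * y ^+ 2) * cos (th + w * y))%:E).
Proof. exact: if_. Qed.

End GaussFourier2.

(** * Heat kernels on R^n, their Fourier transforms and their action on exponentials *)

Section HeatKernel.
Variable R : realType.
Local Notation leb := (@lebesgue_measure R).

Definition hk (t y : R) : R := expR (- y ^+ 2 / (4 * t)) / Num.sqrt (4 * pi * t).

Definition heat n (t : R) (y : 'rV[R]_n) : R := \prod_i hk t (y ord0 i).

(** The Fourier transform of [heat t]. *)
Definition gauss n (t : R) (xi : 'rV[R]_n) : R :=
  \prod_i expR (- t * xi ord0 i ^+ 2).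

Lemma hk_gt0 t y : 0 < t -> 0 < hk t y.
Proof.
by move=> t0; rewrite divr_gt0 ?expR_gt0// sqrtr_gt0 !mulr_gt0 ?pi_gt0.
Qed.

Lemma expR_sumE (I : finType) (F : I -> R) :
  \prod_i expR (F i) = expR (\sum_i F i).
Proof. by rewrite (big_morph _ (@expRD R) (@expR0 R)). Qed.

Lemma gaussE n t (xi : 'rV[R]_n) : gauss t xi = expR (- t * edot xi xi).
Proof. by rewrite /gauss expR_sumE /edot mulr_sumr. Qed.

Lemma heatE n t (y : 'rV[R]_n) :
  heat t y = (Num.sqrt (4 * pi * t))^-1 ^+ n * expR (- edot y y / (4 * t)).
Proof.
rewrite /heat /hk big_split/= expR_sumE prodr_const card_ord mulrC; congr (_ * expR _).
by rewrite /edot -sumrN mulr_suml.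
Qed.

Lemma edot_ge0 n (y : 'rV[R]_n) : 0 <= edot y y.
Proof. by apply: sumr_ge0 => i _; rewrite -expr2 sqr_ge0. Qed.

Lemma enorm_sqr n (y : 'rV[R]_n) : enorm y ^+ 2 = edot y y.
Proof.
rewrite /enorm sqr_sqrtr; last by apply: sumr_ge0 => i _; exact: sqr_ge0.
by apply: eq_bigr => i _; rewrite expr2.
Qed.

Lemma heat_gt0 n t (y : 'rV[R]_n) : 0 < t -> 0 < heat t y.
Proof. by move=> t0; apply: prodr_gt0 => i _; exact: hk_gt0. Qed.

Lemma sqrt_pi_hk t w : 0 < t ->
  Num.sqrt (pi / t) * expR (- (w ^+ 2) / (4 * t)) = 2 * pi * hk t w.
Proof.
move=> t0; rewrite /hk mulrCA mulrC; congr (_ * _).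
have s0 : 0 < Num.sqrt (4 * pi * t) by rewrite sqrtr_gt0 !mulr_gt0 ?pi_gt0.
apply: (mulIf (lt0r_neq0 s0)); rewrite divfK ?gt_eqF//.
rewrite -sqrtrM ?divr_ge0 ?pi_ge0 ?(ltW t0)//.
have -> : pi / t * (4 * pi * t) = (2 * pi) ^+ 2 :> R.
  by field; rewrite gt_eqF.
by rewrite sqrtr_sqr ger0_norm// mulr_ge0 ?pi_ge0.
Qed.

Lemma iint_gauss_fourier m (t : R) (w : nat -> R) (c th : R) : 0 < t ->
  iint m (fun xi => (c * (\prod_(i < m) expR (- t * xi i ^+ 2))
      * cos (th + \sum_(i < m) w i * xi i))%:E)
  = (c * cos th * \prod_(i < m) (2 * pi * hk t (w i)))%:E.
Proof.
move=> t0; elim: m c th => [|m IH] c th /=.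
  by rewrite !big_ord0 addr0 !mulr1.
transitivity (\int[leb]_s ((c * \prod_(i < m) (2 * pi * hk t (w i)))%:E *
    (expR (- t * s ^+ 2) * cos (th + w m * s))%:E))%E.
  apply: eq_integral => s _.
  rewrite -EFinM [RHS](_ : _ = (c * expR (- t * s ^+ 2) * cos (th + w m * s) *
    \prod_(i < m) (2 * pi * hk t (w i)))%:E); last by congr EFin; ring.
  rewrite -IH; congr (iint m _); apply/funext => x; congr EFin.
  rewrite !big_ord_recr/= eqxx.
  have -> : \prod_(i < m) expR (- t * (if i == m :> nat then s else x i) ^+ 2) =
    \prod_(i < m) expR (- t * x i ^+ 2).
    by apply: eq_bigr => i _; rewrite ltn_eqF.
  have -> : \sum_(i < m) w i * (if i == m :> nat then s else x i) =
    \sum_(i < m) w i * x i.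
    by apply: eq_bigr => i _; rewrite ltn_eqF.
  by rewrite -(addrA th) (addrC (w m * s)); ring.
rewrite integralZl//; last exact: integrable_gauss_fourier.
rewrite gauss_fourier// sqrt_pi_hk// -EFinM big_ord_recr/=; congr EFin; ring.
Qed.

Lemma intRn_gauss_fourier n (t : R) (w : 'rV[R]_n) (c th : R) : 0 < t ->
  intRn (fun xi => (c * gauss t xi * cos (th + edot w xi))%:E)
  = (c * cos th * ((2 * pi) ^+ n * heat t w))%:E.
Proof.
move=> t0.
pose w' k := oapp (fun i => w ord0 i) 0 (insub k : option 'I_n).
have ww (i : 'I_n) : w' i = w ord0 i by rewrite /w' valK.
rewrite /intRn -[(2 * pi) ^+ n](_ : \prod_(i < n) (2 * pi) = _); last first.
  by rewrite prodr_const card_ord.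
rewrite /heat -big_split/=.
rewrite -[RHS](_ : (c * cos th * \prod_(i < n) (2 * pi * hk t (w' i)))%:E = _).
  rewrite -iint_gauss_fourier//; congr (iint n _); apply/funext => x; congr EFin.
  rewrite /gauss /edot.
  under eq_bigr do rewrite mxE.
  by under [X in th + X]eq_bigr do rewrite mxE -ww.
by congr (_ * _)%:E; apply: eq_bigr => i _; rewrite ww.
Qed.

Lemma iint_prod m (f : nat -> R -> R) (r : nat -> R) (c : R) :
  (forall i, measurable_fun setT (f i)) -> (forall i y, 0 <= f i y) ->
  (forall i, (\int[leb]_y (f i y)%:E = (r i)%:E)%E) -> 0 <= c ->
  iint m (fun y => (c * \prod_(i < m) f i (y i))%:E) = (c * \prod_(i < m) r i)%:E.
Proof.
move=> mf f0 fr; elim: m c => [|m IH] c c0 /=; first by rewrite !big_ord0.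
have r0 i : 0 <= r i by rewrite -lee_fin -fr integral_ge0// => y _; rewrite lee_fin.
transitivity (\int[leb]_s ((c * \prod_(i < m) r i)%:E * (f m s)%:E))%E.
  apply: eq_integral => s _.
  rewrite -EFinM mulrAC -IH ?mulr_ge0//; congr (iint m _); apply/funext => x; congr EFin.
  rewrite !big_ord_recr/= eqxx mulrA mulrAC; congr (_ * _ * _).
  by apply: eq_bigr => i _; rewrite ltn_eqF.
rewrite ge0_integralZl//.
- by rewrite fr -EFinM big_ord_recr/= mulrA.
- by apply/measurable_EFinP; exact: mf.
- by move=> y _; rewrite lee_fin.
- by rewrite lee_fin mulr_ge0// prodr_ge0.
Qed.

(** Completing the square moves the centre of the Gaussian to [x + 2*k*s]: exponentials are
    eigenfunctions of the heat flow. *)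
Lemma integral_hk_exp (s x k : R) : 0 < s ->
  (\int[leb]_y (hk s (x - y) * expR (k * y))%:E = (expR (k * x + k ^+ 2 * s))%:E)%E.
Proof.
move=> s0.
have s4 : 0 < (4 * s)^-1 by rewrite invr_gt0 mulr_gt0.
pose C := expR (k * x + k ^+ 2 * s) / Num.sqrt (4 * pi * s).
transitivity (\int[leb]_y (C%:E * (expR (- (4 * s)^-1 * (y - (x + 2 * k * s)) ^+ 2))%:E))%E.
  apply: eq_integral => y _; rewrite -EFinM /hk /C; congr EFin.
  rewrite [LHS]mulrAC [RHS]mulrAC -!expRD; congr (expR _ / _).
  by field; rewrite gt_eqF.
rewrite ge0_integralZl//.
- rewrite integral_gauss// -EFinM /C; congr EFin.
  rewrite invrK mulrCA mulrA divfK// gt_eqF// sqrtr_gt0.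
  by rewrite !mulr_gt0 ?pi_gt0.
- apply/measurable_EFinP; apply: measurableT_comp => //; apply: measurable_funM => //.
  by apply: measurable_funX; exact: measurable_funB.
- by rewrite lee_fin divr_ge0 ?expR_ge0// sqrtr_ge0.
Qed.

Lemma measurable_hk s : measurable_fun setT (hk s).
Proof.
apply: measurable_funM => //; apply: measurableT_comp => //.
by apply: measurable_funM => //; apply: measurableT_comp => //; exact: measurable_funX.
Qed.

Lemma intRn_heat_exp n (s : R) (x k : 'rV[R]_n) : 0 < s ->
  intRn (fun y => (heat s (x - y) * expR (edot k y))%:E)
  = (expR (edot k x + s * edot k k))%:E.
Proof.
move=> s0.
pose w (v : 'rV[R]_n) j := oapp (fun i => v ord0 i) 0 (insub j : option 'I_n).
have ww v (i : 'I_n) : w v i = v ord0 i by rewrite /w valK.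
pose f j y := hk s (w x j - y) * expR (w k j * y).
pose r j := expR (w k j * w x j + w k j ^+ 2 * s).
have mf j : measurable_fun setT (f j).
  apply: measurable_funM.
    by apply: (measurableT_comp (measurable_hk s)); exact: measurable_funB.
  by apply: measurableT_comp => //; exact: measurable_funM.
have f0 j y : 0 <= f j y by rewrite mulr_ge0 ?expR_ge0// ltW// hk_gt0.
have fr j : (\int[leb]_y (f j y)%:E = (r j)%:E)%E by exact: integral_hk_exp.
have := @iint_prod n f r 1 mf f0 fr ler01.
rewrite mul1r /r expR_sumE => H; rewrite /intRn.
transitivity (iint n (fun y : nat -> R => (1 * \prod_(i < n) f i (y i))%:E)).
  congr (iint n _); apply/funext => y; congr EFin; rewrite mul1r /f big_split/=.
  rewrite expR_sumE /heat /edot; congr (_ * expR _).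
    by apply: eq_bigr => i _; rewrite !mxE ww.
  by apply: eq_bigr => i _; rewrite !mxE ww.
rewrite H; congr EFin; congr expR; rewrite big_split/=; congr (_ + _).
  by rewrite /edot; apply: eq_bigr => i _; rewrite !ww.
by rewrite /edot mulr_sumr; apply: eq_bigr => i _; rewrite ww expr2 mulrC.
Qed.

Lemma measurable_edot n d (T : measurableType d) (Y Z : T -> 'rV[R]_n) :
  mrow Y -> mrow Z -> measurable_fun setT (fun w => edot (Y w) (Z w)).
Proof.
move=> mY mZ; rewrite /edot; apply: measurable_sum => i.
exact: measurable_funM.
Qed.

Lemma mrowB n d (T : measurableType d) (Y Z : T -> 'rV[R]_n) :
  mrow Y -> mrow Z -> mrow (fun w => Y w - Z w).
Proof.
move=> mY mZ i; rewrite (_ : (fun w => _) = (fun w => Y w ord0 i - Z w ord0 i)).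
  exact: measurable_funB.
by apply/funext => w; rewrite !mxE.
Qed.

Lemma mrow_cst n d (T : measurableType d) (x : 'rV[R]_n) : mrow (fun _ : T => x).
Proof. by move=> i; exact: measurable_cst. Qed.

Lemma measurable_gauss n d (T : measurableType d) (S : T -> R) (Y : T -> 'rV[R]_n) :
  measurable_fun setT S -> mrow Y -> measurable_fun setT (fun w => gauss (S w) (Y w)).
Proof.
move=> mS mY; rewrite (_ : (fun w => _) = (fun w => expR (- S w * edot (Y w) (Y w)))).
  apply: measurableT_comp => //; apply: measurable_funM.
    exact: measurableT_comp.
  exact: measurable_edot.
by apply/funext => w; rewrite gaussE.
Qed.

Lemma measurable_continuous_off0R d (T : measurableType d) (S : T -> R) (f : R -> R) :
  (forall x, x != 0 -> {for x, continuous f}) ->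
  measurable_fun setT S -> measurable_fun setT (fun w => f (S w)).
Proof.
move=> cf mS.
pose Y w : 'rV[R]_1 := const_mx (S w).
rewrite (_ : (fun w => _) = (fun w => f (Y w ord0 ord0))); last first.
  by apply/funext => w; rewrite mxE.
apply: (measurable_continuous_off0 (f := fun x : 'rV[R]_1 => f (x ord0 ord0))).
  move=> x x0; apply: (@continuous_comp _ _ _ (fun x : 'rV[R]_1 => x ord0 ord0) f).
    exact: coord_continuous.
  apply: cf; apply: contra_neq x0 => x0; apply/rowP => i.
  by rewrite mxE (ord1 i).
by move=> i; rewrite (_ : (fun w => _) = S)//; apply/funext => w; rewrite mxE.
Qed.

Lemma measurable_heat n d (T : measurableType d) (S : T -> R) (Y : T -> 'rV[R]_n) :
  measurable_fun setT S -> mrow Y -> measurable_fun setT (fun w => heat (S w) (Y w)).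
Proof.
move=> mS mY.
rewrite (_ : (fun w => _) = (fun w => (Num.sqrt (4 * pi * S w))^-1 ^+ n *
    expR (- edot (Y w) (Y w) / (4 * S w)))); last by apply/funext => w; rewrite heatE.
have mI (f : T -> R) : measurable_fun setT f -> measurable_fun setT (fun w => (f w)^-1).
  by apply: measurable_continuous_off0R => x x0; exact: inv_continuous.
apply: measurable_funM.
  apply: measurable_funX; apply: mI.
  apply: (measurableT_comp (f := @Num.sqrt R)); last exact: measurable_funM.
  by apply: continuous_measurable_fun; exact: sqrt_continuous.
apply: measurableT_comp => //; apply: measurable_funM.
  by apply: measurableT_comp => //; exact: measurable_edot.
by apply: mI; exact: measurable_funM.
Qed.

End HeatKernel.

(** * The weight [e^-s] of the heat superposition *)

Section ExpWeight.
Variable R : realType.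
Local Notation leb := (@lebesgue_measure R).

(** [e^-s] on the half-line and 0 for negative [s], so that integrals in [s] run over the whole
    line. *)
Definition hw : R -> R := exponential_pdf 1.

Lemma hw_ge0 s : 0 <= hw s.
Proof. exact: exponential_pdf_ge0. Qed.

Lemma hwE s : 0 <= s -> hw s = expR (- s).
Proof. by move=> s0; rewrite /hw exponential_pdfE// mul1r mulN1r. Qed.

Lemma hw_lt0 s : s < 0 -> hw s = 0.
Proof. exact: lt0_exponential_pdf. Qed.

Lemma measurable_hw : measurable_fun setT hw.
Proof. exact: measurable_exponential_pdf. Qed.

(** A Laplace transform: [q = |xi|^2] produces the symbol of [B], and [q = -|k|^2] the factor
    [1/(1-|k|^2)]. *)
Lemma integral_hw_exp (q : R) : -1 < q ->
  (\int[leb]_s (hw s * expR (- (s * q)))%:E = ((1 + q)^-1)%:E)%E.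
Proof.
move=> q1; have q0 : 0 < 1 + q by lra.
transitivity (\int[leb]_s (((1 + q)^-1)%:E * (exponential_pdf (1 + q) s)%:E))%E.
  apply: eq_integral => s _; rewrite -EFinM; congr EFin.
  have [s0|s0] := leP 0 s.
    rewrite hwE// exponential_pdfE// mulKf ?gt_eqF// -expRD; congr expR; ring.
  by rewrite hw_lt0// lt0_exponential_pdf// mul0r mulr0.
rewrite ge0_integralZl//.
- by rewrite integral_exponential_pdf// mule1.
- by apply/measurable_EFinP; exact: measurable_exponential_pdf.
- by move=> s _; rewrite lee_fin exponential_pdf_ge0// ltW.
- by rewrite lee_fin invr_ge0 ltW.
Qed.

Lemma integral_hw : (\int[leb]_s (hw s)%:E = 1)%E.
Proof. exact: integral_exponential_pdf. Qed.

End ExpWeight.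

(** * The heat-smoothed Bessel kernel as a superposition of heat kernels *)

Section Bessel.
Variables (R : realType) (n : nat) (B : 'rV[R]_n -> R).
Hypothesis hB : is_bessel_kernel B.
Variables (d : measure_display) (T : measurableType d).
Variables (mu : {sigma_finite_measure set T -> \bar R}) (X : T -> 'rV[R]_n).
Hypothesis mX : mrow X.
Hypothesis intRnE : forall f, vmeas f -> (forall x, (0 <= f x)%E) ->
  intRn f = (\int[mu]_w f (X w))%E.
Hypothesis intRnE' : forall f, vmeas f -> mu.-integrable setT (fun w => f (X w)) ->
  intRn f = (\int[mu]_w f (X w))%E.
Local Notation leb := (@lebesgue_measure R).

Lemma measurable_kernel d' (T' : measurableType d') (Y : T' -> 'rV[R]_n) :
  mrow Y -> measurable_fun setT (fun w => B (Y w)).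
Proof. by have [cB _] := hB; exact: measurable_continuous_off0. Qed.

Lemma integrable_kernel : mu.-integrable setT (fun w => (B (X w))%:E).
Proof.
have [_ [iB _]] := hB.
apply/integrableP; split; first by apply/measurable_EFinP; exact: measurable_kernel.
rewrite -(intRnE (f := fun x => (`|B x|)%:E)) ?lee_fin//.
by move=> d' T' Y mY; apply/measurable_EFinP; apply: measurableT_comp => //; exact: measurable_kernel.
Qed.

Lemma integral_heat (s : R) (x k : 'rV[R]_n) : 0 < s ->
  (\int[mu]_w (heat s (x - X w) * expR (edot k (X w)))%:E
   = (expR (edot k x + s * edot k k))%:E)%E.
Proof.
move=> s0; rewrite -(intRn_heat_exp x k s0).
rewrite -(intRnE (f := fun y => (heat s (x - y) * expR (edot k y))%:E))//.
- move=> d' T' Y mY; apply/measurable_EFinP; apply: measurable_funM.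
    by apply: measurable_heat => //; apply: mrowB => //; exact: mrow_cst.
  by apply: measurableT_comp => //; apply: measurable_edot => //; exact: mrow_cst.
- by move=> y; rewrite lee_fin mulr_ge0 ?expR_ge0// ltW// heat_gt0.
Qed.

Lemma edotBl (x y z : 'rV[R]_n) : edot (x - y) z = edot x z - edot y z.
Proof.
by rewrite /edot -sumrB; apply: eq_bigr => i _; rewrite !mxE mulrBl.
Qed.

Lemma edot0l (y : 'rV[R]_n) : edot 0 y = 0.
Proof. by rewrite /edot big1// => i _; rewrite mxE mul0r. Qed.

Lemma heatN (s : R) (x : 'rV[R]_n) : heat s (- x) = heat s x.
Proof.
by apply: eq_bigr => i _; rewrite mxE /hk sqrrN.
Qed.

Lemma integral_heat1 (s : R) (x : 'rV[R]_n) : 0 < s ->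
  (\int[mu]_w (heat s (X w - x))%:E = 1)%E.
Proof.
move=> s0; have := @integral_heat s x 0 s0.
rewrite !edot0l mulr0 addr0 expR0 => <-; apply: eq_integral => w _.
by rewrite edot0l expR0 mulr1 -heatN opprB.
Qed.

Section Smoothing.
Variables (t : R) (y : 'rV[R]_n).
Hypothesis t0 : 0 < t.

Let tpn : R := (2 * pi) ^+ n.
Local Lemma tpn0 : 0 < tpn. Proof. by rewrite exprn_gt0// mulr_gt0// pi_gt0. Qed.

Local Lemma gauss_gt0 (xi : 'rV[R]_n) : 0 < gauss t xi.
Proof. by rewrite gaussE expR_gt0. Qed.
#[local] Hint Resolve tpn0 gauss_gt0 : core.

Lemma integrable_gauss : mu.-integrable setT (fun w => (gauss t (X w))%:E).
Proof.
have mg : vmeas (fun xi : 'rV[R]_n => (gauss t xi)%:E).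
  by move=> d' T' Y mY; apply/measurable_EFinP; exact: measurable_gauss.
apply/integrableP; split; first exact: mg.
under eq_integral do rewrite gee0_abs ?lee_fin ?(ltW (gauss_gt0 _))//.
rewrite -(intRnE (f := fun xi : 'rV[R]_n => (gauss t xi)%:E))//; last first.
  by move=> xi; rewrite lee_fin ltW.
have := @intRn_gauss_fourier R n t 0 1 0 t0.
under [fun xi => _]eq_fun do rewrite edot0l addr0 cos0 mulr1 mul1r.
by move=> ->; rewrite ltry.
Qed.

Local Lemma cos_abs_le1 (x : R) : `|cos x| <= 1.
Proof. by rewrite ler_norml cos_geN1 cos_le1. Qed.
Local Lemma sin_abs_le1 (x : R) : `|sin x| <= 1.
Proof. by rewrite ler_norml sin_geN1 sin_le1. Qed.
#[local] Hint Resolve cos_abs_le1 sin_abs_le1 : core.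

(** [z.1] carries the space variable and [z.2] the frequency. Integrating out the frequency gives a
    heat kernel; integrating out space gives the Fourier transform of [B]. *)
Let F (z : T * T) : \bar R :=
  (B (X z.1) * gauss t (X z.2) * cos (edot (X z.1 - y) (X z.2)))%:E.

Local Lemma mX1 : mrow (fun z : T * T => X z.1).
Proof. by move=> i; apply: (measurableT_comp (mX i)). Qed.
Local Lemma mX2 : mrow (fun z : T * T => X z.2).
Proof. by move=> i; apply: (measurableT_comp (mX i)). Qed.
#[local] Hint Resolve mX1 mX2 : core.

Local Lemma mcos (f : R -> R) : continuous f -> forall d' (T' : measurableType d') (g : T' -> R),
  measurable_fun setT g -> measurable_fun setT (fun w => f (g w)).
Proof.
move=> cf d' T' g mg; apply: measurableT_comp => //.
exact: continuous_measurable_fun.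
Qed.

Local Lemma mF : measurable_fun setT F.
Proof.
apply/measurable_EFinP; apply: measurable_funM; first apply: measurable_funM.
- exact: (measurable_kernel mX1).
- exact: measurable_gauss.
- apply: mcos; first exact: continuous_cos.
  by apply: measurable_edot => //; apply: mrowB => //; exact: mrow_cst.
Qed.

#[local] Hint Resolve mF : core.
Local Lemma fubiniF : (\int[mu]_w1 \int[mu]_w2 F (w1, w2) = \int[mu]_w2 \int[mu]_w1 F (w1, w2))%E.
Proof.
apply: Fubini; apply/integrable12ltyP => //.
have [mBf iB] := integrableP _ _ _ integrable_kernel.
have [mg ig] := integrableP _ _ _ integrable_gauss.
apply: (@le_lt_trans _ _ (\int[mu]_w1 (`|(B (X w1))%:E| * \int[mu]_w2 `|(gauss t (X w2))%:E|))%E).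
  apply: ge0_le_integral => //.
  - by move=> w _; exact: integral_ge0.
  - by apply: (measurable_fun_fubini_tonelli_F (abse \o F)) => //=; exact: measurableT_comp.
  - apply: emeasurable_funM => //; exact: measurableT_comp.
  - move=> w _; rewrite -ge0_integralZl//; last exact: measurableT_comp.
    apply: ge0_le_integral => //.
    + by apply: measurableT_comp => //; exact: measurableT_comp.
    + by apply: emeasurable_funM => //; exact: measurableT_comp.
    + move=> w2 _; rewrite /F/= lee_fin !normrM ler_piMr// mulr_ge0//.
rewrite ge0_integralZr//.
- by rewrite lte_mul_pinfty// ?integral_ge0// ge0_fin_numE// integral_ge0.
- exact: measurableT_comp.
- exact: integral_ge0.
Qed.

Local Lemma innerF w1 : (\int[mu]_w2 F (w1, w2) = (tpn * (B (X w1) * heat t (X w1 - y)))%:E)%E.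
Proof.
have := @intRn_gauss_fourier R n t (X w1 - y) (B (X w1)) 0 t0.
rewrite cos0 mulr1 mulrCA => <-; apply/esym.
under [fun xi => _]eq_fun do rewrite add0r.
rewrite intRnE' //.
- move=> d' T' Y mY; apply/measurable_EFinP; apply: measurable_funM; first apply: measurable_funM => //.
    exact: measurable_gauss.
  apply: mcos; first exact: continuous_cos.
  by apply: measurable_edot => //; exact: mrow_cst.
- apply: (@le_integrable _ _ _ mu setT measurableT _ (fun w => (B (X w1))%:E * (gauss t (X w))%:E)%E).
  + apply/measurable_EFinP; apply: measurable_funM; first apply: measurable_funM => //.
      exact: measurable_gauss.
    apply: mcos; first exact: continuous_cos.
    by apply: measurable_edot => //; exact: mrow_cst.
  + by move=> w _; rewrite lee_fin !normrM ler_piMr// mulr_ge0.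
  + by apply: integrableZl => //; exact: integrable_gauss.
Qed.

Local Lemma intB (g : R -> R) xi : continuous g -> (forall x, `|g x| <= 1) ->
  mu.-integrable setT (fun w => (B (X w) * g (edot (X w) xi))%:E).
Proof.
move=> cg g1.
apply: (@le_integrable _ _ _ mu setT measurableT _ (fun w => (B (X w))%:E)).
- apply/measurable_EFinP; apply: measurable_funM; first exact: measurable_kernel.
  by apply: mcos => //; apply: measurable_edot => //; exact: mrow_cst.
- by move=> w _; rewrite lee_fin normrM ler_piMr.
- exact: integrable_kernel.
Qed.

Local Lemma intBE (g : R -> R) xi : continuous g -> (forall x, `|g x| <= 1) ->
  intRn (fun x => (B x * g (edot x xi))%:E) =
  (\int[mu]_w (B (X w) * g (edot (X w) xi))%:E)%E.
Proof.
move=> cg g1; rewrite intRnE'//; last exact: intB.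
move=> d' T' Y mY; apply/measurable_EFinP; apply: measurable_funM; first exact: measurable_kernel.
by apply: mcos => //; apply: measurable_edot => //; exact: mrow_cst.
Qed.

Local Lemma innerF2 w2 : (\int[mu]_w1 F (w1, w2) =
  (gauss t (X w2) * cos (edot y (X w2)) * (1 + edot (X w2) (X w2))^-1)%:E)%E.
Proof.
have [_ [_ [Hc Hs]]] := hB.
set xi := X w2.
have ic := intB xi (@continuous_cos R) cos_abs_le1.
have is_ := intB xi (@continuous_sin R) sin_abs_le1.
have E1 := intBE xi (@continuous_cos R) cos_abs_le1.
have E2 := intBE xi (@continuous_sin R) sin_abs_le1.
rewrite Hc enorm_sqr in E1; rewrite Hs in E2.
transitivity (\int[mu]_w ((gauss t xi * cos (edot y xi))%:E * (B (X w) * cos (edot (X w) xi))%:E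
    + (gauss t xi * sin (edot y xi))%:E * (B (X w) * sin (edot (X w) xi))%:E))%E.
  apply: eq_integral => w _; rewrite /F /= -/xi edotBl cosB -!EFinM -EFinD; congr EFin; ring.
rewrite integralD//; [|exact: integrableZl|exact: integrableZl].
by rewrite !integralZl// -E1 -E2 mule0 adde0 -EFinM.
Qed.

Local Lemma smooth1 : (\int[mu]_w (tpn * (B (X w) * heat t (X w - y)))%:E =
  \int[mu]_w (gauss t (X w) * cos (edot y (X w)) * (1 + edot (X w) (X w))^-1)%:E)%E.
Proof.
transitivity (\int[mu]_w1 \int[mu]_w2 F (w1, w2))%E.
  by apply: eq_integral => w _; rewrite innerF.
by rewrite fubiniF; apply: eq_integral => w _; rewrite innerF2.
Qed.

(** The symbol [1/(1+|xi|^2)] unfolded as a Laplace integral in [s = z.2]; integrating out the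
    frequency first gives [heat (t + s) y]. *)
Let F2 (z : T * measurableTypeR R) : \bar R :=
  (hw z.2 * gauss (t + z.2) (X z.1) * cos (edot y (X z.1)))%:E.

Local Lemma F2E w s : F2 (w, s) =
  ((gauss t (X w) * cos (edot y (X w)))%:E * (hw s * expR (- (s * edot (X w) (X w))))%:E)%E.
Proof.
rewrite /F2/= -EFinM; congr EFin.
have -> : gauss (t + s) (X w) = gauss t (X w) * expR (- (s * edot (X w) (X w))).
  by rewrite !gaussE -expRD; congr expR; ring.
ring.
Qed.

Local Lemma mX1' : mrow (fun z : T * measurableTypeR R => X z.1).
Proof. by move=> i; apply: (measurableT_comp (mX i)). Qed.
#[local] Hint Resolve mX1' : core.

Local Lemma mF2 : measurable_fun setT F2.
Proof.
apply/measurable_EFinP; apply: measurable_funM; first apply: measurable_funM.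
- by apply: (measurableT_comp (@measurable_hw R)).
- by apply: measurable_gauss => //; exact: measurable_funD.
- apply: mcos; first exact: continuous_cos.
  by apply: measurable_edot => //; exact: mrow_cst.
Qed.

#[local] Hint Resolve mF2 : core.
Local Lemma fubiniF2 : (\int[mu]_w \int[leb]_s F2 (w, s) = \int[leb]_s \int[mu]_w F2 (w, s))%E.
Proof.
apply: Fubini; apply/integrable12ltyP => //.
have [mg ig] := integrableP _ _ _ integrable_gauss.
apply: le_lt_trans ig; apply: ge0_le_integral => //.
- by move=> w _; exact: integral_ge0.
- by apply: (measurable_fun_fubini_tonelli_F (abse \o F2)) => //=; exact: measurableT_comp.
- exact: measurableT_comp.
move=> w _; rewrite -[leRHS]mule1 -(@integral_hw R) -ge0_integralZl//.
- apply: ge0_le_integral => //.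
  + by apply: measurableT_comp => //; exact: measurableT_comp.
  + apply: emeasurable_funM => //; apply/measurable_EFinP; exact: measurable_hw.
  + move=> s _.
    have e1 : hw s * expR (- (s * edot (X w) (X w))) <= hw s.
      have [s0|s0] := leP 0 s; last by rewrite hw_lt0// mul0r.
      rewrite ler_piMr ?hw_ge0// -expR0 ler_expR oppr_le0 mulr_ge0//.
      exact: edot_ge0.
    rewrite F2E -!EFinM lee_fin normrM ler_pM//.
      by rewrite normrM ler_piMr.
    by rewrite ger0_norm// mulr_ge0 ?hw_ge0 ?expR_ge0.
- by apply/measurable_EFinP; exact: measurable_hw.
- by move=> s _; rewrite lee_fin hw_ge0.
Qed.

Local Lemma inner_F2s w : (\int[leb]_s F2 (w, s) =
  (gauss t (X w) * cos (edot y (X w)) * (1 + edot (X w) (X w))^-1)%:E)%E.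
Proof.
have q1 : -1 < edot (X w) (X w) by rewrite (@lt_le_trans _ _ 0)// ?edot_ge0.
under eq_integral do rewrite F2E.
rewrite integralZl//; first by rewrite integral_hw_exp// -EFinM.
apply/integrableP; split.
  apply/measurable_EFinP; apply: measurable_funM; first exact: measurable_hw.
  apply: measurableT_comp => //; apply: measurableT_comp => //.
  exact: measurable_funM.
under eq_integral do rewrite gee0_abs ?lee_fin ?mulr_ge0 ?hw_ge0 ?expR_ge0//.
by rewrite integral_hw_exp// ltry.
Qed.

Local Lemma inner_F2w s : (\int[mu]_w F2 (w, s) = (tpn * (hw s * heat (t + s) y))%:E)%E.
Proof.
rewrite /F2/=; have [s0|s0] := leP 0 s; last first.
  rewrite hw_lt0// mul0r mulr0.
  by under eq_integral do rewrite !mul0r; rewrite integral0.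
have ts0 : 0 < t + s by rewrite ltr_wpDr.
have := @intRn_gauss_fourier R n (t + s) y (hw s) 0 ts0.
rewrite cos0 mulr1 mulrCA => <-; apply/esym.
under [fun xi => _]eq_fun do rewrite add0r.
have mf d' (T' : measurableType d') (Y : T' -> 'rV[R]_n) : mrow Y ->
    measurable_fun setT (fun w => (hw s * gauss (t + s) (Y w) * cos (edot y (Y w)))%:E).
  move=> mY; apply/measurable_EFinP; apply: measurable_funM; first apply: measurable_funM => //.
    exact: measurable_gauss.
  apply: mcos; first exact: continuous_cos.
  by apply: measurable_edot => //; exact: mrow_cst.
rewrite intRnE' //.
apply: (@le_integrable _ _ _ mu setT measurableT _ (fun w => (hw s)%:E * (gauss t (X w))%:E)%E).
- exact: mf.
- move=> w _; rewrite lee_fin !normrM -mulrA ler_wpM2l//.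
  apply: (@le_trans _ _ `|gauss (t + s) (X w)|); first by rewrite ler_piMr.
  rewrite !gaussE !ger0_norm ?expR_ge0// ler_expR !mulNr lerN2.
  by rewrite ler_wpM2r ?edot_ge0// lerDl.
- by apply: integrableZl => //; exact: integrable_gauss.
Qed.

Lemma integrable_kernel_heat : mu.-integrable setT (fun w => (B (X w) * heat t (X w - y))%:E).
Proof.
apply: (@le_integrable _ _ _ mu setT measurableT _
  (fun w => ((Num.sqrt (4 * pi * t))^-1 ^+ n)%:E * (B (X w))%:E)%E).
- apply/measurable_EFinP; apply: measurable_funM; first exact: measurable_kernel.
  by apply: measurable_heat => //; apply: mrowB => //; exact: mrow_cst.
- move=> w _; rewrite lee_fin !normrM mulrC ler_wpM2r// heatE.
  rewrite normrM ler_piMr// ger0_norm ?expR_ge0// -expR0 ler_expR mulNr oppr_le0.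
  by rewrite divr_ge0 ?edot_ge0// mulr_ge0// ltW.
- by apply: integrableZl => //; exact: integrable_kernel.
Qed.

(** Up to the factor [(2 pi)^n], both sides are the integral of
    [e^(-t|xi|^2) cos(y.xi) / (1+|xi|^2)] over frequencies. The Gaussian factor makes both exchanges
    of integrals absolutely convergent. *)
Lemma kernel_heat : (\int[mu]_w (B (X w) * heat t (X w - y))%:E =
  \int[leb]_s (hw s * heat (t + s) y)%:E)%E.
Proof.
have tt : tpn^-1 * tpn = 1 by rewrite mulVf// gt_eqF.
have c1 : (0 <= tpn^-1%:E)%E by rewrite lee_fin invr_ge0 ltW.
have hh s : 0 <= hw s * heat (t + s) y.
  have [s0|s0] := leP 0 s; last by rewrite hw_lt0// mul0r.
  by rewrite mulr_ge0 ?hw_ge0// ltW// heat_gt0// ltr_wpDr.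
have mh : measurable_fun setT (fun s : measurableTypeR R => (hw s * heat (t + s) y)%:E).
  apply/measurable_EFinP; apply: measurable_funM; first exact: measurable_hw.
  by apply: measurable_heat; [exact: measurable_funD|exact: mrow_cst].
have iBh := integrable_kernel_heat.
have E : (\int[mu]_w (tpn * (B (X w) * heat t (X w - y)))%:E =
    \int[leb]_s (tpn * (hw s * heat (t + s) y))%:E)%E.
  rewrite smooth1; transitivity (\int[mu]_w \int[leb]_s F2 (w, s))%E.
    by apply: eq_integral => w _; rewrite inner_F2s.
  by rewrite fubiniF2; apply: eq_integral => s _; rewrite inner_F2w.
have {}E : (tpn%:E * \int[mu]_w (B (X w) * heat t (X w - y))%:E =
    tpn%:E * \int[leb]_s (hw s * heat (t + s) y)%:E)%E.
  rewrite -integralZl// -ge0_integralZl//.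
  - by move=> s _; rewrite lee_fin.
  - by rewrite lee_fin ltW.
have := congr1 (fun z => tpn^-1%:E * z)%E E.
by rewrite !muleA -!EFinM tt !mul1e.
Qed.

End Smoothing.
End Bessel.

(** * Removing the smoothing away from the origin *)

Section BesselLimit.
Variables (R : realType) (n : nat) (B : 'rV[R]_n -> R).
Hypothesis hB : is_bessel_kernel B.
Variables (d : measure_display) (T : measurableType d).
Variables (mu : {sigma_finite_measure set T -> \bar R}) (X : T -> 'rV[R]_n).
Hypothesis mX : mrow X.
Hypothesis intRnE : forall f, vmeas f -> (forall x, (0 <= f x)%E) ->
  intRn f = (\int[mu]_w f (X w))%E.
Hypothesis intRnE' : forall f, vmeas f -> mu.-integrable setT (fun w => f (X w)) ->
  intRn f = (\int[mu]_w f (X w))%E.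
Local Notation leb := (@lebesgue_measure R).
Local Notation tj j := (j.+1%:R^-1 : R).

Lemma row_norm_edot m (z : 'rV[R]_m) : `|z| ^+ 2 <= edot z z.
Proof.
have e0 := edot_ge0 z.
have : `|z| <= Num.sqrt (edot z z).
  apply: row_norm_le => [|i]; first exact: sqrtr_ge0.
  rewrite -sqrtr_sqr ler_sqrt// /edot (bigD1 i)//= -expr2 lerDl.
  by apply: sumr_ge0 => j _; rewrite -expr2 sqr_ge0.
move=> h; rewrite -[leRHS]sqr_sqrtr// lerXn2r// nnegrE ?sqrtr_ge0//.
Qed.

Lemma heat_far (t dl : R) (z : 'rV[R]_n) : 0 < t -> 0 < dl -> dl <= `|z| ->
  heat t z <= (Num.sqrt (4 * pi * t))^-1 ^+ n * expR (- (dl ^+ 2 / (4 * t))).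
Proof.
move=> t0 dl0 dz; rewrite heatE ler_wpM2l ?exprn_ge0 ?invr_ge0 ?sqrtr_ge0//.
rewrite ler_expR mulNr lerN2 ler_wpM2r ?invr_ge0 ?mulr_ge0 ?(ltW t0)//.
by apply: (le_trans _ (row_norm_edot z)); rewrite lerXn2r ?nnegrE// ltW.
Qed.

(** Half of the exponent supplies the smallness, the other half is a heat kernel at time [2*t], of
    mass one. This serves the constant [B y], against which the uniform bound of [heat_far] is not
    integrable. *)
Lemma heat_far2 (t dl : R) (z : 'rV[R]_n) : 0 < t -> 0 < dl -> dl <= `|z| ->
  heat t z <= Num.sqrt 2 ^+ n * expR (- (dl ^+ 2 / (8 * t))) * heat (2 * t) z.
Proof.
move=> t0 dl0 dz; rewrite !heatE.
have p0 : 0 < 4 * pi * t by rewrite !mulr_gt0 ?pi_gt0.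
have -> : (Num.sqrt (4 * pi * t))^-1 ^+ n =
    Num.sqrt 2 ^+ n * (Num.sqrt (4 * pi * (2 * t)))^-1 ^+ n :> R.
  rewrite -exprMn; congr (_ ^+ n).
  have -> : 4 * pi * (2 * t) = 2 * (4 * pi * t) :> R by ring.
  by rewrite (@sqrtrM R 2)// invfM mulrA divff ?mul1r// gt_eqF// sqrtr_gt0.
rewrite -!mulrA ler_wpM2l ?exprn_ge0 ?sqrtr_ge0//.
rewrite [leRHS]mulrCA ler_wpM2l ?exprn_ge0 ?invr_ge0 ?sqrtr_ge0//.
rewrite -expRD ler_expR.
have h : dl ^+ 2 <= edot z z.
  by apply: (le_trans _ (row_norm_edot z)); rewrite lerXn2r ?nnegrE// ltW.
have -> : - edot z z / (4 * t) = - (edot z z / (8 * t)) - edot z z / (4 * (2 * t)).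
  by field; rewrite gt_eqF.
have h' : dl ^+ 2 / (8 * t) <= edot z z / (8 * t).
  by rewrite ler_wpM2r// invr_ge0 mulr_ge0// ltW.
by rewrite [- edot z z / (4 * (2 * t))]mulNr lerD2r lerN2 mulrA -expr2.
Qed.

(** A single term of the exponential series, of degree [m.+1], beats the power and leaves one spare
    factor [1/(j+1)]. *)
Lemma pow_exp_decay (c : R) (m j : nat) : 0 < c ->
  (j.+1%:R : R) ^+ m * expR (- (c * j.+1%:R)) <=
  (m.+1)`!%:R / c ^+ m.+1 * j.+1%:R^-1.
Proof.
move=> c0; set r := j.+1%:R : R.
have r0 : 0 < r by rewrite /r ltr0n.
have f0 : 0 < (m.+1)`!%:R :> R by rewrite ltr0n fact_gt0.
rewrite expRN ler_pdivrMr ?expR_gt0//.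
have := @expR_ge1Dxn R (c * r) m (mulr_ge0 (ltW c0) (ltW r0)) => H.
have H' : (c * r) ^+ m.+1 / (m.+1)`!%:R <= expR (c * r).
  by apply: le_trans H; rewrite lerDr.
apply: (@le_trans _ _ ((m.+1)`!%:R / c ^+ m.+1 / r * ((c * r) ^+ m.+1 / (m.+1)`!%:R))).
  rewrite exprMn (exprS r m) le_eqVlt; apply/orP; left; apply/eqP.
  by field; rewrite !gt_eqF ?exprn_gt0.
by rewrite ler_wpM2l// !divr_ge0// ?ltW// exprn_gt0.
Qed.

Lemma heat_peak_le j : (Num.sqrt (4 * pi * tj j))^-1 <= j.+1%:R :> R.
Proof.
have r1 : 1 <= j.+1%:R :> R by rewrite (ler_nat R 1 j.+1).
have pi1 : 1 <= pi :> R by apply: le_trans (pi_ge2 R); rewrite ler1n.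
set r := j.+1%:R in r1 *.
have r0 : 0 < r by exact: lt_le_trans r1.
rewrite -[leRHS]invrK lef_pV2 ?posrE ?invr_gt0// ?sqrtr_gt0 ?mulr_gt0 ?invr_gt0 ?pi_gt0//.
rewrite -[leLHS]ger0_norm ?invr_ge0 ?(ltW r0)// -sqrtr_sqr ler_sqrt ?sqr_ge0//; last first.
  by rewrite !mulr_ge0 ?pi_ge0 ?invr_ge0 ?(ltW r0).
rewrite expr2 ler_wpM2r ?invr_ge0 ?(ltW r0)//.
have : r^-1 <= 1 by rewrite invf_le1.
move=> h; apply: (le_trans h); nra.
Qed.

Lemma heat_error_cvg (dl : R) : 0 < dl -> exists C : R, 0 <= C /\ forall j : nat,
  (Num.sqrt (4 * pi * tj j))^-1 ^+ n * expR (- (dl ^+ 2 / (4 * tj j))) <= C * tj j /\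
  Num.sqrt 2 ^+ n * expR (- (dl ^+ 2 / (8 * tj j))) <= C * tj j.
Proof.
move=> dl0; pose c : R := dl ^+ 2 / 8.
have c0 : 0 < c by rewrite divr_gt0 ?exprn_gt0.
have C0 : 0 <= (2 ^+ n * ((n.+1)`!%:R / c ^+ n.+1)) :> R.
  by rewrite mulr_ge0 ?exprn_ge0// divr_ge0// ?exprn_ge0// ltW.
exists (2 ^+ n * ((n.+1)`!%:R / c ^+ n.+1)); split=> // j.
have r1 : 1 <= j.+1%:R :> R by rewrite (ler_nat R 1 j.+1).
have r0 : 0 < j.+1%:R :> R by exact: lt_le_trans r1.
have D := @pow_exp_decay c n j c0.
have key (A : R) : A <= 2 ^+ n * (j.+1%:R ^+ n * expR (- (c * j.+1%:R))) ->
    A <= 2 ^+ n * ((n.+1)`!%:R / c ^+ n.+1) * tj j.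
  by move=> h; apply: (le_trans h); rewrite -mulrA ler_wpM2l// exprn_ge0.
have two1 : 1 <= 2 ^+ n :> R by rewrite exprn_ege1// ler1n.
have rn1 : 1 <= j.+1%:R ^+ n :> R by rewrite exprn_ege1.
split; apply: key.
  apply: (@le_trans _ _ (j.+1%:R ^+ n * expR (- (c * j.+1%:R)))).
    apply: ler_pM; rewrite ?expR_ge0 ?exprn_ge0 ?invr_ge0 ?sqrtr_ge0//.
      by rewrite lerXn2r ?nnegrE ?invr_ge0 ?sqrtr_ge0 ?heat_peak_le// ltW.
    rewrite ler_expR lerN2 /c invfM invrK mulrA ler_wpM2r ?(ltW r0)//.
    by rewrite ler_wpM2l ?sqr_ge0// lef_pV2 ?posrE// ler_nat.
  by rewrite ler_peMl// mulr_ge0 ?expR_ge0// exprn_ge0// ltW.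
apply: ler_pM; rewrite ?expR_ge0 ?exprn_ge0 ?sqrtr_ge0//.
  rewrite lerXn2r ?nnegrE ?sqrtr_ge0// -[leRHS]ger0_norm// -sqrtr_sqr ler_sqrt//.
  by rewrite expr2 -natrM ler_nat.
apply: (@le_trans _ _ (expR (- (c * j.+1%:R)))).
  by rewrite ler_expR lerN2 /c invfM invrK mulrA.
by rewrite ler_peMl// expR_ge0.
Qed.

Let Bn : R := fine (\int[mu]_w `|(B (X w))%:E|)%E.

Local Lemma BnE : (\int[mu]_w `|(B (X w))%:E| = Bn%:E)%E.
Proof.
have /integrableP[_ h] := integrable_kernel hB mX intRnE.
by rewrite /Bn fineK// ge0_fin_numE// integral_ge0.
Qed.

Local Lemma measurable_heatX (s : R) (y : 'rV[R]_n) :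
  measurable_fun setT (fun w => (heat s (X w - y))%:E).
Proof.
apply/measurable_EFinP; apply: measurable_heat => //.
by apply: mrowB => //; exact: mrow_cst.
Qed.

Local Lemma integrable_heatX (s : R) (y : 'rV[R]_n) : 0 < s ->
  mu.-integrable setT (fun w => (heat s (X w - y))%:E).
Proof.
move=> s0; apply/integrableP; split; first exact: measurable_heatX.
under eq_integral do rewrite gee0_abs ?lee_fin ?(ltW (heat_gt0 _ s0))//.
by rewrite integral_heat1// ltry.
Qed.

(** Approximate identity for a function that may be unbounded at the origin: close to [y] continuity
    gives [e], while far from [y] only the L1 norm [Bn] of [B] is available and is paired with the
    supremum of the kernel. *)
Lemma smoothing_error (t dl e : R) (y : 'rV[R]_n) : 0 < t -> 0 < dl -> 0 <= e ->
  (forall x, `|x - y| < dl -> `|B x - B y| <= e) ->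
  (`| \int[mu]_w (B (X w) * heat t (X w - y))%:E - (B y)%:E | <=
  (e + (Num.sqrt (4 * pi * t))^-1 ^+ n * expR (- (dl ^+ 2 / (4 * t))) * Bn +
    `|B y| * (Num.sqrt 2 ^+ n * expR (- (dl ^+ 2 / (8 * t)))))%:E)%E.
Proof.
move=> t0 dl0 e0 near.
set a := _ * expR (- (dl ^+ 2 / (4 * t))); set b := _ * expR (- (dl ^+ 2 / (8 * t))).
have a0 : 0 <= a by rewrite mulr_ge0 ?expR_ge0 ?exprn_ge0 ?invr_ge0 ?sqrtr_ge0.
have b0 : 0 <= b by rewrite mulr_ge0 ?expR_ge0 ?exprn_ge0 ?sqrtr_ge0.
have t20 : 0 < 2 * t by rewrite mulr_gt0.
have i1 := integrable_kernel_heat hB mX intRnE y t0.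
have ih := integrable_heatX y t0.
have i2 : mu.-integrable setT (fun w => (B y)%:E * (heat t (X w - y))%:E)%E.
  exact: integrableZl.
have iB := integrable_kernel hB mX intRnE.
have -> : ((B y)%:E = \int[mu]_w ((B y)%:E * (heat t (X w - y))%:E))%E.
  by rewrite integralZl// integral_heat1// mule1.
rewrite -integralB//.
have mB' : measurable_fun setT (fun w => (B (X w))%:E) by exact: measurable_int iB.
apply: (le_trans (le_abse_integral _ _ _)) => //.
  apply: measurable_int (integrableB _ i1 i2) => //.
apply: (@le_trans _ _ (\int[mu]_w (e%:E * (heat t (X w - y))%:E + a%:E * `|(B (X w))%:E| +
    (`|B y| * b)%:E * (heat (2 * t) (X w - y))%:E))%E).
  apply: ge0_le_integral => //.
  - apply: measurableT_comp => //.
    by apply: measurable_int (integrableB _ i1 i2).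
  - apply: emeasurable_funD; first apply: emeasurable_funD.
    + by apply: emeasurable_funM => //; exact: measurable_heatX.
    + by apply: emeasurable_funM => //; exact: measurableT_comp.
    + by apply: emeasurable_funM => //; exact: measurable_heatX.
  - move=> w _; rewrite -!EFinM -EFinB -!EFinD lee_fin -mulrBl normrM.
    have h0 := heat_gt0 (X w - y) t0.
    have h20 := heat_gt0 (X w - y) t20.
    rewrite (ger0_norm (ltW h0)).
    have [/near h|far] := ltP `|X w - y| dl.
      apply: (@le_trans _ _ (e * heat t (X w - y))); first by rewrite ler_wpM2r// ltW.
      by rewrite -addrA lerDl addr_ge0// !mulr_ge0// ltW.
    have f1 := heat_far t0 dl0 far; have f2 := heat_far2 t0 dl0 far.
    rewrite -/a in f1; rewrite -/b in f2.
    apply: (@le_trans _ _ ((`|B (X w)| + `|B y|) * heat t (X w - y))).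
      by rewrite ler_wpM2r ?(ltW h0)// ler_normB.
    rewrite mulrDl; apply: lerD.
      apply: (@le_trans _ _ (a * `|B (X w)|)); first by rewrite mulrC ler_wpM2r.
      by rewrite lerDr mulr_ge0// ltW.
    by rewrite -mulrA ler_wpM2l.
rewrite ge0_integralD//; last 4 first.
- move=> w _; rewrite adde_ge0// mule_ge0// lee_fin// ltW// heat_gt0//.
- apply: emeasurable_funD.
    by apply: emeasurable_funM => //; exact: measurable_heatX.
  by apply: emeasurable_funM => //; exact: measurableT_comp.
- by move=> w _; rewrite mule_ge0// lee_fin ?mulr_ge0// ltW// heat_gt0.
- by apply: emeasurable_funM => //; exact: measurable_heatX.
rewrite ge0_integralD//; last 4 first.
- by move=> w _; rewrite mule_ge0// lee_fin ltW// heat_gt0.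
- by apply: emeasurable_funM => //; exact: measurable_heatX.
- by move=> w _; rewrite mule_ge0// lee_fin.
- by apply: emeasurable_funM => //; exact: measurableT_comp.
rewrite integralZl// integral_heat1//.
rewrite integralZl//; last exact: integrable_abse.
rewrite integralZl//; last exact: integrable_heatX.
by rewrite integral_heat1// BnE !mule1 -EFinM -!EFinD lee_fin.
Qed.

(** Convergence along [t = 1/(j+1)] is enough for what follows: pointwise lower bounds pass to the
    limit, and upper bounds on integrals pass by Fatou. *)
Lemma kernel_cvg (y : 'rV[R]_n) : y != 0 ->
  (\int[leb]_s (hw s * heat (tj j + s) y)%:E)%E @[j --> \oo] --> (B y)%:E.
Proof.
move=> y0; have [cB _] := hB.
have tj0 j : 0 < tj j by rewrite invr_gt0.
under eq_fun do rewrite -(kernel_heat hB mX intRnE intRnE' y (tj0 _)).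
have fin j : (\int[mu]_w (B (X w) * heat (tj j) (X w - y))%:E)%E \is a fin_num.
  by apply: integrable_fin_num => //; exact: integrable_kernel_heat.
apply/fine_cvgP; split; first exact: nearW.
apply/cvgrPdist_le => e e0 /=.
have e20 : 0 < e / 2 by rewrite divr_gt0.
have /cvgrPdist_le/(_ _ e20)/nbhs_ballP[dl /= dl0 Hdl] := cB y y0.
have near x : `|x - y| < dl -> `|B x - B y| <= e / 2.
  by move=> xy; rewrite distrC; apply: Hdl; rewrite -ball_normE /ball_/= distrC.
have [C [C0 HC]] := heat_error_cvg dl0.
have Bn0 : 0 <= Bn by rewrite fine_ge0// integral_ge0.
pose M := C * Bn + `|B y| * C.
have M0 : 0 <= M by rewrite addr_ge0// mulr_ge0.
have : \forall j \near \oo, M * tj j <= e / 2.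
  have : M * tj j @[j --> \oo] --> M * 0.
    by apply: cvgM; [exact: cvg_cst|exact: cvg_harmonic].
  rewrite mulr0 => /cvgrPdist_le/(_ _ e20); apply: filterS => j.
  by rewrite sub0r normrN ger0_norm// mulr_ge0// ltW.
apply: filterS => j Hj; have [h1 h2] := HC j.
have := smoothing_error (tj0 j) dl0 (ltW e20) near.
rewrite -{1}(fineK (fin j)) -EFinB abse_EFin lee_fin => h.
rewrite distrC (le_trans h)//.
apply: (@le_trans _ _ (e / 2 + M * tj j)); last by rewrite [leRHS](splitr e) lerD2l.
have -> : M * tj j = C * tj j * Bn + `|B y| * (C * tj j) by rewrite /M; ring.
by rewrite -addrA lerD2l lerD// ?ler_wpM2r// ler_wpM2l.
Qed.

End BesselLimit.

(** * Lower bound for the Bessel kernel and its convolution with exponentials *)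

Section BesselProperties.
Variables (R : realType) (n : nat) (B : 'rV[R]_n -> R).
Hypothesis hB : is_bessel_kernel B.
Variables (d : measure_display) (T : measurableType d).
Variables (mu : {sigma_finite_measure set T -> \bar R}) (X : T -> 'rV[R]_n).
Hypothesis mX : mrow X.
Hypothesis intRnE : forall f, vmeas f -> (forall x, (0 <= f x)%E) ->
  intRn f = (\int[mu]_w f (X w))%E.
Hypothesis intRnE' : forall f, vmeas f -> mu.-integrable setT (fun w => f (X w)) ->
  intRn f = (\int[mu]_w f (X w))%E.
Local Notation leb := (@lebesgue_measure R).
Local Notation tj j := (j.+1%:R^-1 : R).

Lemma hw_heat_ge0 m (t s : R) (y : 'rV[R]_m) : 0 < t -> 0 <= hw s * heat (t + s) y.
Proof.
move=> t0; have [s0|s0] := leP 0 s; last by rewrite hw_lt0// mul0r.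
by rewrite mulr_ge0 ?hw_ge0// ltW// heat_gt0// ltr_wpDr.
Qed.

Lemma measurable_hw_heat m (t : R) (y : 'rV[R]_m) :
  measurable_fun setT (fun s : measurableTypeR R => (hw s * heat (t + s) y)%:E).
Proof.
apply/measurable_EFinP; apply: measurable_funM; first exact: measurable_hw.
by apply: measurable_heat; [exact: measurable_funD|exact: mrow_cst].
Qed.

Definition norm1 m (y : 'rV[R]_m) : R := \sum_i `|y ord0 i|.

Lemma norm1_ge0 m (y : 'rV[R]_m) : 0 <= norm1 y.
Proof. exact: sumr_ge0. Qed.

Lemma coord_norm1 m (y : 'rV[R]_m) i : `|y ord0 i| <= norm1 y.
Proof. by rewrite /norm1 (bigD1 i)//= lerDl sumr_ge0. Qed.

Lemma edot_norm1 m (y : 'rV[R]_m) : edot y y <= norm1 y ^+ 2.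
Proof.
rewrite expr2 {1}/norm1 mulr_suml; apply: ler_sum => i _.
by rewrite -expr2 -real_normK ?num_real// expr2 ler_wpM2l// coord_norm1.
Qed.

(** The constants of [hw_heat_lb]: [e^-2] from the weight [hw] and [((4 pi)^-1 e^-2)^n] from the
    peak of the heat kernel. *)
Definition klow : R := expR (- 2) * (4 * pi)^-1 ^+ n * expR (- (2 * n%:R)).

Lemma klow_gt0 : 0 < klow.
Proof.
by rewrite !mulr_gt0 ?expR_gt0// exprn_gt0// invr_gt0 mulr_gt0// pi_gt0.
Qed.

(** With [N = norm1 y], times [s] of order [1 + N] keep the Gaussian exponent [|y|^2/(4(t+s))] below
    [N]. The rate [2 + n] adds one [N] from the weight, [n] from the peak, bounded through
    [t + s <= e^(2+N)], and one from the Gaussian. *)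
Lemma hw_heat_lb (t s : R) (y : 'rV[R]_n) : 0 < t <= 1 ->
  1 + norm1 y <= s <= 2 + norm1 y ->
  klow * expR (- ((2 + n%:R) * norm1 y)) <= hw s * heat (t + s) y.
Proof.
move=> /andP[t0 t1] /andP[s1 s2].
have N0 := norm1_ge0 y; set N := norm1 y in s1 s2 N0 *.
have s0 : 0 <= s by lra.
have u0 : 0 < t + s by lra.
have pi1 : 1 <= pi :> R by apply: le_trans (pi_ge2 R); rewrite ler1n.
rewrite hwE// heatE.
have -> : klow * expR (- ((2 + n%:R) * N)) =
    expR (- (2 + N)) * (((4 * pi)^-1 * expR (- (2 + N))) ^+ n * expR (- N)).
  rewrite /klow exprMn -expRM_natl mulrA mulrA -!mulrA.
  rewrite [expR (- (2 + N)) * _]mulrCA [expR (- 2) * _]mulrCA; congr (_ * _).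
  rewrite -!expRD; congr expR; ring.
apply: ler_pM; rewrite ?expR_ge0//.
- by rewrite mulr_ge0 ?expR_ge0// exprn_ge0// mulr_ge0 ?expR_ge0// invr_ge0 mulr_ge0// pi_ge0.
- by rewrite ler_expR lerN2.
apply: ler_pM; rewrite ?expR_ge0//.
- by rewrite exprn_ge0// mulr_ge0 ?expR_ge0// invr_ge0 mulr_ge0// pi_ge0.
- rewrite lerXn2r ?nnegrE ?invr_ge0 ?sqrtr_ge0//.
    by rewrite mulr_ge0 ?expR_ge0// invr_ge0 mulr_ge0// pi_ge0.
  rewrite expRN -invfM lef_pV2 ?posrE ?mulr_gt0 ?expR_gt0 ?sqrtr_gt0 ?pi_gt0//; last first.
    by rewrite !mulr_gt0 ?pi_gt0.
  have w1 : 1 <= 4 * pi * (t + s) by nra.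
  apply: (@le_trans _ _ (4 * pi * (t + s))).
    set W := 4 * pi * (t + s) in w1 *.
    rewrite -[leRHS]ger0_norm; last by lra.
    by rewrite -sqrtr_sqr ler_sqrt ?sqr_ge0// expr2; nra.
  rewrite ler_wpM2l ?mulr_ge0 ?pi_ge0//.
  by apply: le_trans (expR_ge1Dx _); lra.
- rewrite ler_expR mulNr lerN2 ler_pdivrMr ?mulr_gt0//.
  apply: (le_trans (edot_norm1 y)); rewrite -/N expr2 ler_wpM2l//; lra.
Qed.

Lemma kernel_approx_lb (t : R) (y : 'rV[R]_n) : 0 < t <= 1 ->
  ((klow * expR (- ((2 + n%:R) * norm1 y)))%:E <=
   \int[leb]_s (hw s * heat (t + s) y)%:E)%E.
Proof.
move=> t01; have t0 : 0 < t by case/andP: t01.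
set c := klow * _.
pose D : set (measurableTypeR R) := `[1 + norm1 y, 2 + norm1 y]%classic.
have mD : measurable D by exact: measurable_itv.
apply: (@le_trans _ _ (\int[leb]_(s in D) (hw s * heat (t + s) y)%:E)%E); last first.
  apply: ge0_subset_integral => //; first exact: measurable_hw_heat.
  by move=> s _; rewrite lee_fin hw_heat_ge0.
apply: (@le_trans _ _ (\int[leb]_(s in D) c%:E)%E).
  rewrite integral_cst//= lebesgue_measure_itv/= lte_fin ltrD2r ltr1n.
  by rewrite -EFinB (_ : 2 + _ - _ = 1) ?mule1//; ring.
apply: ge0_le_integral => //.
- by move=> s _; rewrite lee_fin mulr_ge0 ?expR_ge0// ltW// klow_gt0.
- by apply: measurable_funTS; exact: measurable_hw_heat.
- by move=> s; rewrite /D/= in_itv/= => Ds; rewrite lee_fin hw_heat_lb.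
Qed.

Local Lemma tj01 j : 0 < tj j <= 1.
Proof. by rewrite invr_gt0 ltr0n/= invf_le1// ler1n. Qed.

Lemma kernel_lb (y : 'rV[R]_n) : y != 0 ->
  klow * expR (- ((2 + n%:R) * norm1 y)) <= B y.
Proof.
move=> y0; rewrite -lee_fin.
have H := kernel_cvg hB mX intRnE intRnE' y0.
rewrite -(cvg_lim _ H)//; apply: lime_ge; first by apply/cvg_ex; eexists; exact: H.
by apply: nearW => j; apply: kernel_approx_lb; exact: tj01.
Qed.

Lemma kernel_ge0 (y : 'rV[R]_n) : y != 0 -> 0 <= B y.
Proof.
move=> y0; apply: le_trans (kernel_lb y0).
by rewrite mulr_ge0 ?expR_ge0// ltW// klow_gt0.
Qed.

Lemma approx_kernel_exp (t : R) (x k : 'rV[R]_n) : 0 < t -> edot k k < 1 ->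
  (\int[mu]_w ((\int[leb]_s (hw s * heat (t + s) (x - X w))%:E) * (expR (edot k (X w)))%:E)
   = (expR (edot k x + t * edot k k) / (1 - edot k k))%:E)%E.
Proof.
move=> t0 k1.
pose F (z : T * measurableTypeR R) : \bar R :=
  ((hw z.2 * heat (t + z.2) (x - X z.1)) * expR (edot k (X z.1)))%:E.
have mX1 : mrow (fun z : T * measurableTypeR R => X z.1).
  by move=> i; apply: (measurableT_comp (mX i)).
have mF : measurable_fun setT F.
  apply/measurable_EFinP; apply: measurable_funM; first apply: measurable_funM.
  - by apply: (measurableT_comp (@measurable_hw R)).
  - apply: measurable_heat; first exact: measurable_funD.
    by apply: mrowB => //; exact: mrow_cst.
  - apply: measurableT_comp => //.
    by apply: measurable_edot => //; exact: mrow_cst.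
have F0 z : (0 <= F z)%E by rewrite lee_fin mulr_ge0 ?expR_ge0// hw_heat_ge0.
transitivity (\int[mu]_w \int[leb]_s F (w, s))%E.
  apply: eq_integral => w _; rewrite /F/=.
  under [RHS]eq_integral do rewrite EFinM.
  rewrite ge0_integralZr//.
  - exact: measurable_hw_heat.
  - by move=> s _; rewrite lee_fin hw_heat_ge0.
rewrite fubini_tonelli//.
transitivity (\int[leb]_s ((expR (edot k x + t * edot k k))%:E *
    (hw s * expR (- (s * - edot k k)))%:E))%E.
  apply: eq_integral => s _; rewrite /F/= -EFinM.
  have [s0|s0] := leP 0 s; last first.
    rewrite hw_lt0// mul0r mulr0.
    by under eq_integral do rewrite !mul0r; rewrite integral0.
  have ts0 : 0 < t + s by rewrite ltr_wpDr.
  under eq_integral do rewrite -mulrA EFinM.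
  rewrite ge0_integralZl//.
  - rewrite (integral_heat intRnE x k ts0) -EFinM mulrCA; congr (_ * _)%:E.
    by rewrite -expRD; congr expR; ring.
  - apply/measurable_EFinP; apply: measurable_funM.
      by apply: measurable_heat => //; apply: mrowB => //; exact: mrow_cst.
    by apply: measurableT_comp => //; apply: measurable_edot => //; exact: mrow_cst.
  - by move=> w _; rewrite lee_fin mulr_ge0 ?expR_ge0// ltW// heat_gt0.
  - by rewrite lee_fin hw_ge0.
rewrite ge0_integralZl//.
- by rewrite integral_hw_exp ?ltrN2// -EFinM.
- apply/measurable_EFinP; apply: measurable_funM; first exact: measurable_hw.
  apply: measurableT_comp => //; apply: measurableT_comp => //.
  exact: measurable_funM.
- by move=> s _; rewrite lee_fin mulr_ge0 ?hw_ge0 ?expR_ge0.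
Qed.

(** Fatou applied to the smoothed kernels. At the origin [kernel_cvg] is silent; the value [klow]
    lies below all smoothed kernels there, so the pointwise comparison with the lower limit holds
    everywhere. *)
Lemma kernel_exp (x k : 'rV[R]_n) : B 0 = klow -> edot k k < 1 ->
  (\int[mu]_w (B (x - X w) * expR (edot k (X w)))%:E
   <= (expR (edot k x) / (1 - edot k k))%:E)%E.
Proof.
move=> B00 k1.
have tj0 j : 0 < tj j by case/andP: (tj01 j).
pose f j w := ((\int[leb]_s (hw s * heat (tj j + s) (x - X w))%:E) * (expR (edot k (X w)))%:E)%E.
have mXk : mrow (fun w => x - X w) by apply: mrowB => //; exact: mrow_cst.
have me : measurable_fun setT (fun w => (expR (edot k (X w)))%:E).
  apply/measurable_EFinP; apply: measurableT_comp => //.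
  by apply: measurable_edot => //; exact: mrow_cst.
have mf j : measurable_fun setT (f j).
  apply: emeasurable_funM => //.
  pose g (z : T * measurableTypeR R) : \bar R := (hw z.2 * heat (tj j + z.2) (x - X z.1))%:E.
  apply: (measurable_fun_fubini_tonelli_F g).
    apply/measurable_EFinP; apply: measurable_funM.
      by apply: (measurableT_comp (@measurable_hw R)).
    apply: measurable_heat; first exact: measurable_funD.
    by move=> i; apply: (measurableT_comp (mXk i)).
  by move=> z; rewrite lee_fin hw_heat_ge0.
have f0 j w : (0 <= f j w)%E.
  by rewrite mule_ge0 ?lee_fin ?expR_ge0// integral_ge0// => s _; rewrite lee_fin hw_heat_ge0.
have lf0 w : (0 <= limn_einf (f ^~ w))%E.
  rewrite limn_einf_lim; apply: lime_ge; first exact: is_cvg_einfs.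
  by apply: nearW => j; apply/ereal_infP => _ [m _ <-].
have B0 w : 0 <= B (x - X w) * expR (edot k (X w)).
  rewrite mulr_ge0 ?expR_ge0//; have [->|] := eqVneq (x - X w) 0; first by rewrite B00 ltW// klow_gt0.
  exact: kernel_ge0.
apply: (@le_trans _ _ (\int[mu]_w limn_einf (f ^~ w))%E).
  apply: ge0_le_integral => //.
  - by move=> w _; rewrite lee_fin.
  - apply/measurable_EFinP; apply: measurable_funM; last first.
      exact/measurable_EFinP.
    exact: (measurable_kernel hB).
  - apply: (emeasurable_fun_cvg (fun j w => einfs (f ^~ w) j)) => [j|w _].
      exact: measurable_fun_einfs.
    by rewrite limn_einf_lim; exact: is_cvg_einfs.
  - move=> w _; have [xw|xw] := eqVneq (x - X w) 0.
      rewrite xw B00 limn_einf_lim; apply: lime_ge; first exact: is_cvg_einfs.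
      apply: nearW => j; apply/ereal_infP => _ [m _ <-].
      rewrite EFinM lee_wpmul2r ?lee_fin ?expR_ge0// xw.
      apply: le_trans (kernel_approx_lb _ (tj01 m)).
      rewrite /norm1 big1 ?mulr0 ?oppr0 ?expR0 ?mulr1// => i _.
      by rewrite mxE normr0.
    have H : f j w @[j --> \oo] --> (B (x - X w) * expR (edot k (X w)))%:E.
      rewrite EFinM; apply: cvgeZr => //.
      exact: (kernel_cvg hB mX intRnE intRnE' xw).
    by rewrite (cvg_limn_einf_sup H).1.
apply: (le_trans (fatou _ _ _ _)) => //.
have H : (\int[mu]_w f j w)%E @[j --> \oo] --> (expR (edot k x) / (1 - edot k k))%:E.
  under eq_fun do rewrite (approx_kernel_exp x (tj0 _) k1).
  apply: cvg_EFin; first exact: nearW.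
  apply: cvgM; last exact: cvg_cst.
  apply: (cvg_comp (fun j => edot k x + tj j * edot k k) (@expR R)); last first.
    exact: continuous_expR.
  have : edot k x + tj j * edot k k @[j --> \oo] --> edot k x + 0 * edot k k.
    apply: cvgD; first exact: cvg_cst.
    by apply: cvgM; [exact: cvg_harmonic|exact: cvg_cst].
  by rewrite mul0r addr0.
by rewrite (cvg_limn_einf_sup H).1.
Qed.

End BesselProperties.

(** * Monotonicity and linearity of the space-time integral operators *)

Section TimeConvolution.
Variables (R : realType) (n : nat) (B : 'rV[R]_n -> R).
Local Notation leb := (@lebesgue_measure R).

Definition smeas m (f : 'rV[R]_m -> R) :=
  forall d (T : measurableType d) (Y : T -> 'rV[R]_m), mrow Y ->
    measurable_fun setT (fun w => f (Y w)).

Definition stmeas m (f : 'rV[R]_m -> R -> R) :=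
  forall d (T : measurableType d) (Y : T -> 'rV[R]_m) (S : T -> R), mrow Y ->
    measurable_fun setT S -> measurable_fun setT (fun w => f (Y w) (S w)).

Lemma stmeas_smeas m (f : 'rV[R]_m -> R -> R) s : stmeas f -> smeas (f ^~ s).
Proof. by move=> mf d T Y mY; apply: (mf _ _ Y (cst s)). Qed.

Hypothesis B0 : forall y, 0 <= B y.
Hypothesis mB : smeas B.
Variables (d : measure_display) (T : measurableType d).
Variables (mu : {sigma_finite_measure set T -> \bar R}) (X : T -> 'rV[R]_n).
Hypothesis mX : mrow X.
Hypothesis intRnE : forall f, vmeas f -> (forall x, (0 <= f x)%E) ->
  intRn f = (\int[mu]_w f (X w))%E.

Lemma mrow_subX d' (T' : measurableType d') (x : 'rV[R]_n) (Y : T' -> 'rV[R]_n) :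
  mrow Y -> mrow (fun w => x - Y w).
Proof.
move=> mY i; rewrite (_ : (fun w => _) = (fun w => x ord0 i - Y w ord0 i)).
  exact: measurable_funB.
by apply/funext => w; rewrite !mxE.
Qed.

Lemma bconvE (f : 'rV[R]_n -> R) x : smeas f -> (forall y, 0 <= f y) ->
  bconv B f x = (\int[mu]_w (B (x - X w) * f (X w))%:E)%E.
Proof.
move=> mf f0; rewrite /bconv intRnE// => [d' T' Y mY|y].
  apply/measurable_EFinP; apply: measurable_funM; last exact: mf.
  by apply: mB; exact: mrow_subX.
by rewrite lee_fin mulr_ge0.
Qed.

Lemma bconv_ge0 (f : 'rV[R]_n -> R) x : smeas f -> (forall y, 0 <= f y) ->
  (0 <= bconv B f x)%E.
Proof.
move=> mf f0; rewrite bconvE//; apply: integral_ge0 => w _.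
by rewrite lee_fin mulr_ge0.
Qed.

Local Lemma measurable_conv (f : 'rV[R]_n -> R) x : smeas f ->
  measurable_fun setT (fun w => (B (x - X w) * f (X w))%:E).
Proof.
move=> mf; apply/measurable_EFinP; apply: measurable_funM; last exact: mf.
by apply: mB; exact: mrow_subX.
Qed.

Lemma le_bconv (f g : 'rV[R]_n -> R) x : smeas f -> smeas g ->
  (forall y, 0 <= f y) -> (forall y, f y <= g y) ->
  (bconv B f x <= bconv B g x)%E.
Proof.
move=> mf mg f0 fg; rewrite !bconvE//; last by move=> y; exact: le_trans (fg y).
apply: ge0_le_integral => //.
- by move=> w _; rewrite lee_fin mulr_ge0.
- exact: measurable_conv.
- exact: measurable_conv.
- by move=> w _; rewrite lee_fin ler_wpM2l.
Qed.

Lemma bconvD (f g : 'rV[R]_n -> R) x : smeas f -> smeas g ->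
  (forall y, 0 <= f y) -> (forall y, 0 <= g y) ->
  bconv B (fun y => f y + g y) x = (bconv B f x + bconv B g x)%E.
Proof.
move=> mf mg f0 g0; rewrite !bconvE//; last 2 first.
- by move=> d' T' Y mY; apply: measurable_funD; [exact: mf|exact: mg].
- by move=> y; rewrite addr_ge0.
rewrite -ge0_integralD//.
- by apply: eq_integral => w _; rewrite mulrDr EFinD.
- by move=> w _; rewrite lee_fin mulr_ge0.
- exact: measurable_conv.
- by move=> w _; rewrite lee_fin mulr_ge0.
- exact: measurable_conv.
Qed.

Lemma bconvZ (c : R) (f : 'rV[R]_n -> R) x : smeas f -> 0 <= c ->
  (forall y, 0 <= f y) -> bconv B (fun y => c * f y) x = (c%:E * bconv B f x)%E.
Proof.
move=> mf c0 f0; rewrite !bconvE//; last 2 first.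
- by move=> d' T' Y mY; apply: measurable_funM => //; exact: mf.
- by move=> y; rewrite mulr_ge0.
rewrite -ge0_integralZl//.
- by apply: eq_integral => w _; rewrite -EFinM mulrCA.
- exact: measurable_conv.
- by move=> w _; rewrite lee_fin mulr_ge0.
Qed.

Lemma measurable_bconv (f : 'rV[R]_n -> R -> R) x : stmeas f ->
  (forall y s, 0 <= f y s) -> measurable_fun setT (fun s => bconv B (f ^~ s) x).
Proof.
move=> mf f0.
rewrite (_ : (fun s => _) = (fun s => \int[mu]_w (B (x - X w) * f (X w) s)%:E)%E); last first.
  by apply/funext => s; rewrite bconvE//; exact: stmeas_smeas.
pose g (z : R * T) : \bar R := (B (x - X z.2) * f (X z.2) z.1)%:E.
apply: (measurable_fun_fubini_tonelli_F g); last by move=> z; rewrite lee_fin mulr_ge0.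
have mX2 : mrow (fun z : R * T => X z.2).
  by move=> i; apply: (measurableT_comp (mX i)).
apply/measurable_EFinP; apply: measurable_funM.
  by apply: mB; exact: mrow_subX.
exact: mf.
Qed.

(** Discarding time zero allows pointwise bounds at positive times only, which is where [V] is
    bounded by the power of [|x|]. *)
Lemma tintE (t : R) (F : R -> \bar R) : measurable_fun setT F ->
  tint t F = (\int[leb]_(s in `]0%R, t]) F s)%E.
Proof.
move=> mF; rewrite integral_itv_obnd_cbnd; last exact: measurable_funTS.
by rewrite /tint; congr (integral _ _ _); apply/seteqP.
Qed.

Lemma le_tint (t : R) (F G : R -> \bar R) : measurable_fun setT F ->
  measurable_fun setT G -> (forall s, 0 < s <= t -> (0 <= F s <= G s)%E) ->
  (tint t F <= tint t G)%E.
Proof.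
move=> mF mG FG; rewrite !tintE//; apply: ge0_le_integral => //.
- by move=> s; rewrite /= in_itv/= => /FG/andP[].
- exact: measurable_funTS.
- exact: measurable_funTS.
- by move=> s; rewrite /= in_itv/= => /FG/andP[].
Qed.

Lemma tint_ge0 (t : R) (F : R -> \bar R) : measurable_fun setT F ->
  (forall s, 0 < s <= t -> (0 <= F s)%E) -> (0 <= tint t F)%E.
Proof.
move=> mF F0; rewrite tintE//; apply: integral_ge0 => s.
by rewrite /= in_itv/=; exact: F0.
Qed.

Variables (q : R -> R).
Hypothesis q0 : forall s, 0 <= q s.
Hypothesis mq : measurable_fun setT q.

Local Lemma measurable_qbconv (f : 'rV[R]_n -> R -> R) x : stmeas f ->
  (forall y s, 0 <= f y s) ->
  measurable_fun setT (fun s => (q s)%:E * bconv B (f ^~ s) x)%E.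
Proof.
move=> mf f0; apply: emeasurable_funM; first exact/measurable_EFinP.
exact: measurable_bconv.
Qed.

Lemma tint_bconv_ge0 (t : R) (f : 'rV[R]_n -> R -> R) x : stmeas f ->
  (forall y s, 0 <= f y s) -> (0 <= tint t (fun s => (q s)%:E * bconv B (f ^~ s) x))%E.
Proof.
move=> mf f0; apply: tint_ge0 => [|s _]; first exact: measurable_qbconv.
by rewrite mule_ge0 ?lee_fin// bconv_ge0//; exact: stmeas_smeas.
Qed.

(** The excess has separated variables: convolution meets only [rho] and the time integral only [w],
    so each later estimate reduces to one scalar integral. *)
Lemma tint_bconv_ub (t C : R) (f g : 'rV[R]_n -> R -> R) (w : R -> R)
    (rho : 'rV[R]_n -> R) x :
  stmeas f -> stmeas g -> smeas rho -> measurable_fun setT w -> 0 <= C ->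
  (forall y s, 0 <= f y s) -> (forall y s, 0 <= g y s) ->
  (forall y, 0 <= rho y) -> (forall s, 0 <= w s) ->
  (forall y s, 0 < s <= t -> f y s <= g y s + w s * rho y) ->
  (bconv B rho x <= C%:E)%E ->
  (tint t (fun s => (q s)%:E * bconv B (f ^~ s) x) <=
   tint t (fun s => (q s)%:E * bconv B (g ^~ s) x) +
   C%:E * tint t (fun s => (q s * w s)%:E))%E.
Proof.
move=> mf mg mr mw C0 f0 g0 r0 w0 fg HC.
have mf1 := @measurable_qbconv f x mf f0.
have mg1 := @measurable_qbconv g x mg g0.
have mqw : measurable_fun setT (fun s => (q s * w s)%:E).
  by apply/measurable_EFinP; exact: measurable_funM.
have mCqw : measurable_fun setT (fun s => C%:E * (q s * w s)%:E)%E.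
  by apply: emeasurable_funM.
have qb0 s : (0 <= (q s)%:E * bconv B (g ^~ s) x)%E.
  by rewrite mule_ge0 ?lee_fin// bconv_ge0//; exact: stmeas_smeas.
apply: (@le_trans _ _ (tint t (fun s => (q s)%:E * bconv B (g ^~ s) x +
    C%:E * (q s * w s)%:E))%E).
  apply: le_tint => //; first exact: emeasurable_funD.
  move=> s st; apply/andP; split.
    by rewrite mule_ge0 ?lee_fin// bconv_ge0//; exact: stmeas_smeas.
  rewrite EFinM muleCA -ge0_muleDr//; last 2 first.
    by rewrite bconv_ge0//; exact: stmeas_smeas.
    by rewrite mule_ge0 ?lee_fin.
  rewrite lee_wpmul2l ?lee_fin//.
  have mgs : smeas (g ^~ s) by exact: stmeas_smeas.
  have mfs : smeas (f ^~ s) by exact: stmeas_smeas.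
  have mwr : smeas (fun y => w s * rho y).
    by move=> d' T' Y mY; apply: measurable_funM => //; exact: mr.
  apply: (@le_trans _ _ (bconv B (fun y => g y s + w s * rho y) x)).
    apply: le_bconv => //.
      by move=> d' T' Y mY; apply: measurable_funD; [exact: mgs|exact: mwr].
    by move=> y; exact: fg.
  rewrite bconvD//; last by move=> y; rewrite mulr_ge0.
  by rewrite bconvZ// leeD2l// muleC lee_wpmul2r ?lee_fin.
rewrite !tintE//; last exact: emeasurable_funD.
rewrite ge0_integralD//; last 3 first.
- exact: measurable_funTS.
- by move=> s _; rewrite mule_ge0 ?lee_fin// mulr_ge0.
- exact: measurable_funTS.
rewrite ge0_integralZl//; last 2 first.
- exact: measurable_funTS.
- by move=> s _; rewrite lee_fin mulr_ge0.
Qed.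

Lemma tint_bconv_lb (t K : R) (f : 'rV[R]_n -> R -> R) (w : R -> R)
    (g : 'rV[R]_n -> R) x :
  stmeas f -> smeas g -> measurable_fun setT w -> 0 <= K ->
  (forall y s, 0 <= f y s) -> (forall y, 0 <= g y) -> (forall s, 0 <= w s) ->
  (forall y s, 0 < s <= t -> w s * g y <= f y s) ->
  (K%:E <= bconv B g x)%E ->
  (K%:E * tint t (fun s => (q s * w s)%:E) <=
   tint t (fun s => (q s)%:E * bconv B (f ^~ s) x))%E.
Proof.
move=> mf mg mw K0 f0 g0 w0 fg HK.
have mf1 := @measurable_qbconv f x mf f0.
have mqw : measurable_fun setT (fun s => (q s * w s)%:E).
  by apply/measurable_EFinP; exact: measurable_funM.
rewrite [X in (K%:E * X <= _)%E]tintE// -ge0_integralZl//; last 2 first.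
- exact: measurable_funTS.
- by move=> s _; rewrite lee_fin mulr_ge0.
rewrite -tintE; last exact: emeasurable_funM.
apply: le_tint => //; first exact: emeasurable_funM.
move=> s st; rewrite mule_ge0 ?lee_fin ?mulr_ge0//= EFinM muleCA.
rewrite lee_wpmul2l ?lee_fin//.
apply: (@le_trans _ _ (bconv B (fun y => w s * g y) x)).
  by rewrite bconvZ// muleC lee_wpmul2l ?lee_fin.
apply: le_bconv.
- by move=> d' T' Y mY; apply: measurable_funM => //; exact: mg.
- exact: stmeas_smeas.
- by move=> y; rewrite mulr_ge0.
- by move=> y; exact: fg.
Qed.

End TimeConvolution.

(** * Inequalities and continuity for real powers *)

Section RealPowers.
Variable R : realType.
Implicit Types x y z m : R.

Lemma powR_monotone a x y : 0 <= a -> 0 <= x -> x <= y -> x `^ a <= y `^ a.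
Proof.
by move=> a0 x0 xy; apply: (ge0_ler_powR a0); rewrite ?nnegrE// (le_trans x0).
Qed.

(** The truncation keeps the base where [powR] is the usual power, so that continuity holds through
    0. *)
Lemma continuous_powR_max a : 0 < a -> continuous (fun x : R => Num.max x 0 `^ a).
Proof.
move=> a0 x.
have [x0|x0|x0] := ltgtP x 0.
- have H : {near x, (fun x : R => Num.max x 0 `^ a) =1 cst 0}.
    have : \forall y \near x, y < 0 by exact: lt_nbhsl.
    by apply: filterS => y y0 /=; rewrite (max_idPr (ltW y0)) powR0// gt_eqF.
  rewrite /continuous_at (max_idPr (ltW x0)) powR0 ?gt_eqF//.
  by apply: cvg_near_cst.
- have H : \forall y \near x, y `^ a = Num.max y 0 `^ a.
    have : \forall y \near x, 0 < y by exact: lt_nbhsr.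
    by apply: filterS => y y0; rewrite (max_idPl (ltW y0)).
  rewrite /continuous_at (max_idPl (ltW x0)).
  apply: cvg_trans (near_eq_cvg H) _.
  exact: (der_continuous (is_derive1_powR a x0)).
- rewrite x0 /continuous_at maxxx powR0 ?gt_eqF//.
  apply/cvgrPdist_le => e e0.
  have d0 : 0 < e `^ a^-1 by exact: powR_gt0.
  have : \forall y \near (0 : R), `|0 - y| < e `^ a^-1.
    by apply/nbhs_ballP; exists (e `^ a^-1).
  apply: filterS => y; rewrite sub0r normrN => yd.
  rewrite sub0r normrN ger0_norm ?powR_ge0//.
  apply: (@le_trans _ _ ((e `^ a^-1) `^ a)).
    apply: powR_monotone; [exact: ltW|by rewrite le_max lexx orbT|].
    by rewrite ge_max (ltW d0) andbT (le_trans (ler_norm y))// ltW.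
  by rewrite -powRrM mulVf ?gt_eqF// powRr1// ltW.
Qed.

Lemma continuous_powR_comp (T : topologicalType) (f : T -> R) a : 0 < a ->
  (forall x : T, 0 <= f x) -> continuous f -> continuous (fun x : T => f x `^ a).
Proof.
move=> a0 f0 cf; have -> : (fun x : T => f x `^ a) = (fun x : R => Num.max x 0 `^ a) \o f.
  by apply/funext => x /=; rewrite (max_idPl (f0 x)).
by move=> x; apply: continuous_comp; [exact: cf|exact: continuous_powR_max].
Qed.

Lemma powR_bernoulli p m z : 0 < p < 1 -> 0 < m -> 0 <= z ->
  (m + z) `^ p <= m `^ p + p * m `^ (p - 1) * z.
Proof.
move=> /andP[p0 p1] m0 z0; pose r := z / m.
have r0 : 0 <= r by rewrite divr_ge0// ltW.
have zr : z = m * r by rewrite /r mulrC divfK// gt_eqF.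
have A0 : 0 < 1 + r by rewrite ltr_wpDr.
have M0 : 0 < 1 + p * r by rewrite ltr_wpDr// mulr_ge0// ltW.
have key : (1 + r) `^ p <= 1 + p * r.
  rewrite /powR gt_eqF// -[leRHS]lnK ?posrE// ler_expR.
  (* Weighted arithmetic-geometric mean: apply this at [(1+r)/(1+p*r)] with weight [p] and at
     [1/(1+p*r)] with weight [1-p]; the right-hand sides cancel. *)
  have h (y : R) : 0 < y -> ln y <= y - 1.
    by move=> y0; have := @le_ln1Dx R (y - 1); rewrite subrKC; apply; lra.
  have h1 := h _ (divr_gt0 A0 M0).
  have MV0 : 0 < (1 + p * r)^-1 by rewrite invr_gt0.
  have h2 := h _ MV0.
  rewrite lnM ?posrE// lnV ?posrE// in h1; rewrite lnV ?posrE// in h2.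
  have E : p * ((1 + r) / (1 + p * r) - 1) + (1 - p) * ((1 + p * r)^-1 - 1) = 0.
    by field; rewrite gt_eqF.
  have := lerD (ler_wpM2l (ltW p0) h1) (ler_wpM2l (_ : 0 <= 1 - p) h2).
  rewrite E => /(_ ltac:(lra)); nra.
have -> : m + z = m * (1 + r) by rewrite mulrDr mulr1 -zr.
rewrite powRM ?(ltW m0) ?(ltW A0)//.
apply: (le_trans (ler_wpM2l (powR_ge0 _ _) key)).
have -> : m `^ (p - 1) = m `^ p / m.
  rewrite powRD; last by rewrite (gt_eqF m0) implybT.
  by rewrite powR_inv1 ?ltW.
by rewrite /r le_eqVlt; apply/orP; left; apply/eqP; field; rewrite gt_eqF.
Qed.

Lemma powR_ge_id p y : 0 < p < 1 -> 0 <= y <= 1 -> y <= y `^ p.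
Proof.
move=> /andP[p0 p1] /andP[]; rewrite le_eqVlt => /orP[/eqP <-|y0] y1.
  by rewrite powR_ge0.
rewrite /powR gt_eqF// -[leLHS]lnK ?posrE// ler_expR.
have : ln y <= 0 by exact: ln_le0.
nra.
Qed.

Lemma powR_subadditive p x z : 0 < p < 1 -> 0 <= x -> 0 <= z ->
  (x + z) `^ p <= x `^ p + z `^ p.
Proof.
move=> p01 x0 z0; have [p0 p1] := andP p01.
have := addr_ge0 x0 z0; rewrite le_eqVlt => /orP[/eqP <-|c0].
  by rewrite powR0 ?gt_eqF// addr_ge0// powR_ge0.
set c := x + z in c0 *.
(* A number of [[0, 1]] is at most its [p]-th power; use this for the two fractions of [c], which
   sum to 1. *)
have h y : 0 <= y -> y <= c -> c `^ p * (y / c) <= y `^ p.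
  move=> y0 yc; have yc1 : 0 <= y / c <= 1.
    by rewrite divr_ge0 ?(ltW c0)//= ler_pdivrMr// mul1r.
  rewrite -[in leRHS](divfK (lt0r_neq0 c0) y) (mulrC (y / c)) powRM ?(ltW c0)//.
    by rewrite ler_wpM2l ?powR_ge0// powR_ge_id.
  by case/andP: yc1.
have -> : c `^ p = c `^ p * (x / c) + c `^ p * (z / c).
  by rewrite -mulrDr -mulrDl divff ?mulr1// gt_eqF.
by rewrite lerD// h// /c ?lerDl ?lerDr.
Qed.

(** Closes both lower-bound bootstraps: the [j]-th stage is a geometric mean of the target [x] and a
    crude bound [m], in which [m] has the vanishing weight [p^j]. *)
Lemma powR_interp_le p x m z : 0 < p < 1 -> 0 < x -> 0 < m ->
  (forall j : nat, x `^ (1 - p ^+ j) * m `^ (p ^+ j) <= z) -> x <= z.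
Proof.
move=> /andP[p0 p1] x0 m0 H.
pose f (j : nat) := expR ((1 - p ^+ j) * ln x + p ^+ j * ln m).
have fE j : x `^ (1 - p ^+ j) * m `^ (p ^+ j) = f j.
  by rewrite /powR !gt_eqF// -expRD.
have pj : p ^+ j @[j --> \oo] --> (0 : R).
  have := @cvg_geometric R 1 p; rewrite /geometric/= ger0_norm ?(ltW p0)// => /(_ p1).
  by under eq_fun do rewrite mul1r.
have cf : f j @[j --> \oo] --> x.
  rewrite -[X in _ --> X](lnK (x := x)) ?posrE//.
  apply: (cvg_comp (fun j : nat => (1 - p ^+ j) * ln x + p ^+ j * ln m) (@expR R)); last first.
    exact: continuous_expR.
  have : (1 - p ^+ j) * ln x + p ^+ j * ln m @[j --> \oo] -->
      (1 - 0) * ln x + 0 * ln m.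
    apply: cvgD; (apply: cvgM; last exact: cvg_cst); last exact: pj.
    by apply: cvgB; [exact: cvg_cst|exact: pj].
  by rewrite subr0 mul1r mul0r addr0.
rewrite -(cvg_lim _ cf)//; apply: limr_le; first by apply/cvg_ex; exists x.
by apply: nearW => j; rewrite -fE.
Qed.

End RealPowers.

(** * The primitive [L] and the integral of its powers *)

Section Primitive.
Variables (R : realType) (l : R -> R) (T : R).
Hypothesis cl : continuous l.
Hypothesis l0 : forall s, 0 < l s.
Hypothesis T0 : 0 <= T.
Local Notation leb := (@lebesgue_measure R).

(** Freezes time outside [[0, T]]: composing with it turns data controlled on that interval into
    total functions. *)
Definition clamp (s : R) : R := Num.max 0 (Num.min s T).

Lemma clamp_itv s : 0 <= clamp s <= T.
Proof. by rewrite /clamp le_max lexx/= ge_max T0/= ge_min lexx orbT. Qed.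

Lemma clamp_id s : 0 <= s <= T -> clamp s = s.
Proof. by move=> /andP[s0 sT]; rewrite /clamp (min_idPl sT) (max_idPr s0). Qed.

Lemma continuous_clamp : continuous clamp.
Proof.
move=> s; apply: (@continuous_max R R (cst 0) (fun s => Num.min s T) s).
  exact: cvg_cst.
apply: (@continuous_min R R (fun s => s) (cst T) s); first exact: cvg_id.
exact: cvg_cst.
Qed.

Lemma exists_primitive : exists L : R -> R,
  [/\ continuous L, L 0 = 0 /\ (forall s, 0 <= L s), forall s : R, 0 < s <= T -> 0 < L s,
      (exists2 M : R, 0 < M & forall s : R, 0 <= s <= T -> L s <= M * s) &
      forall s : R, 0 < s < T -> is_derive s 1 L (l s)].
Proof.
(* The integral starts at -1 so that 0 is an interior point and [G] is differentiable there. *)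
pose G (x : R) : R := (\int[leb]_(t in `[-1, x]) l t)%R.
have il u : leb.-integrable `[-1, u] (EFin \o l).
  apply: continuous_compact_integrable; first exact: segment_compact.
  exact: continuous_subspaceT.
have dG (x : R) : -1 < x -> is_derive x 1 G (l x).
  move=> x1; have xu : x < x + 1 by rewrite ltrDl.
  have [d1 d2] := continuous_FTC1_closed xu (il (x + 1)) x1 (cl (x := x)).
  by apply: DeriveDef; [exact: d1|rewrite -derive1E; exact: d2].
pose H x := G x - G 0.
have dH (x : R) : -1 < x -> is_derive x 1 H (l x).
  move=> x1; have dGx := dG x x1.
  by apply: is_derive_eq; rewrite subr0.
have mvt (s : R) : 0 < s <= T -> exists2 c : R, c \in `]0, s[ & H s = l c * s.
  move=> /andP[s0 sT].
  have [||c cs] := @MVT R H l 0 s s0.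
  - by move=> x; rewrite in_itv/= => /andP[x0 _]; apply: dH; lra.
  - apply: derivable_within_continuous => x; rewrite in_itv/= => /andP[x0 _].
    by apply: ex_derive; apply: dH; lra.
  by rewrite /H subrr !subr0 => E; exists c.
(* Clamping makes the primitive nonnegative on the whole line; the derivative formula is kept inside
   []0, T[]. *)
exists (H \o clamp); split.
- move=> s; apply: continuous_comp; first exact: continuous_clamp.
  have /andP[h _] := clamp_itv s.
  by apply: (der_continuous (dH _ _)); lra.
- split; first by rewrite /= clamp_id ?lexx// /H subrr.
  move=> s /=; have := clamp_itv s; move: (clamp s) => r /andP[].
  rewrite le_eqVlt => /orP[/eqP <-|r0] rT; first by rewrite /H subrr.
  have [|c _ ->] := mvt r; first by rewrite r0.
  by rewrite mulr_ge0// ltW.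
- move=> s sT /=; rewrite clamp_id; last by case/andP: sT => /ltW -> ->.
  have [c _ ->] := mvt s sT; case/andP: sT => s0 _.
  by rewrite mulr_gt0.
- have [c _ Hc] := @EVT_max R l 0 T T0 (continuous_subspaceT cl).
  exists (l c) => // s sT; rewrite /= clamp_id//.
  have /andP[] := sT; rewrite le_eqVlt => /orP[/eqP <- _|s0 sT'].
    by rewrite /H subrr mulr0.
  have [|e] := mvt s; first by rewrite s0.
  rewrite in_itv/= => /andP[e0 es] ->; rewrite ler_wpM2r ?(ltW s0)//.
  by apply: Hc; rewrite in_itv/= ltW//= ltW// (lt_le_trans es).
- move=> s /andP[s0 sT].
  have dHs : is_derive s 1 H (l s) by apply: dH; lra.
  have E : \forall y \near s, H y = (H \o clamp) y.
    have : \forall y \near s, y \in `]0, T[.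
      by apply: near_in_itvoo; rewrite in_itv/= s0 sT.
    apply: filterS => y; rewrite in_itv/= => /andP[y0 yT].
    by rewrite /= clamp_id// !ltW.
  exact: (near_eq_is_derive E dHs).
Qed.

Variable L : R -> R.
Hypothesis cL : continuous L.
Hypothesis L00 : L 0 = 0.
Hypothesis Lge0 : forall s, 0 <= L s.
Hypothesis Lgt0 : forall s, 0 < s <= T -> 0 < L s.
Hypothesis dL : forall s, 0 < s < T -> is_derive s 1 L (l s).

Variables (K eta g : R).
Hypothesis eta0 : 0 <= eta.
Hypothesis g1 : 1 < g.

Let W (s : R) := expR (K * s) * (L s + eta) `^ g.
Let W1 (s : R) := expR (K * s) * (l s * (L s + eta) `^ (g - 1)).

Local Lemma Leta_ge0 s : 0 <= L s + eta.
Proof. by rewrite addr_ge0. Qed.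

Local Lemma cLeta : continuous (fun s => L s + eta).
Proof. by move=> s; apply: cvgD; [exact: cL|exact: cvg_cst]. Qed.

Local Lemma cexpK : continuous (fun s : R => expR (K * s)).
Proof. by move=> s; apply: der_continuous. Qed.

Lemma continuous_W : continuous W.
Proof.
move=> s; apply: cvgM; first exact: cexpK.
by apply: (continuous_powR_comp (f := fun s => L s + eta)); [exact: lt_trans g1|exact: Leta_ge0|exact: cLeta].
Qed.

Lemma continuous_W1 : continuous W1.
Proof.
move=> s; apply: cvgM; first exact: cexpK.
apply: cvgM; first exact: cl.
by apply: (continuous_powR_comp (f := fun s => L s + eta)); [rewrite subr_gt0|exact: Leta_ge0|exact: cLeta].
Qed.

(** [K * W + g * W1] is the derivative of [W]. In the comparison the first term pays for the linear
    convolution and the second for the nonlinear one. For [eta = 0] the base vanishes at time 0,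
    where continuity of [W] suffices. *)
Lemma tint_power t : 0 <= t <= T ->
  tint t (fun s => (K * W s + g * W1 s)%:E) = (W t - eta `^ g)%:E.
Proof.
move=> /andP[]; rewrite le_eqVlt => /orP[/eqP <- _|t0 tT].
  rewrite /tint /W mulr0 expR0 mul1r L00 add0r subrr.
  rewrite (_ : [set s : R | 0 <= s <= 0] = [set 0]) ?integral_set1//.
  by apply/seteqP; split=> s /=; [move=> /le_anti|move=> ->; rewrite lexx].
rewrite /tint (_ : [set s : R | 0 <= s <= t] = `[0, t]%classic); last first.
  by apply/seteqP; split=> s /=; rewrite in_itv.
have cf : continuous (fun s => K * W s + g * W1 s).
  move=> s; apply: cvgD; (apply: cvgM; first exact: cvg_cst).
    exact: continuous_W.
  exact: continuous_W1.
rewrite (@continuous_FTC2 _ (fun s => K * W s + g * W1 s) W)//.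
- by rewrite -EFinB {2}/W mulr0 expR0 mul1r L00 add0r.
- exact: continuous_subspaceT.
- split.
  + move=> s; rewrite in_itv/= => /andP[s0 st].
    have dLs : is_derive s 1 L (l s) by apply: dL; rewrite s0 (lt_le_trans st).
    have Ls : 0 < L s + eta by rewrite ltr_wpDr// Lgt0// s0 ltW// (lt_le_trans st).
    have dp := @der_comp R (fun x => x `^ g) (fun y => L y + eta) s _ _ (is_derive1_powR g Ls) (derD dLs (derC eta s)).
    by have [dW _] := derM (der_exp (derM (derC K s) (derI s))) dp; exact: dW.
  + by apply: cvg_at_right_filter; exact: continuous_W.
  + by apply: cvg_at_left_filter; exact: continuous_W.
- move=> s; rewrite in_itv/= => /andP[s0 st].
  have dLs : is_derive s 1 L (l s) by apply: dL; rewrite s0 (lt_le_trans st).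
  have Ls : 0 < L s + eta by rewrite ltr_wpDr// Lgt0// s0 ltW// (lt_le_trans st).
  have dp := @der_comp R (fun x => x `^ g) (fun y => L y + eta) s _ _ (is_derive1_powR g Ls) (derD dLs (derC eta s)).
  have D := derM (der_exp (derM (derC K s) (derI s))) dp.
  by rewrite derive1E; case: D => _ ->; rewrite /W /W1; ring.
Qed.

End Primitive.

(** * The weighted norm, boundedness and joint measurability *)

Section WeightedSpaces.
Variables (R : realType) (n : nat).
Implicit Types x y : 'rV[R]_n.

Lemma enorm_ge0 x : 0 <= enorm x. Proof. exact: sqrtr_ge0. Qed.

Lemma coord_enorm x i : `|x ord0 i| <= enorm x.
Proof.
rewrite -sqrtr_sqr /enorm ler_sqrt; last by apply: sumr_ge0 => j _; exact: sqr_ge0.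
by rewrite (bigD1 i)//= lerDl sumr_ge0// => j _; exact: sqr_ge0.
Qed.

Definition wt (a : R) x : R := (1 + enorm x ^+ 2) `^ (a / 2).

Lemma wt_gt0 a x : 0 < wt a x.
Proof. by rewrite powR_gt0// ltr_pwDl// sqr_ge0. Qed.

Lemma wt_ge1 a x : 0 <= a -> 1 <= wt a x.
Proof.
move=> a0; have h : 1 <= 1 + enorm x ^+ 2 by rewrite lerDl sqr_ge0.
have := @powR_monotone R (a / 2) 1 (1 + enorm x ^+ 2) (divr_ge0 a0 (ler0n _ 2)) ler01 h.
by rewrite powR1.
Qed.

Lemma enorm_powR_wt a x : 0 <= a -> enorm x `^ a <= wt a x.
Proof.
move=> a0; have -> : enorm x `^ a = (enorm x ^+ 2) `^ (a / 2).
  rewrite -powR_mulrn ?enorm_ge0// -powRrM; congr (_ `^ _); by field.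
by apply: powR_monotone; rewrite ?divr_ge0 ?sqr_ge0// lerDr.
Qed.

(** Compactness of a box covers the region where the growth condition says nothing. The set in
    [wnorm] is then bounded above, which makes its [sup] a genuine supremum. *)
Lemma BC_ubound a (phi : 'rV[R]_n -> R) : 0 <= a -> BC a phi ->
  exists2 C, 0 <= C & forall x, `|phi x| <= C * wt a x.
Proof.
move=> a0 [cphi [C [M HM]]].
pose M' := Num.max M 0.
pose K : set 'rV[R]_n := [set v | forall i, `[- M', M']%classic (v ord0 i)].
have cK : compact K.
  by apply: (@rV_compact _ _ (fun=> `[- M', M']%classic)) => i; exact: segment_compact.
have M0 : 0 <= M' by rewrite le_max lexx orbT.
have K0 : K !=set0 by exists 0 => i /=; rewrite mxE in_itv/= M0 oppr_le0 M0.
have cn : {within K, continuous (fun x => `|phi x|)}.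
  apply: continuous_subspaceT => x; apply: continuous_comp; first exact: cphi.
  exact: norm_continuous.
have [c _ Hc] := EVT_max_rV K0 cK cn.
exists (`|C| + `|phi c|) => [|x]; first exact: addr_ge0.
have w1 := wt_ge1 x a0.
have [/HM h|xM] := leP M (enorm x).
  apply: (le_trans h); rewrite mulrDl.
  apply: (@le_trans _ _ (`|C| * wt a x)); last by rewrite lerDl mulr_ge0// ltW// wt_gt0.
  apply: (@le_trans _ _ (`|C| * enorm x `^ a)); first by rewrite ler_wpM2r ?powR_ge0// ler_norm.
  by rewrite ler_wpM2l// enorm_powR_wt.
have Kx : x \in K.
  rewrite inE => i /=; rewrite in_itv/= -ler_norml (le_trans (coord_enorm x i))//.
  by rewrite le_max (ltW xM).
apply: (le_trans (Hc x Kx)); rewrite mulrDl.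
apply: (@le_trans _ _ (`|phi c| * wt a x)); first by rewrite ler_peMr.
by rewrite lerDr mulr_ge0// ltW// wt_gt0.
Qed.

Lemma wtN a x : (1 + enorm x ^+ 2) `^ (- (a / 2)) = (wt a x)^-1.
Proof. by rewrite powRN. Qed.

Lemma BC_le_wnorm a (phi : 'rV[R]_n -> R) x : 0 <= a -> BC a phi ->
  `|phi x| <= wnorm a phi * wt a x.
Proof.
move=> a0 /(BC_ubound a0)[C C0 HC].
rewrite -ler_pdivrMr ?wt_gt0// mulrC -wtN.
apply: ub_le_sup; last by exists x.
exists C => _ [y _ <-]; rewrite wtN mulrC ler_pdivrMr ?wt_gt0//.
Qed.

Lemma wnorm_le a (phi : 'rV[R]_n -> R) C : (forall x, `|phi x| <= C * wt a x) ->
  wnorm a phi <= C.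
Proof.
move=> HC; apply: ge_sup; first by exists ((1 + enorm (0 : 'rV[R]_n) ^+ 2) `^ (- (a / 2)) * `|phi 0|); exists 0.
by move=> _ [y _ <-]; rewrite wtN mulrC ler_pdivrMr ?wt_gt0.
Qed.

Lemma BC_sub a (phi psi : 'rV[R]_n -> R) : BC a phi -> BC a psi ->
  BC a (fun x => phi x - psi x).
Proof.
move=> [c1 [C1 [M1 H1]]] [c2 [C2 [M2 H2]]]; split.
  by move=> x; exact: (cvgB (c1 x) (c2 x)).
exists (C1 + C2), (Num.max M1 M2) => x; rewrite ge_max => /andP[m1 m2].
by rewrite (le_trans (ler_normB _ _))// mulrDl lerD// ?H1 ?H2.
Qed.

Variables (tau0 : \bar R) (a T : R).
Hypothesis a0 : 0 <= a.
Hypothesis T0 : 0 <= T.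
Hypothesis TT : (T%:E < tau0)%E.

Lemma inI_le t : 0 <= t <= T -> inI tau0 t.
Proof. by move=> /andP[t0 tT]; split=> //; rewrite (le_lt_trans _ TT)// lee_fin. Qed.

Lemma inI_clamp s : inI tau0 (clamp T s).
Proof. by apply: inI_le; exact: clamp_itv. Qed.

(** By the reverse triangle inequality the norm is a continuous function of time, hence bounded on
    the compact interval [[0, T]]. *)
Lemma Zspace_bounded (u : 'rV[R]_n -> R -> R) : Zspace tau0 a u ->
  exists2 H, 0 <= H & forall x t, 0 <= t <= T -> `|u x t| <= H * wt a x.
Proof.
move=> [uBC uc].
pose N t := wnorm a (fun x => u x t).
have uN t x : inI tau0 t -> `|u x t| <= N t * wt a x.
  by move=> It; apply: BC_le_wnorm => //; exact: uBC.
have Nc : continuous (fun s => N (clamp T s)).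
  move=> s0; apply/cvgrPdist_le => e e0.
  have [dl dl0 Hd] := uc _ (inI_clamp s0) e e0.
  have /cvgrPdist_lt/(_ _ dl0) := continuous_clamp (T := T) (x := s0).
  apply: filterS => s; rewrite distrC => sd.
  have D := Hd _ (inI_clamp s) sd.
  have [B1 B2] := (uBC _ (inI_clamp s), uBC _ (inI_clamp s0)).
  have Dx x : `|u x (clamp T s) - u x (clamp T s0)| <= e * wt a x.
    apply: (le_trans (BC_le_wnorm x a0 (BC_sub B1 B2))).
    by rewrite ler_wpM2r ?(ltW (wt_gt0 _ _))// ltW.
  rewrite ler_distl; apply/andP; split.
    rewrite lerBlDr; apply: wnorm_le => x; rewrite mulrDl.
    rewrite -[u x _](subrK (u x (clamp T s0))) addrC.
    by rewrite (le_trans (ler_normD _ _))// lerD// uN//; exact: inI_clamp.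
  apply: wnorm_le => x; rewrite mulrDl.
  rewrite -[u x (clamp T s0)](subrK (u x (clamp T s))) addrC.
  rewrite (le_trans (ler_normD _ _))// lerD//; first by apply: uN; exact: inI_clamp.
  by rewrite distrC.
have [c _ Hc] := @EVT_max R _ 0 T T0 (continuous_subspaceT Nc).
exists (`|N (clamp T c)|) => // x t tT.
apply: (le_trans (uN _ _ (inI_le tT))).
rewrite ler_wpM2r ?(ltW (wt_gt0 _ _))//.
have := Hc t; rewrite in_itv/= (clamp_id tT) => /(_ tT) h.
by rewrite (le_trans h)// ler_norm.
Qed.

Lemma Zspace_stmeas (u : 'rV[R]_n -> R -> R) : Zspace tau0 a u ->
  stmeas (fun y s => u y (clamp T s)).
Proof.
move=> [uBC uc] d T' Y S mY mS.
have mcS : measurable_fun setT (fun w => clamp T (S w)).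
  apply: measurableT_comp => //.
  by apply: continuous_measurable_fun; exact: continuous_clamp.
apply: (measurable_dsc_cvg (f := u)) => // w.
set y := Y w; set s := clamp T (S w).
have Is : inI tau0 s by exact: inI_clamp.
have /andP[s0 sT] := clamp_itv T0 (S w).
have Isk k : inI tau0 (dsc k s).
  by apply: inI_le; rewrite dsc_ge0//= (le_trans (dsc_le _ _)).
(* Rounding moves a coordinate by at most 1, so [Q] bounds the weight at all discretisations of [y];
   convergence in the weighted norm is then uniform along them. *)
pose Q := (1 + \sum_i (`|y ord0 i| + 1) ^+ 2) `^ (a / 2).
have S0 : 0 <= \sum_i (`|y ord0 i| + 1) ^+ 2 :> R.
  by apply: sumr_ge0 => i _; exact: sqr_ge0.
have wQ k : wt a (map_mx (dsc k) y) <= Q.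
  apply: powR_monotone; [by rewrite divr_ge0|by rewrite addr_ge0 ?sqr_ge0|].
  rewrite lerD2l enorm_sqr; apply: ler_sum => i _; rewrite !mxE -expr2.
  rewrite -real_normK ?num_real// lerXn2r ?nnegrE ?addr_ge0//.
  have h1 := dsc_le k (y ord0 i); have h2 := dsc_ge k (y ord0 i).
  have h3 : k.+1%:R^-1 <= 1 :> R by rewrite invf_le1// ler1n.
  have : `|dsc k (y ord0 i) - y ord0 i| <= 1.
    move: h2 h3; set c := k.+1%:R^-1 => h2 h3; move: h1 h2; set b := dsc _ _ => h1 h2.
    by rewrite ler_norml; apply/andP; split; lra.
  move=> h; rewrite -[dsc k _](subrK (y ord0 i)) addrC.
  by rewrite (le_trans (ler_normD _ _))// lerD2l.
have Q0 : 0 < Q by exact: lt_le_trans (wt_gt0 _ _) (wQ 0).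
have [cu _] := uBC _ Is.
have c1 : u (map_mx (dsc k) y) s @[k --> \oo] --> u y s.
  apply: (@cvg_comp _ _ _ (fun k => map_mx (dsc k) y) (u ^~ s) _ _ _ _ (cu y)).
  exact: cvg_dsc_row.
apply/cvgrPdist_le => e e0.
have e20 : 0 < e / 2 by rewrite divr_gt0.
have eQ : 0 < e / 2 / Q by rewrite divr_gt0.
have [dl dl0 Hd] := uc _ Is _ eQ.
have /cvgrPdist_lt/(_ _ dl0) N1 := cvg_dsc (r := s).
have /cvgrPdist_le/(_ _ e20) N2 := c1.
near=> k.
have h1 : `|s - dsc k s| < dl by near: k; exact: N1.
have h2 : `|u y s - u (map_mx (dsc k) y) s| <= e / 2 by near: k; exact: N2.
rewrite distrC in h1; have D := Hd _ (Isk k) h1.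
have Dx : `|u (map_mx (dsc k) y) (dsc k s) - u (map_mx (dsc k) y) s| <= e / 2.
  apply: (le_trans (BC_le_wnorm (map_mx (dsc k) y) a0 (BC_sub (uBC _ (Isk k)) (uBC _ Is)))).
  apply: (@le_trans _ _ (e / 2 / Q * wt a (map_mx (dsc k) y))).
    by rewrite ler_wpM2r ?(ltW (wt_gt0 _ _))// ltW.
  rewrite -[leRHS](divfK (lt0r_neq0 Q0)) ler_wpM2l//; exact: ltW.
rewrite [leRHS](splitr e) -(subrKA (u (map_mx (dsc k) y) s)).
by rewrite (le_trans (ler_normD _ _))// lerD// distrC.
Unshelve. all: by end_near. Qed.

Lemma cvg_within_comp (V W : topologicalType) (A : set V) (f : V -> W)
    (D : Type) (F : set_system D) {FF : Filter F} (g : D -> V) (z : V) :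
  {within A, continuous f} -> A z -> (forall t, A (g t)) -> g @ F --> z ->
  f (g t) @[t --> F] --> f z.
Proof.
move=> /subspace_continuousP cf Az Ag gz.
apply: (cvg_comp g f _ (cf z Az)) => P /= HP.
have HP' : nbhs z [set x | A x -> P x] := HP.
have G : F (fun t => A (g t) -> P (g t)) := gz _ HP'.
exact: (@filterS _ F FF _ _ (fun t h => h (Ag t)) G).
Qed.

Lemma continuous_clamp_comp (f : R -> R) : {within [set t | inI tau0 t], continuous f} ->
  continuous (fun s => f (clamp T s)).
Proof.
move=> cf s; have h t : [set t | inI tau0 t] (clamp T t) by exact: inI_clamp.
exact: (cvg_within_comp cf (h s) h (@continuous_clamp R T s)).
Qed.

(** Times are rounded down and never below 0, so the approximating points stay in the set on which
    [f] is continuous. *)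
Lemma within_stmeas (f : 'rV[R]_n -> R -> R) :
  {within [set z : 'rV[R]_n * R | inI tau0 z.2], continuous (fun z => f z.1 z.2)} ->
  stmeas (fun y s => f y (clamp T s)).
Proof.
move=> cf d T' Y S mY mS.
have mcS : measurable_fun setT (fun w => clamp T (S w)).
  apply: measurableT_comp => //.
  by apply: continuous_measurable_fun; exact: continuous_clamp.
apply: (measurable_dsc_cvg (f := f)) => // w.
have /andP[s0 sT] := clamp_itv T0 (S w).
pose g (k : nat) : 'rV[R]_n * R := (map_mx (dsc k) (Y w), dsc k (clamp T (S w))).
have h k : [set z : 'rV[R]_n * R | inI tau0 z.2] (g k).
  by apply: inI_le; rewrite dsc_ge0//= (le_trans (dsc_le _ _)).
have h0 : [set z : 'rV[R]_n * R | inI tau0 z.2] (Y w, clamp T (S w)).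
  exact: inI_clamp.
have cg : g k @[k --> \oo] --> (Y w, clamp T (S w)).
  move=> P [[A1 A2] /= [hA1 hA2] hA].
  have h1 := @cvg_dsc_row R n (Y w) _ hA1.
  have h2 := @cvg_dsc _ (clamp T (S w)) _ hA2.
  have G : \forall k \near \oo, A1 (map_mx (dsc k) (Y w)) /\ A2 (dsc k (clamp T (S w))).
    by apply: filterI; [exact: h1|exact: h2].
  exact: (filterS (fun k (h : A1 _ /\ A2 _) => hA (g k) h) G).
exact: (cvg_within_comp cf h0 h cg).
Qed.

End WeightedSpaces.

(** * The kernel with its value at the origin fixed *)

Section KernelNormalisation.
Variable R : realType.
Local Notation leb := (@lebesgue_measure R).

Lemma smeasM n (f g : 'rV[R]_n -> R) : smeas f -> smeas g -> smeas (fun y => f y * g y).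
Proof. by move=> mf mg d T Y mY; apply: measurable_funM; [exact: mf|exact: mg]. Qed.

Lemma smeas_comp n (g : R -> R) (f : 'rV[R]_n -> R) : measurable_fun setT g ->
  smeas f -> smeas (fun y => g (f y)).
Proof. by move=> mg mf d T Y mY; apply: measurableT_comp => //; exact: mf. Qed.

Lemma smeas_edot n (k : 'rV[R]_n) : smeas (edot k).
Proof. by move=> d T Y mY; apply: measurable_edot => //; exact: mrow_cst. Qed.

Lemma smeas_enorm n : smeas (@enorm R n).
Proof.
move=> d T Y mY; rewrite (_ : (fun w => _) = (fun w => Num.sqrt (edot (Y w) (Y w)))).
  apply: measurableT_comp; last exact: measurable_edot.
  by apply: continuous_measurable_fun; exact: sqrt_continuous.
by apply/funext => w; rewrite -enorm_sqr sqrtr_sqr ger0_norm// sqrtr_ge0.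
Qed.

Lemma smeas_continuous n (f : 'rV[R]_n -> R) : continuous f -> smeas f.
Proof. by move=> cf d T Y mY; exact: measurable_continuous_row. Qed.

Lemma vmeas_smeas n (f : 'rV[R]_n -> R) : smeas f -> vmeas (fun y => (f y)%:E).
Proof. by move=> mf d T Y mY; apply/measurable_EFinP; exact: mf. Qed.

Lemma smeas_reflect n (x : 'rV[R]_n) (f : 'rV[R]_n -> R) : smeas f -> smeas (fun y => f (x - y)).
Proof. by move=> mf d T Y mY; apply: mf; exact: mrow_subX. Qed.

Lemma smeas_bessel n (B : 'rV[R]_n -> R) : is_bessel_kernel B -> smeas B.
Proof. by move=> [cB _] d T Y mY; apply: measurable_continuous_off0. Qed.

(* [is_bessel_kernel] leaves the value at the origin arbitrary. *)
Lemma bessel_kernel_upd0 n (B : 'rV[R]_n.+1 -> R) (c : R) : is_bessel_kernel B ->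
  is_bessel_kernel (fun y => if y == 0 then c else B y).
Proof.
move=> hB; have [cB [iB [cosB sinB]]] := hB; set B' := (fun y => _).
have cB' (x : 'rV[R]_n.+1) : x != 0 -> {for x, continuous B'}.
  move=> x0; have E : \forall y \near x, B y = B' y.
    have cn : `|y| @[y --> x] --> `|x| by exact: norm_continuous.
    have x1 : 0 < `|x| by rewrite normr_gt0.
    have := @cvgr_gt _ _ _ (nbhs_filter x) _ _ cn _ x1.
    by apply: filterS => y; rewrite /B' normr_gt0 => /negbTE ->.
  rewrite /prop_for /continuous_at {2}/B' (negbTE x0).
  by apply: cvg_trans (near_eq_cvg E) _; exact: cB.
have mB : smeas B by exact: smeas_bessel.
have mB' : smeas B' by move=> d T Y mY; apply: measurable_continuous_off0.
have off (h : R -> R) (g : 'rV[R]_n.+1 -> R) : measurable_fun setT h -> smeas g ->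
    intRn (fun y => (h (B' y) * g y)%:E) = intRn (fun y => (h (B y) * g y)%:E).
  move=> mh mg; apply: (@intRn_eq_off R n 0).
  - by apply: vmeas_smeas; apply: smeasM => //; exact: smeas_comp.
  - by apply: vmeas_smeas; apply: smeasM => //; exact: smeas_comp.
  - by move=> y y0; rewrite /B' (negbTE y0).
have medot xi : smeas (fun y : 'rV[R]_n.+1 => edot y xi).
  by move=> d T Y mY; apply: measurable_edot => //; exact: mrow_cst.
split=> //; split.
  have -> : intRn (fun y => `|B' y|%:E) = intRn (fun y => (`|B' y| * 1)%:E).
    by congr intRn; apply/funext => y; rewrite mulr1.
  rewrite off//.
    have -> : intRn (fun y => (`|B y| * 1)%:E) = intRn (fun y => `|B y|%:E) => //.
    by congr intRn; apply/funext => y; rewrite mulr1.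
split=> xi.
  rewrite (off id)//; apply: smeas_comp => //.
  by apply: continuous_measurable_fun; exact: continuous_cos.
rewrite (off id)//; apply: smeas_comp => //.
by apply: continuous_measurable_fun; exact: continuous_sin.
Qed.

(** Interface to the rest of the proof, which knows the kernel only through these five properties.
    Changing [B] at the origin alters no integral. *)
Lemma bessel_normalised n (B : 'rV[R]_n.+1 -> R) : is_bessel_kernel B ->
  exists B' : 'rV[R]_n.+1 -> R,
  [/\ forall y, klow R n.+1 * expR (- ((2 + n.+1%:R) * norm1 y)) <= B' y, smeas B',
      forall x k, edot k k < 1 ->
        (bconv B' (fun y => expR (edot k y)) x <= (expR (edot k x) / (1 - edot k k))%:E)%E,
      forall f x, smeas f -> bconv B f x = bconv B' f x &
      forall f x, smeas f -> (forall y, 0 <= f y) ->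
        intRn (fun y => (B y * f (x - y))%:E) = bconv B' f x].
Proof.
move=> hB; exists (fun y => if y == 0 then klow R n.+1 else B y).
have hB' := bessel_kernel_upd0 (klow R n.+1) hB.
set B' := (fun y => _) in hB' *.
have [d [T [mu [X [mX intRnE intRnE']]]]] := intRn_model R n.+1.
have lb y : klow R n.+1 * expR (- ((2 + n.+1%:R) * norm1 y)) <= B' y.
  have [->|y0] := eqVneq y 0; last exact: (kernel_lb hB' mX intRnE intRnE').
  by rewrite /B' eqxx ler_piMr ?(ltW (klow_gt0 _ _))// -expR0 ler_expR oppr_le0 mulr_ge0// norm1_ge0.
have B'0 y : 0 <= B' y.
  by apply: le_trans (lb y); rewrite mulr_ge0 ?expR_ge0// ltW// klow_gt0.
have mB : smeas B by exact: smeas_bessel.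
have mB' : smeas B' by exact: smeas_bessel.
split=> //.
- move=> x k k1; rewrite (bconvE B'0 mB' intRnE).
  + by apply: (kernel_exp hB' mX intRnE intRnE') => //; rewrite /B' eqxx.
  + by apply: smeas_comp => //; exact: smeas_edot.
  + by move=> y; exact: expR_ge0.
- move=> f x mf; apply: (@intRn_eq_off R n x).
  + by apply: vmeas_smeas; apply: smeasM => //; exact: smeas_reflect.
  + by apply: vmeas_smeas; apply: smeasM => //; exact: smeas_reflect.
  + by move=> y; rewrite /B' subr_eq0 eq_sym => /negbTE ->.
- move=> f x mf f0; rewrite (@intRn_eq_off R n 0 _ (fun y => (B' y * f (x - y))%:E)).
  + rewrite -(@intRn_reflect R _ x).
    * by rewrite /bconv; congr intRn; apply/funext => y; rewrite subKr.
    * by apply: vmeas_smeas; apply: smeasM => //; exact: smeas_reflect.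
    * by move=> y; rewrite lee_fin mulr_ge0.
  + by apply: vmeas_smeas; apply: smeasM => //; exact: smeas_reflect.
  + by apply: vmeas_smeas; apply: smeasM => //; exact: smeas_reflect.
  + by move=> y; rewrite /B' => /negbTE ->.
Qed.

Lemma bconv_box_lb n (B f : 'rV[R]_n -> R) (c x : 'rV[R]_n) (r b : R) :
  (forall y, 0 <= B y) -> smeas B -> smeas f -> (forall y, 0 <= f y) ->
  0 <= b -> 0 < r ->
  (forall y : 'rV[R]_n, (forall i, `|y ord0 i - c ord0 i| <= r) -> b <= B (x - y) * f y) ->
  ((b * (2 * r) ^+ n)%:E <= bconv B f x)%E.
Proof.
move=> B0 mB mf f0 b0 r0 Hb.
have [d [T [mu [X [mX intRnE _]]]]] := intRn_model R n.
pose w j := oapp (fun i => c ord0 i) 0 (insub j : option 'I_n).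
have ww (i : 'I_n) : w i = c ord0 i by rewrite /w valK.
(* Compare the integrand with [b] times the indicator of a cube of side [2*r], whose iterated
   integral factorises. *)
pose g j : R -> R := \1_(`[w j - r, w j + r]%classic).
have mg j : measurable_fun setT (g j) by apply: measurable_indic; exact: measurable_itv.
have g0 j y : 0 <= g j y by rewrite /g indicE.
have gr j : (\int[leb]_y (g j y)%:E = (2 * r)%:E)%E.
  rewrite /g (@integral_indic _ _ _ leb setT)//.
  rewrite setIT; transitivity (leb [set` `[w j - r, w j + r]]) => //.
  rewrite lebesgue_measure_itv/= lte_fin ltrD2l gtrN//.
  by rewrite -EFinB; congr EFin; ring.
have := @iint_prod R n g (fun=> 2 * r) b mg g0 gr b0.
rewrite prodr_const card_ord => H.
pose G (y : 'rV[R]_n) := b * \prod_(i < n) g i (y ord0 i).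
have GE : intRn (fun y => (G y)%:E) = (b * (2 * r) ^+ n)%:E.
  rewrite -H /intRn; congr (iint n _); apply/funext => y; congr EFin; congr (_ * _).
  by apply: eq_bigr => i _; rewrite mxE.
have mG : smeas G.
  move=> d' T' Y mY; apply: measurable_funM => //; apply: measurable_prod => i _.
  by apply: measurableT_comp => //; exact: mY.
have G0 y : 0 <= G y by rewrite mulr_ge0// prodr_ge0.
rewrite -GE /bconv !intRnE//; last 3 first.
- by move=> d' T' Y mY; apply/measurable_EFinP; apply: measurable_funM; [apply: mB; exact: mrow_subX|exact: mf].
- by move=> y; rewrite lee_fin mulr_ge0.
- exact: vmeas_smeas.
apply: ge0_le_integral => //.
- by move=> y _; rewrite lee_fin.
- by apply/measurable_EFinP; exact: mG.
- by apply/measurable_EFinP; apply: measurable_funM; [apply: mB; exact: mrow_subX|exact: mf].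
move=> z _; rewrite lee_fin; move: (X z) => y.
have [/forallP h|/forallPn[i hi]] := boolP [forall i, `|y ord0 i - c ord0 i| <= r].
  rewrite /G big1 ?mulr1; first by apply: Hb => i; exact: h.
  move=> i _; rewrite /g indicE mem_set//= in_itv/= ww.
  by have := h i; rewrite ler_distl.
rewrite /G (bigD1 i)//= {1}/g indicE memNset ?mul0r ?mulr0 ?mulr_ge0//.
by rewrite /= in_itv/= ww -ler_distl; exact/negP.
Qed.

End KernelNormalisation.

(** * A dominating weight that convolution barely enlarges *)

Section ExponentialWeight.
Variables (R : realType) (n : nat) (B : 'rV[R]_n.+1 -> R).
Hypothesis B0 : forall y, 0 <= B y.
Hypothesis mB : smeas B.
Hypothesis kexp : forall x k, edot k k < 1 ->
  (bconv B (fun y => expR (edot k y)) x <= (expR (edot k x) / (1 - edot k k))%:E)%E.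

Local Notation J := ('I_n.+1 * bool)%type.

Lemma sqr_le_expR (y : R) : 0 <= y -> y ^+ 2 <= 4 * expR y.
Proof.
move=> y0; have E : expR y = expR (y / 2) ^+ 2.
  by rewrite -expRM_natl; congr expR; field.
have h := expR_ge1Dx (y / 2); rewrite E; nra.
Qed.

Lemma edot_delta (c : R) (i : 'I_n.+1) (x : 'rV[R]_n.+1) :
  edot (c *: delta_mx ord0 i) x = c * x ord0 i.
Proof.
rewrite /edot (bigD1 i)//= big1 ?addr0; first by rewrite !mxE !eqxx mulr1.
by move=> j ji; rewrite !mxE eqxx/= (negbTE ji) mulr0 mul0r.
Qed.

(** [rho] is a multiple of the sum of [e^(ka x_i)] and [e^(-ka x_i)] over the coordinates: each
    summand grows under convolution by at most [1/(1-ka^2)], yet any positive rate beats every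
    power. *)
Lemma exp_weight (r a : R) : 0 < r < 1 -> 0 <= a ->
  exists (rho : 'rV[R]_n.+1 -> R) (C1 : R),
  [/\ 0 < C1, C1 * r < 1, smeas rho, forall x, wt a x <= rho x &
      forall x, (bconv B rho x <= (C1 * rho x)%:E)%E].
Proof.
move=> /andP[r0 r1] a0.
(* This rate gives [1/(1-ka^2) = 2/(1+r)], which is [C1], and [2r/(1+r) < 1]. *)
pose ka : R := Num.sqrt ((1 - r) / 2).
have ka2 : ka ^+ 2 = (1 - r) / 2 by rewrite sqr_sqrtr//; lra.
have ka0 : 0 < ka by rewrite sqrtr_gt0; lra.
pose k (j : J) : 'rV[R]_n.+1 := (if j.2 then ka else - ka) *: delta_mx ord0 j.1.
have kE j x : edot (k j) x = (if j.2 then ka else - ka) * x ord0 j.1 by exact: edot_delta.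
have kk j : edot (k j) (k j) = (1 - r) / 2.
  rewrite kE /k !mxE !eqxx mulr1 -ka2 expr2; case: ifP => _ //; exact: mulrNN.
pose S x := \sum_(j : J) expR (edot (k j) x).
have SE (x : 'rV[R]_n.+1) i : expR (ka * `|x ord0 i|) <= S x.
  have h j : expR (edot (k j) x) <= S x.
    by rewrite /S (bigD1 j)//= lerDl sumr_ge0// => j' _; exact: expR_ge0.
  have [xi|xi] := ger0P (x ord0 i); first by have := h (i, true); rewrite kE.
  by have := h (i, false); rewrite kE/= mulrN mulNr.
have S1 x : 1 <= S x.
  apply: le_trans (SE x ord0); rewrite -expR0 ler_expR mulr_ge0//; exact: ltW.
have mS : smeas S.
  move=> d T Y mY; apply: measurable_sum => j; apply: measurableT_comp => //.
  exact: smeas_edot.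
pose b := a / 2; have b0 : 0 <= b by rewrite divr_ge0.
(* At rate [c] an exponential is at most [S^(1/(b+1))]. So [1 + |x|^2] is bounded by a multiple of
   that power, and its [b]-th power by a multiple of [S^(b/(b+1)) <= S]. *)
pose c := ka / (b + 1).
have b1 : 0 < b + 1 by rewrite ltr_wpDl.
have c0 : 0 < c by rewrite divr_gt0.
pose A := (1 + n.+1%:R * (4 / c ^+ 2)) `^ b.
have A0 : 0 < A by rewrite powR_gt0// ltr_pwDl// mulr_ge0// divr_ge0// sqr_ge0.
have cka : c / ka = (b + 1)^-1 by rewrite /c; field; rewrite !gt_eqF.
have wS x : wt a x <= A * S x.
  have Sp : 1 <= S x `^ (b + 1)^-1.
    apply: (@le_trans _ _ (1 `^ (b + 1)^-1)); first by rewrite powR1.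
    apply: powR_monotone => //.
    by rewrite invr_ge0 ltW.
  have xi i : x ord0 i ^+ 2 <= 4 / c ^+ 2 * S x `^ (b + 1)^-1.
    have h : (c * `|x ord0 i|) ^+ 2 <= 4 * expR (c * `|x ord0 i|).
      by apply: sqr_le_expR; rewrite mulr_ge0// ltW.
    have e : expR (c * `|x ord0 i|) <= S x `^ (b + 1)^-1.
      have -> : expR (c * `|x ord0 i|) = expR (ka * `|x ord0 i|) `^ (b + 1)^-1.
        rewrite -expRM -cka; congr expR; field; rewrite gt_eqF//.
      apply: powR_monotone; [by rewrite invr_ge0 ltW|exact: expR_ge0|exact: SE].
    rewrite -real_normK ?num_real// mulrAC ler_pdivlMr ?exprn_gt0// -exprMn mulrC.
    by apply: (le_trans h); rewrite ler_wpM2l.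
  have x2 : 1 + enorm x ^+ 2 <= (1 + n.+1%:R * (4 / c ^+ 2)) * S x `^ (b + 1)^-1.
    rewrite mulrDl mul1r lerD// enorm_sqr.
    have -> : n.+1%:R * (4 / c ^+ 2) * S x `^ (b + 1)^-1 =
        \sum_(i < n.+1) 4 / c ^+ 2 * S x `^ (b + 1)^-1.
      by rewrite sumr_const card_ord -mulrA mulr_natl.
    by apply: ler_sum => i _; rewrite -expr2.
  apply: (@le_trans _ _ (A * (S x `^ (b + 1)^-1) `^ b)).
    rewrite /A -powRM ?powR_ge0//; last by rewrite addr_ge0// mulr_ge0// divr_ge0// sqr_ge0.
    by apply: powR_monotone => //; rewrite addr_ge0// sqr_ge0.
  rewrite ler_wpM2l ?(ltW A0)// -powRrM.
  rewrite -[leRHS]powRr1 ?(le_trans ler01)//; apply: ler_powR => //.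
  by rewrite mulrC ler_pdivrMr// mul1r lerDl.
exists (fun x => A * S x), (2 / (1 + r)); split=> //.
- by rewrite divr_gt0//; lra.
- by rewrite mulrAC ltr_pdivrMr; lra.
- by apply: smeasM => // d T Y mY; exact: measurable_cst.
move=> x; have S0 y : 0 <= S y by exact: le_trans (S1 y).
have [d [T [mu [X [mX intRnE _]]]]] := intRn_model R n.+1.
have me j : smeas (fun y => expR (edot (k j) y)).
  by apply: smeas_comp => //; exact: smeas_edot.
rewrite (bconvZ B0 mB mX intRnE)// ?(ltW A0)//.
rewrite mulrCA EFinM lee_wpmul2l ?lee_fin ?(ltW A0)//.
rewrite (bconvE B0 mB intRnE)//.
under eq_integral do rewrite mulr_sumr -sumEFin.
rewrite ge0_integral_sum//; last 2 first.
- move=> j; apply/measurable_EFinP; apply: measurable_funM; last exact: me.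
  by apply: mB; exact: mrow_subX.
- by move=> j w _; rewrite lee_fin mulr_ge0 ?expR_ge0.
rewrite /S mulr_sumr -sumEFin; apply: lee_sum => j _.
rewrite -(bconvE B0 mB intRnE (f := fun y => expR (edot (k j) y)))//.
apply: le_trans (kexp _ _) _; first by rewrite kk; lra.
by rewrite kk lee_fin mulrC; rewrite le_eqVlt; apply/orP; left; apply/eqP; congr (_ * _); field; apply/eqP; lra.
Qed.

End ExponentialWeight.

(** * Lower bounds for the supersolution *)

Section LowerBound.
Variables (R : realType) (n : nat) (B : 'rV[R]_n.+1 -> R).
Local Notation k0 := (2 + n.+1%:R : R).
Local Notation rV := 'rV[R]_n.+1.
Hypothesis klb : forall y, klow R n.+1 * expR (- (k0 * norm1 y)) <= B y.
Hypothesis mB : smeas B.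

Lemma norm1_triangle (x y : rV) : norm1 (x - y) <= norm1 x + norm1 y.
Proof.
by rewrite /norm1 -big_split/=; apply: ler_sum => i _; rewrite !mxE ler_normB.
Qed.

Lemma norm1_le (x : rV) r : (forall i, `|x ord0 i| <= r) -> norm1 x <= n.+1%:R * r.
Proof.
move=> h; rewrite /norm1 (_ : n.+1%:R * r = \sum_(i < n.+1) r).
  exact: ler_sum.
by rewrite sumr_const card_ord mulr_natl.
Qed.

Lemma kernel_nonneg y : 0 <= B y.
Proof. by apply: le_trans (klb y); rewrite mulr_ge0 ?expR_ge0// ltW// klow_gt0. Qed.

Lemma stmeasM (f g : rV -> R -> R) : stmeas f -> stmeas g ->
  stmeas (fun y s => f y s * g y s).
Proof. by move=> mf mg d T Y S mY mS; apply: measurable_funM; [exact: mf|exact: mg]. Qed.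

Lemma stmeas_powR (f : rV -> R -> R) e : stmeas f -> stmeas (fun y s => f y s `^ e).
Proof.
move=> mf d T Y S mY mS; apply: (measurableT_comp (measurable_powR e)); exact: mf.
Qed.

Lemma smeas_ge1 : smeas (fun y : rV => (if 1 <= enorm y then 1 else 0) : R).
Proof. move=> d T' Y mY; apply: measurable_fun_ifT => //.
by apply: measurable_fun_ler => //; exact: smeas_enorm. Qed.

Variables (p sigma thl T : R) (q lam L : R -> R) (V mu : rV -> R -> R) (u0 : rV -> R).
Hypothesis p01 : 0 < p < 1.
Hypothesis sigma0 : 0 <= sigma.
Hypothesis thl0 : 0 < thl.
Hypothesis T0 : 0 <= T.
Hypothesis cq : continuous q.
Hypothesis q0 : forall s, 0 < q s.
Hypothesis clam : continuous lam.
Hypothesis lam0 : forall s, 0 < lam s.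
Hypothesis cL : continuous L.
Hypothesis L00 : L 0 = 0.
Hypothesis Lge0 : forall s, 0 <= L s.
Hypothesis Lgt0 : forall s : R, 0 < s <= T -> 0 < L s.
Hypothesis dL : forall s : R, 0 < s < T -> is_derive s 1 L (q s * lam s).
Hypothesis LM : exists2 M : R, 0 < M & forall s : R, 0 <= s <= T -> L s <= M * s.
Hypothesis mV : stmeas V.
Hypothesis V0 : forall y s, 0 <= V y s.
Hypothesis mmu : stmeas mu.
Hypothesis mu0 : forall y s, 0 <= mu y s.
Hypothesis u00 : forall y, 0 <= u0 y.
Hypothesis cu0 : continuous u0.
Hypothesis u0nz : exists x, u0 x != 0.
Hypothesis Vlb : forall y (s : R), 1 <= enorm y -> 0 < s <= T ->
  thl * lam s * enorm y `^ sigma <= V y s.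
Hypothesis mu_ge : forall x (t : R), 0 <= t <= T ->
  ((u0 x)%:E + tint t (fun s => (1 : R)%:E * bconv B (mu ^~ s) x)
   + tint t (fun s => (q s)%:E * bconv B (fun y => V y s * mu y s `^ p)%R x)
   <= (mu x t)%:E)%E.

Let g := (1 - p)^-1.

Lemma gam_gt1 : 1 < g.
Proof. by case/andP: p01 => h0 h1; rewrite /g invf_gt1; lra. Qed.

Lemma gam_gt0 : 0 < g. Proof. exact: lt_trans gam_gt1. Qed.

Lemma gamM : g * p = g - 1.
Proof. by case/andP: p01 => h0 h1; rewrite /g; field; apply/eqP; lra. Qed.

Lemma continuous_ql : continuous (fun s => q s * lam s).
Proof. by move=> s; apply: cvgM; [exact: cq|exact: clam]. Qed.

Lemma measurable_cont (f : R -> R) : continuous f -> measurable_fun setT f.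
Proof. exact: continuous_measurable_fun. Qed.

Lemma continuous_Lpow e : 0 < e -> continuous (fun s => L s `^ e).
Proof. by move=> e0; apply: continuous_powR_comp. Qed.

Lemma tint_cst (t : R) : 0 <= t -> tint t (fun s => (1 * 1 : R)%:E) = t%:E.
Proof.
move=> t0; rewrite mulr1 /tint (_ : [set s : R | 0 <= s <= t] = `[0, t]%classic); last first.
  by apply/seteqP; split=> s /=; rewrite in_itv.
rewrite integral_cst//= mul1e; transitivity (@lebesgue_measure R [set` `[0, t]]) => //.
rewrite lebesgue_measure_itv/= lte_fin; case: ltP => [_|t1]; first by rewrite -EFinB subr0.
by congr EFin; apply/eqP; rewrite eq_le t0 t1.
Qed.

Lemma tintZ (t c : R) (f : R -> R) : 0 <= c -> measurable_fun setT f -> (forall s, 0 <= f s) ->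
  tint t (fun s => (c * f s)%:E) = (c%:E * tint t (fun s => (f s)%:E))%E.
Proof.
move=> c0 mf f0.
have mf' : measurable_fun setT (fun s => (f s)%:E) by exact/measurable_EFinP.
rewrite !tintE//; last by apply/measurable_EFinP; exact: measurable_funM.
rewrite -ge0_integralZl//; last by move=> s _; rewrite lee_fin.
exact: measurable_funTS.
Qed.

Lemma tint_Lpow (t c : R) : 0 <= c -> 0 <= t <= T ->
  tint t (fun s => (q s * (c * lam s * L s `^ (g - 1)))%:E) = (c / g * L t `^ g)%:E.
Proof.
move=> c0 tT.
have c' : 0 <= c / g by rewrite divr_ge0// ltW// gam_gt0.
have := tint_power continuous_ql cL L00 Lge0 Lgt0 dL 0 (lexx 0) gam_gt1 tT.
rewrite mul0r expR0 mul1r addr0 powR0 ?gt_eqF ?gam_gt0// subr0 EFinM => <-.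
rewrite (_ : (fun s => (0 * _ + _)%:E) =
    (fun s => (g * (q s * lam s * L s `^ (g - 1)))%:E)); last first.
  by apply/funext => s; rewrite !mul0r expR0 addr0 add0r mul1r.
rewrite -tintZ//.
- congr tint; apply/funext => s; congr EFin; field; exact: lt0r_neq0 gam_gt0.
- apply: measurable_cont => s; apply: cvgM; first exact: cvg_cst.
  apply: cvgM; first exact: continuous_ql.
  by apply: continuous_Lpow; rewrite subr_gt0 gam_gt1.
- move=> s; rewrite mulr_ge0 ?(ltW gam_gt0)//.
  by rewrite mulr_ge0 ?powR_ge0// mulr_ge0// ltW.
Qed.

Lemma mu_ge_terms x (t : R) : 0 <= t <= T ->
  [/\ u0 x <= mu x t, (tint t (fun s => (1 : R)%:E * bconv B (mu ^~ s) x) <= (mu x t)%:E)%E &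
  (tint t (fun s => (q s)%:E * bconv B (fun y => V y s * mu y s `^ p)%R x) <= (mu x t)%:E)%E].
Proof.
move=> tT; have := mu_ge x tT.
have [d [T' [m [X [mX intRnE _]]]]] := intRn_model R n.+1.
have B0 := kernel_nonneg.
set A := tint _ _; set C := tint _ _ => H.
have A0 : (0 <= A)%E.
  apply: (@tint_bconv_ge0 _ _ _ B0 mB _ _ _ _ mX intRnE (fun=> 1)) => //.
have C0 : (0 <= C)%E.
  apply: (@tint_bconv_ge0 _ _ _ B0 mB _ _ _ _ mX intRnE q _ _ t (fun y s => V y s * mu y s `^ p)) => //.
  - by move=> s; exact: ltW.
  - exact: measurable_cont.
  - by apply: stmeasM => //; exact: stmeas_powR.
  - by move=> y s; rewrite mulr_ge0// powR_ge0.
have U0 : (0 <= (u0 x)%:E)%E by rewrite lee_fin.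
clearbody A C.
split.
- by rewrite -lee_fin; apply: le_trans H; rewrite -addeA leeDl// adde_ge0.
- by apply: le_trans H; rewrite addeAC leeDr// adde_ge0.
- by apply: le_trans H; rewrite leeDr// adde_ge0.
Qed.

(** Since [g * p = g - 1], the [p]-th power of [L^g] times [q * lam] is the derivative of [L^g] up
    to the factor [g]. The time profile thus reproduces itself and only the constant and the spatial
    profile change. The indicator discards the unit ball, where [V] has no lower bound. *)
Lemma lower_step (c K : R) (h : rV -> R) x (t : R) : 0 <= c -> 0 <= K -> smeas h ->
  (forall y, 0 <= h y) ->
  (forall y (s : R), 0 < s <= T -> c * L s `^ g * h y <= mu y s) ->
  (K%:E <= bconv B (fun y => (if 1 <= enorm y then 1 else 0) * (enorm y `^ sigma * h y `^ p))%R x)%E ->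
  0 <= t <= T -> thl / g * c `^ p * K * L t `^ g <= mu x t.
Proof.
move=> c0 K0 mh h0 Hh HK tT; have [pp p1] := andP p01.
have [d [T' [m [X [mX intRnE _]]]]] := intRn_model R n.+1.
have B0 := kernel_nonneg.
have [_ _ H] := mu_ge_terms x tT; rewrite -lee_fin; apply: le_trans H.
have tc0 : 0 <= thl * c `^ p by rewrite mulr_ge0 ?powR_ge0// ltW.
have -> : thl / g * c `^ p * K * L t `^ g = K * (thl * c `^ p / g * L t `^ g) by ring.
rewrite EFinM -(tint_Lpow tc0 tT).
apply: (@tint_bconv_lb _ _ _ B0 mB _ _ _ _ mX intRnE q _ _ t K
   (fun y s => V y s * mu y s `^ p) (fun s => thl * c `^ p * lam s * L s `^ (g - 1))
   (fun y => (if 1 <= enorm y then 1 else 0) * (enorm y `^ sigma * h y `^ p))) => //.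
- by move=> s; exact: ltW.
- exact: measurable_cont.
- by apply: stmeasM => //; exact: stmeas_powR.
- apply: (smeasM smeas_ge1).
  apply: smeasM; first exact: (smeas_comp (measurable_powR sigma) (@smeas_enorm R _)).
  exact: (smeas_comp (measurable_powR p) mh).
- apply: measurable_cont => s; apply: cvgM; last first.
    by apply: continuous_Lpow; rewrite subr_gt0 gam_gt1.
  by apply: cvgM; [exact: cvg_cst|exact: clam].
- by move=> y s; rewrite mulr_ge0// powR_ge0.
- by move=> y; case: ifP => _; rewrite ?mul0r// mul1r mulr_ge0// powR_ge0.
- by move=> s; rewrite mulr_ge0 ?powR_ge0// mulr_ge0// ltW.
move=> y s st; have [s0 sT] := andP st.
have [y1|_] := ifP; last by rewrite mul0r mulr0 mulr_ge0// powR_ge0.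
have sT' : 0 < s <= T by rewrite s0 (le_trans sT)//; case/andP: tT.
have hmu := Hh y s sT'.
have : (c * L s `^ g * h y) `^ p <= mu y s `^ p.
  apply: powR_monotone => //; first exact: ltW.
  by rewrite !mulr_ge0// powR_ge0.
rewrite !powRM ?powR_ge0// ?mulr_ge0 ?powR_ge0// -powRrM gamM => hp.
have hV := Vlb y1 sT'.
have -> : thl * c `^ p * lam s * L s `^ (g - 1) * (1 * (enorm y `^ sigma * h y `^ p)) =
  thl * lam s * enorm y `^ sigma * (c `^ p * L s `^ (g - 1) * h y `^ p) by ring.
by apply: ler_pM => //; rewrite !mulr_ge0 ?powR_ge0// ltW.
Qed.

(** Only the linear term enters: [mu >= u0] at all times, so [mu] is at least [t] times [B * u0],
    and [u0] is bounded below on a box around a point where it is positive. *)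
Lemma lower_start : exists2 c : R, 0 < c & forall x (t : R), 0 <= t <= T ->
  c * L t `^ g * expR (- (k0 * norm1 x)) <= mu x t.
Proof.
have B0 := kernel_nonneg.
have [d [T' [m [X [mX intRnE _]]]]] := intRn_model R n.+1.
have [z uz] := u0nz.
have uz0 : 0 < u0 z by rewrite lt_neqAle eq_sym uz u00.
pose de := u0 z / 2; have de0 : 0 < de by rewrite divr_gt0.
have /cvgrPdist_lt/(_ _ de0)/nbhs_ballP[r r0 Hr] := cu0 (x := z).
rewrite /= in r0.
pose r' := r / 2; have r'0 : 0 < r' by rewrite divr_gt0.
have box (y : rV) : (forall i, `|y ord0 i - z ord0 i| <= r') -> de <= u0 y.
  move=> h; have : ball z r y.
    split=> // i j; rewrite ord1 /ball/= distrC (le_lt_trans (h j))// /r'.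
    by move: r0; lra.
  move=> /Hr/=; rewrite ltr_distl => /andP[]; rewrite /de; lra.
pose N := norm1 z + n.+1%:R * r'.
pose b := klow R n.+1 * expR (- (k0 * N)) * de.
have b0 : 0 < b by rewrite mulr_gt0// mulr_gt0 ?expR_gt0// klow_gt0.
pose c1 := b * (2 * r') ^+ n.+1.
have c10 : 0 < c1 by rewrite mulr_gt0// exprn_gt0// mulr_gt0.
have conv x : ((c1 * expR (- (k0 * norm1 x)))%:E <= bconv B u0 x)%E.
  have := @bconv_box_lb R n.+1 B u0 z x r' (b * expR (- (k0 * norm1 x))) B0 mB (smeas_continuous cu0) u00.
  rewrite -/b (_ : b * _ * _ = c1 * expR (- (k0 * norm1 x))); last by rewrite /c1; ring.
  apply => //; first by rewrite mulr_ge0 ?expR_ge0// ltW.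
  move=> y hy; have hu := box y hy.
  have hn : norm1 y <= N.
    have := norm1_triangle z (z - y); rewrite subKr => h; apply: (le_trans h).
    by rewrite lerD2l; apply: norm1_le => i; rewrite !mxE distrC.
  have hxy : norm1 (x - y) <= norm1 x + N by apply: le_trans (norm1_triangle _ _) _; rewrite lerD2l.
  have -> : b * expR (- (k0 * norm1 x)) = klow R n.+1 * expR (- (k0 * (norm1 x + N))) * de.
    have -> : expR (- (k0 * (norm1 x + N))) = expR (- (k0 * norm1 x)) * expR (- (k0 * N)).
      by rewrite -expRD; congr expR; ring.
    by rewrite /b; ring.
  apply: ler_pM => //; rewrite ?(ltW de0)//; first by rewrite mulr_ge0 ?expR_ge0// ltW// klow_gt0.
  apply: le_trans (klb _); rewrite ler_wpM2l ?(ltW (klow_gt0 _ _))// ler_expR lerN2.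
  by rewrite ler_wpM2l.
have [M M0 HM] := LM.
have MT : 0 < M * T + 1 by rewrite ltr_wpDl// mulr_ge0// ltW.
(* As [g > 1] and [L t <= M t], one has [L^g <= Q t]; a bound linear in [t] is therefore strong
   enough. The summand 1 keeps the base positive when [T = 0]. *)
pose Q := M * (M * T + 1) `^ (g - 1).
have Q0 : 0 < Q by rewrite mulr_gt0// powR_gt0.
exists (c1 / Q); first by rewrite divr_gt0.
move=> x t tT; have [t0 tT'] := andP tT.
have Lt : L t `^ g <= Q * t.
  have := Lge0 t; rewrite le_eqVlt => /orP[/eqP <-|Lt0].
    by rewrite powR0 ?gt_eqF ?gam_gt0// mulr_ge0// ltW.
  have -> : L t `^ g = L t * L t `^ (g - 1).
    rewrite -{2}[L t]powRr1 ?(ltW Lt0)// -powRD ?subrKC//.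
    by rewrite (gt_eqF Lt0) implybT.
  have -> : Q * t = (M * t) * (M * T + 1) `^ (g - 1) by rewrite /Q; ring.
  apply: ler_pM => //; rewrite ?powR_ge0// ?HM//.
  apply: powR_monotone => //; first by rewrite subr_ge0 ltW// gam_gt1.
  have := HM t tT; have : M * t <= M * T by rewrite ler_wpM2l// ltW.
  lra.
have [_ H _] := mu_ge_terms x tT.
rewrite -lee_fin; apply: le_trans H.
have E : ((c1 * expR (- (k0 * norm1 x)))%:E * tint t (fun s => (1 * 1 : R)%:E) <=
    tint t (fun s => (1 : R)%:E * bconv B (mu ^~ s) x))%E.
  apply: (@tint_bconv_lb _ _ _ B0 mB _ _ _ _ mX intRnE (fun=> 1) _ _ t _ mu (fun=> 1) u0) => //.
  - exact: smeas_continuous.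
  - by rewrite mulr_ge0 ?expR_ge0// ltW.
  - move=> y s /andP[s0 st]; rewrite mul1r.
    by have [] := @mu_ge_terms y s _; rewrite ?(ltW s0)/= ?(le_trans st).
apply: le_trans E; rewrite tint_cst// -EFinM lee_fin.
have -> : c1 / Q * L t `^ g * expR (- (k0 * norm1 x)) = c1 * expR (- (k0 * norm1 x)) * (L t `^ g / Q) by ring.
by apply: ler_wpM2l; [rewrite mulr_ge0 ?expR_ge0// ltW|rewrite ler_pdivrMr// mulrC].
Qed.

Lemma smeas_norm1 : smeas (@norm1 R n.+1).
Proof.
move=> d T' Y mY; apply: measurable_sum => i.
by apply: measurableT_comp => //; exact: mY.
Qed.

(** The power [p] in the nonlinearity multiplies the spatial decay rate by [p] at each round, while
    the constant [m] can be kept the same throughout. *)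
Lemma lower_flat : exists2 m : R, 0 < m & forall x (t : R), 0 <= t <= T ->
  m * L t `^ g <= mu x t.
Proof.
have B0 := kernel_nonneg.
have [c c0 Hc] := lower_start.
have [p0 p1] := andP p01.
(* Points of the box used below differ from [x] by at most [2 + 1/2] in each coordinate. The two
   exponentials in [be] are the resulting losses in the kernel and in the spatial profile. *)
pose kb : R := n.+1%:R * (5 / 2).
have kb0 : 0 <= kb by rewrite mulr_ge0// divr_ge0.
have k00 : 0 <= k0 by rewrite addr_ge0.
pose be := klow R n.+1 * expR (- (k0 * kb)) * expR (- (k0 * kb)).
have be0 : 0 < be by rewrite mulr_gt0 ?expR_gt0// mulr_gt0 ?expR_gt0// klow_gt0.
pose A := thl / g * be.
have A0 : 0 < A by rewrite mulr_gt0// divr_gt0// gam_gt0.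
(* One round sends the constant [m] to [A m^p], which is at least [m] as soon as [m <= A^g]. *)
pose m := Num.min c (A `^ g).
have m0 : 0 < m by rewrite lt_min c0 powR_gt0.
have mA : m <= A * m `^ p.
  have E : m = m `^ (1 - p) * m `^ p.
    rewrite -powRD; first by rewrite subrK powRr1// ltW.
    by rewrite (gt_eqF m0) implybT.
  rewrite {1}E ler_wpM2r ?powR_ge0//.
  apply: (@le_trans _ _ ((A `^ g) `^ (1 - p))).
    by apply: powR_monotone; [lra|exact: ltW|rewrite ge_min lexx orbT].
  by rewrite -powRrM /g mulVf ?powRr1 ?(ltW A0)//; apply/eqP; lra.
have claim j : forall x (t : R), 0 <= t <= T ->
    m * L t `^ g * expR (- (k0 * p ^+ j * norm1 x)) <= mu x t.
  elim: j => [|j IH] x t tT.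
    rewrite expr0 mulr1; apply: le_trans (Hc x t tT).
    rewrite ler_wpM2r ?expR_ge0// ler_wpM2r ?powR_ge0//.
    by rewrite ge_min lexx.
  pose h (y : rV) := expR (- (k0 * p ^+ j * norm1 y)).
  pose E := expR (- (k0 * p ^+ j.+1 * norm1 x)).
  have pj0 : 0 <= p ^+ j.+1 by rewrite exprn_ge0// ltW.
  have pj1 : p ^+ j.+1 <= 1 by rewrite exprn_ile1// ltW.
  apply: (@le_trans _ _ (thl / g * m `^ p * (be * E) * L t `^ g)).
    have -> : thl / g * m `^ p * (be * E) * L t `^ g = A * m `^ p * L t `^ g * E by rewrite /A; ring.
    by rewrite ler_wpM2r ?expR_ge0// ler_wpM2r ?powR_ge0.
  apply: (@lower_step m (be * E) h x t) => //.
  - exact: ltW.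
  - by rewrite mulr_ge0 ?expR_ge0// ltW.
  - apply: smeas_comp => //.
    have -> : (fun y => - (k0 * p ^+ j * norm1 y)) = (fun y => (- (k0 * p ^+ j)) * @norm1 R n.+1 y).
      by apply/funext => y; rewrite mulNr.
    apply: smeasM; last exact: smeas_norm1.
    by move=> d T' Y mY; exact: measurable_cst.
  - by move=> y; exact: expR_ge0.
  - by move=> y s /andP[s0 sT]; apply: IH; rewrite ltW.
  (* The unit box is shifted so that its first coordinates have modulus at least [3/2]: there
     [|y| >= 1] and [V] is bounded below. *)
  pose sg : R := if 0 <= x ord0 ord0 then 2 else - 2.
  pose z : rV := x + const_mx sg.
  have mf : smeas (fun y : rV => (if 1 <= enorm y then 1 else 0) * (enorm y `^ sigma * h y `^ p)).
    apply: (smeasM smeas_ge1).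
    apply: smeasM; first exact: (smeas_comp (measurable_powR sigma) (@smeas_enorm R _)).
    apply: (smeas_comp (measurable_powR p)); apply: smeas_comp => //.
    have -> : (fun y => - (k0 * p ^+ j * norm1 y)) = (fun y => (- (k0 * p ^+ j)) * @norm1 R n.+1 y).
      by apply/funext => y; rewrite mulNr.
    apply: smeasM; last exact: smeas_norm1.
    by move=> d T' Y mY; exact: measurable_cst.
  have := @bconv_box_lb R n.+1 B _ z x (1 / 2) (be * E) B0 mB mf.
  rewrite (_ : be * E * (2 * (1 / 2)) ^+ n.+1 = be * E); last first.
    by rewrite (_ : 2 * (1 / 2) = 1 :> R) ?expr1n ?mulr1//; field.
  apply.
  - by move=> y; case: ifP => _; rewrite ?mul0r// mul1r mulr_ge0// powR_ge0.
  - by rewrite mulr_ge0 ?expR_ge0// ltW.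
  - by rewrite divr_gt0.
  move=> y hy.
  have nxy : norm1 (x - y) <= kb.
    apply: norm1_le => i; have := hy i; rewrite /z !mxE /sg.
    by case: ifP => _; rewrite !ler_norml => /andP[h1 h2]; apply/andP; split; lra.
  have ny : norm1 y <= norm1 x + kb.
    have := norm1_triangle x (x - y); rewrite subKr => h1.
    by apply: (le_trans h1); rewrite lerD2l.
  have y1 : 1 <= enorm y.
    apply: le_trans (coord_enorm y ord0).
    have := hy ord0; rewrite /z !mxE /sg; case: ifPn => x0.
      rewrite ler_norml => /andP[h1 h2]; apply: le_trans (ler_norm _); lra.
    rewrite -ltNge in x0; rewrite ler_norml -normrN => /andP[h1 h2].
    by apply: le_trans (ler_norm _); lra.
  rewrite y1 mul1r.
  have ys : 1 <= enorm y `^ sigma.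
    have := @powR_monotone R sigma 1 (enorm y) sigma0 ler01 y1.
    by rewrite powR1.
  have hB : klow R n.+1 * expR (- (k0 * kb)) <= B (x - y).
    apply: le_trans (klb _); rewrite ler_wpM2l ?(ltW (klow_gt0 _ _))// ler_expR lerN2.
    by rewrite ler_wpM2l.
  have hh : expR (- (k0 * kb)) * E <= h y `^ p.
    rewrite /h /E -expRM -expRD ler_expR mulNr -opprD lerN2.
    have -> : k0 * p ^+ j * norm1 y * p = k0 * p ^+ j.+1 * norm1 y by rewrite exprS; ring.
    have kp : 0 <= k0 * p ^+ j.+1 by rewrite mulr_ge0.
    apply: (@le_trans _ _ (k0 * p ^+ j.+1 * (norm1 x + kb))); first by rewrite ler_wpM2l.
    rewrite mulrDr addrC lerD2r ler_wpM2r// ler_piMr//.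
  have -> : be * E = klow R n.+1 * expR (- (k0 * kb)) * (1 * (expR (- (k0 * kb)) * E)).
    by rewrite /be mul1r mulrA.
  apply: ler_pM => //.
  - by rewrite mulr_ge0 ?expR_ge0// ltW// klow_gt0.
  - by rewrite mul1r mulr_ge0 ?expR_ge0.
  - by apply: ler_pM => //; rewrite mulr_ge0 ?expR_ge0.
exists m => // x t tT.
have := Lge0 t; rewrite le_eqVlt => /orP[/eqP <-|Lt0].
  by rewrite powR0 ?gt_eqF ?gam_gt0// mulr0.
have X0 : 0 < m * L t `^ g by rewrite mulr_gt0// powR_gt0.
apply: (@powR_interp_le R p _ (m * L t `^ g * expR (- (k0 * norm1 x)))) => //.
  by rewrite mulr_gt0// expR_gt0.
move=> j; apply: le_trans (claim j x t tT).
move: (m * L t `^ g) X0 => Xm X0.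
rewrite powRM ?expR_ge0 ?(ltW X0)// mulrA -(@powRD _ Xm); last by rewrite (gt_eqF X0) implybT.
rewrite subrK powRr1 ?(ltW X0)// -expRM ler_wpM2l ?(ltW X0)// ler_expR.
by rewrite le_eqVlt; apply/orP; left; apply/eqP; ring.
Qed.

Variable eps0 : R.
Hypothesis eps00 : 0 < eps0.
Hypothesis heps : forall x d, 0 <= d <= sigma * p / (1 - p) ->
  ((eps0 * enorm x `^ (sigma + d))%:E <=
   bconv B (fun y => (if 1 <= enorm y then 1 else 0) * enorm y `^ (sigma + d))%R x)%E.

(** Each round raises the spatial exponent from [sigma e] to [sigma (1 + e p)]. These are the
    partial geometric sums [sigma g (1 - p^j)], with limit [sigma g]; the exponent of [D] follows
    the same recursion. *)
Lemma lower_bound x (t : R) : 0 <= t <= T ->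
  (eps0 * thl / g * L t * enorm x `^ sigma) `^ g <= mu x t.
Proof.
move: x t; have [p0 p1] := andP p01.
have [m m0 Hm] := lower_flat.
pose D := eps0 * thl / g.
have D0 : 0 < D by rewrite divr_gt0 ?gam_gt0// mulr_gt0.
have q1 : 1 - p != 0 by apply/eqP; lra.
have claim j : forall x (t : R), 0 <= t <= T ->
    D `^ (g * (1 - p ^+ j)) * m `^ (p ^+ j) * L t `^ g * enorm x `^ (sigma * (g * (1 - p ^+ j)))
    <= mu x t.
  elim: j => [|j IH] x t tT.
    by rewrite expr0 subrr !mulr0 !powRr0 mul1r mulr1 powRr1 ?(ltW m0)//; exact: Hm.
  (* [d] is the spatial exponent of the [p]-th power of the current profile; [e <= g] keeps it in
     the range covered by [heps]. *)
  pose e := g * (1 - p ^+ j); pose d := sigma * (e * p).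
  have pj1 : p ^+ j <= 1 by rewrite exprn_ile1// ltW.
  have pj0 : 0 <= p ^+ j by rewrite exprn_ge0// ltW.
  have e0 : 0 <= e by rewrite mulr_ge0 ?(ltW gam_gt0)// subr_ge0.
  have eS : 1 + e * p = g * (1 - p ^+ j.+1).
    by rewrite /e exprS /g; field.
  pose c := D `^ e * m `^ (p ^+ j).
  pose h (y : rV) := enorm y `^ (sigma * e).
  have c0 : 0 <= c by rewrite mulr_ge0 ?powR_ge0.
  have hd : 0 <= d <= sigma * p / (1 - p).
    apply/andP; split; first by rewrite mulr_ge0// mulr_ge0// ltW.
    have -> : sigma * p / (1 - p) = sigma * (g * p) by rewrite /g; field.
    rewrite ler_wpM2l// ler_wpM2r ?(ltW p0)// /e ler_piMr ?(ltW gam_gt0)//.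
    by rewrite gerBl.
  have := @lower_step c (eps0 * enorm x `^ (sigma + d)) h x t c0.
  have -> : thl / g * c `^ p * (eps0 * enorm x `^ (sigma + d)) * L t `^ g =
      D `^ (g * (1 - p ^+ j.+1)) * m `^ (p ^+ j.+1) * L t `^ g *
      enorm x `^ (sigma * (g * (1 - p ^+ j.+1))).
    rewrite -eS /c powRM ?powR_ge0// -!powRrM [D `^ (1 + _)]powRD; last by rewrite (gt_eqF D0) implybT.
    rewrite powRr1 ?(ltW D0)// /d mulrDr mulr1 exprSr /D; ring.
  apply => //.
  - by rewrite mulr_ge0 ?powR_ge0// ltW.
  - exact: (smeas_comp (measurable_powR _) (@smeas_enorm R _)).
  - by move=> y; exact: powR_ge0.
  - by move=> y s /andP[s0 sT]; apply: IH; rewrite ltW.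
  rewrite (_ : (fun y => _) = (fun y => (if 1 <= enorm y then 1 else 0) * enorm y `^ (sigma + d))).
    exact: heps.
  apply/funext => y; case: ifPn => [y1|_]; last by rewrite !mul0r.
  rewrite !mul1r /h -powRrM -powRD; first by congr (_ `^ _); rewrite /d; ring.
  by rewrite (gt_eqF (lt_le_trans ltr01 y1)) implybT.
move=> x t tT; rewrite -/D; move: D D0 claim => D D0 claim.
have := Lge0 t; rewrite le_eqVlt => /orP[/eqP <-|Lt0].
  by rewrite mulr0 mul0r powR0 ?gt_eqF ?gam_gt0.
have := powR_ge0 (enorm x) sigma; rewrite le_eqVlt => /orP[/eqP <-|E0].
  by rewrite mulr0 powR0 ?gt_eqF ?gam_gt0.
have X0 : 0 < D * L t * enorm x `^ sigma by rewrite !mulr_gt0.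
have Lg0 : 0 < L t `^ g by rewrite powR_gt0.
apply: (@powR_interp_le R p _ (m * L t `^ g)) => //.
- by rewrite powR_gt0.
- by rewrite mulr_gt0.
move=> j; apply: le_trans (claim j x t tT).
set qj := p ^+ j.
rewrite -powRrM !powRM ?powR_ge0 ?(ltW m0) ?(ltW D0) ?mulr_ge0 ?(ltW D0)//.
rewrite -!powRrM.
have -> : L t `^ g = L t `^ (g * (1 - qj)) * L t `^ (g * qj).
  by rewrite -powRD; [congr (_ `^ _); ring|rewrite (gt_eqF Lt0) implybT].
by rewrite le_eqVlt; apply/orP; left; apply/eqP; ring.
Qed.

End LowerBound.

(** * Comparison of subsolution and supersolution *)

Section UpperBound.
Variables (R : realType) (n : nat) (B : 'rV[R]_n.+1 -> R).
Local Notation rV := 'rV[R]_n.+1.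
Hypothesis B0 : forall y, 0 <= B y.
Hypothesis mB : smeas B.

Variables (p sigma thu T D C1 : R) (q lam L : R -> R) (V mu om : rV -> R -> R).
Variables (u0 v0 rho : rV -> R).
Hypothesis p01 : 0 < p < 1.
Hypothesis thu0 : 0 < thu.
Hypothesis cq : continuous q.
Hypothesis q0 : forall s, 0 < q s.
Hypothesis clam : continuous lam.
Hypothesis lam0 : forall s, 0 < lam s.
Hypothesis cL : continuous L.
Hypothesis L00 : L 0 = 0.
Hypothesis Lge0 : forall s, 0 <= L s.
Hypothesis Lgt0 : forall s : R, 0 < s <= T -> 0 < L s.
Hypothesis dL : forall s : R, 0 < s < T -> is_derive s 1 L (q s * lam s).
Hypothesis mV : stmeas V.
Hypothesis V0 : forall y s, 0 <= V y s.
Hypothesis mmu : stmeas mu.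
Hypothesis mu0 : forall y s, 0 <= mu y s.
Hypothesis mom : stmeas om.
Hypothesis om0 : forall y s, 0 <= om y s.
Hypothesis v0u0 : forall y, v0 y <= u0 y.
Hypothesis Vub : forall y (s : R), 0 < s <= T ->
  V y s <= thu * lam s * enorm y `^ sigma.
Hypothesis mu_ge : forall x (t : R), 0 <= t <= T ->
  ((u0 x)%:E + tint t (fun s => (1 : R)%:E * bconv B (mu ^~ s) x)
   + tint t (fun s => (q s)%:E * bconv B (fun y => V y s * mu y s `^ p)%R x)
   <= (mu x t)%:E)%E.
Hypothesis om_le : forall x (t : R), 0 <= t <= T ->
  ((om x t)%:E <= (v0 x)%:E + tint t (fun s => (1 : R)%:E * bconv B (om ^~ s) x)
   + tint t (fun s => (q s)%:E * bconv B (fun y => V y s * om y s `^ p)%R x))%E.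
Hypothesis mrho : smeas rho.
Hypothesis rho0 : forall y, 0 < rho y.
Hypothesis rho_abs : forall y, enorm y `^ sigma * rho y `^ p <= rho y.
Hypothesis C10 : 0 < C1.
Hypothesis brho : forall x, (bconv B rho x <= (C1 * rho x)%:E)%E.
Hypothesis om_bound : exists2 H : R, 0 <= H & forall y (s : R), 0 <= s <= T -> om y s <= H * rho y.
Hypothesis D0 : 0 < D.

Let g := (1 - p)^-1.
(** With [D = eps0 thl / g] this is [p thu / (eps0 thl)], the gain of the linearised nonlinear term
    before convolution. *)
Let r := thu * p / (D * g).
Hypothesis C1r : C1 * r < 1.
Hypothesis mu_lb : forall y (t : R), 0 <= t <= T ->
  (D * L t * enorm y `^ sigma) `^ g <= mu y t.

(** The first summand gives [C1/K <= 1/4] for the sublinear phase, the second [C1/K <= (1 - C1 r)/2]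
    for the linear phase. *)
Let K := 4 * C1 + 2 * C1 / (1 - C1 * r).

Local Lemma g1 : 1 < g. Proof. exact: gam_gt1. Qed.
Local Lemma g0 : 0 < g. Proof. exact: lt_trans g1. Qed.
Local Lemma gp : g * p = g - 1. Proof. exact: gamM. Qed.
#[local] Hint Resolve g1 g0 : core.

Local Lemma rC0 : 0 < 1 - C1 * r. Proof. by rewrite subr_gt0. Qed.

Local Lemma K0 : 0 < K.
Proof. by rewrite addr_gt0// ?mulr_gt0// invr_gt0 rC0. Qed.
#[local] Hint Resolve K0 : core.

Local Lemma K_quarter : C1 / K <= 1 / 4.
Proof.
rewrite ler_pdivrMr// /K.
have : 0 < 2 * C1 / (1 - C1 * r) by rewrite divr_gt0 ?rC0// mulr_gt0.
lra.
Qed.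

Local Lemma K_half : C1 / K <= (1 - C1 * r) / 2.
Proof.
rewrite ler_pdivrMr//; have h := rC0.
apply: (@le_trans _ _ ((1 - C1 * r) / 2 * (2 * C1 / (1 - C1 * r)))).
  by rewrite le_eqVlt; apply/orP; left; apply/eqP; field; exact: lt0r_neq0.
by rewrite ler_wpM2l ?(divr_ge0 (ltW h))// /K lerDr mulr_ge0// ltW.
Qed.

Let W (eta s : R) := expR (K * s) * (L s + eta) `^ g.
Let W1 (eta s : R) := expR (K * s) * (lam s * (L s + eta) `^ (g - 1)).
(** The derivative of [W eta] on []0, T[]. *)
Let F (eta s : R) := K * W eta s + g * (q s * W1 eta s).

Local Lemma W_ge0 eta s : 0 <= W eta s.
Proof. by rewrite mulr_ge0 ?expR_ge0 ?powR_ge0. Qed.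
Local Lemma W1_ge0 eta s : 0 <= W1 eta s.
Proof. by rewrite mulr_ge0 ?expR_ge0// mulr_ge0 ?powR_ge0// ltW. Qed.
#[local] Hint Resolve W_ge0 W1_ge0 : core.

Local Lemma cW eta : 0 <= eta -> continuous (W eta).
Proof. by move=> e0; exact: (@continuous_W R L cL Lge0 K eta g e0 g1). Qed.

Local Lemma cW1 eta : 0 <= eta -> continuous (W1 eta).
Proof. by move=> e0; exact: (@continuous_W1 R lam clam L cL Lge0 K eta g e0 g1). Qed.

Local Lemma cF eta : 0 <= eta -> continuous (F eta).
Proof.
move=> e0 s; apply: cvgD; (apply: cvgM; first exact: cvg_cst); first exact: cW.
by apply: cvgM; [exact: cq|exact: cW1].
Qed.

Local Lemma tint_F (eta t : R) : 0 <= eta -> 0 <= t <= T ->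
  (tint t (fun s => (F eta s)%:E) <= (W eta t)%:E)%E.
Proof.
move=> e0 tT.
have := tint_power (continuous_ql cq clam) cL L00 Lge0 Lgt0 dL K e0 g1 tT.
rewrite (_ : (fun s => _) = (fun s => (F eta s)%:E)); last first.
  by apply/funext => s; congr EFin; rewrite /F /W /W1; ring.
by move=> ->; rewrite lee_fin gerBl powR_ge0.
Qed.

Local Lemma tint_leF (eta t c : R) (f : R -> R) : 0 <= eta -> 0 <= t <= T -> 0 <= c ->
  continuous f -> (forall s, 0 <= f s <= c * F eta s) ->
  (tint t (fun s => (f s)%:E) <= (c * W eta t)%:E)%E.
Proof.
move=> e0 tT c0 cf fF.
have mF : measurable_fun setT (F eta) by apply: measurable_cont; exact: cF.
have F0 s : 0 <= F eta s.
  by rewrite /F addr_ge0// mulr_ge0 ?(ltW K0) ?(ltW g0)// mulr_ge0// ltW.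
apply: (@le_trans _ _ (tint t (fun s => (c * F eta s)%:E))).
  apply: le_tint.
  - by apply/measurable_EFinP; exact: measurable_cont.
  - by apply/measurable_EFinP; apply: measurable_funM.
  - by move=> s _; rewrite !lee_fin.
by rewrite tintZ// EFinM lee_wpmul2l ?lee_fin// tint_F.
Qed.

Local Lemma tint_W (eta t m : R) : 0 <= eta -> 0 <= t <= T -> 0 <= m ->
  (tint t (fun s => (1 * (m * W eta s))%:E) <= (m / K * W eta t)%:E)%E.
Proof.
move=> e0 tT m0; apply: tint_leF => //; first by rewrite divr_ge0// ltW.
  by move=> s; apply: cvgM; [exact: cvg_cst|apply: cvgM; [exact: cvg_cst|exact: cW]].
move=> s; rewrite mul1r mulr_ge0//= /F mulrDr mulrA divfK ?gt_eqF// lerDl.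
by rewrite mulr_ge0 ?divr_ge0 ?(ltW K0)// mulr_ge0 ?(ltW g0)// mulr_ge0// ltW.
Qed.

Local Lemma tint_W1 (eta t m : R) : 0 <= eta -> 0 <= t <= T -> 0 <= m ->
  (tint t (fun s => (q s * (m * W1 eta s))%:E) <= (m / g * W eta t)%:E)%E.
Proof.
move=> e0 tT m0; apply: tint_leF => //; first by rewrite divr_ge0// ltW.
  by move=> s; apply: cvgM; [exact: cq|apply: cvgM; [exact: cvg_cst|exact: cW1]].
move=> s; have P : 0 <= q s * (m * W1 eta s).
  by apply: mulr_ge0; [exact: ltW|exact: mulr_ge0].
rewrite P/=.
have -> : m / g * F eta s = m / g * (K * W eta s) + q s * (m * W1 eta s).
  by rewrite /F; field; exact: lt0r_neq0 g0.
by rewrite lerDr mulr_ge0 ?divr_ge0 ?(ltW g0)// mulr_ge0 ?(ltW K0).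
Qed.

(** Subtract the two integral inequalities. Both excesses are parts of the derivative of [W eta], so
    time integration returns [W eta] with factors [1/K] and [1/g], and convolution of [rho] costs
    [C1]. *)
Local Lemma upper_step (eta m c : R) : 0 <= eta -> 0 <= m -> 0 <= c ->
  (forall y (s : R), 0 < s <= T -> om y s <= mu y s + m * W eta s * rho y) ->
  (forall y (s : R), 0 < s <= T ->
     V y s * om y s `^ p <= V y s * mu y s `^ p + c * W1 eta s * rho y) ->
  forall x (t : R), 0 <= t <= T ->
    om x t <= mu x t + C1 * (m / K + c / g) * W eta t * rho x.
Proof.
move=> e0 m0 c0 H1 H2 x t tT; have [t0 tT'] := andP tT.
have [d [T' [nu [X [mX intRnE _]]]]] := intRn_model R n.+1.
have Cr : 0 <= C1 * rho x by rewrite mulr_ge0// ltW.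
have r00 y : 0 <= rho y by exact: ltW.
pose A := tint t (fun s => (1 : R)%:E * bconv B (mu ^~ s) x)%E.
pose C := tint t (fun s => (q s)%:E * bconv B (fun y => V y s * mu y s `^ p)%R x)%E.
pose al := C1 * rho x * (m / K * W eta t); pose be := C1 * rho x * (c / g * W eta t).
have h1 : (tint t (fun s => (1 : R)%:E * bconv B (om ^~ s) x) <= A + al%:E)%E.
  apply: (@le_trans _ _ (A + (C1 * rho x)%:E * tint t (fun s => (1 * (m * W eta s))%:E))%E).
    apply: (@tint_bconv_ub _ _ _ B0 mB _ _ _ _ mX intRnE (fun=> 1) _ _ t _ om mu (fun s => m * W eta s) rho) => //.
    - by apply: measurable_funM => //; apply: measurable_cont; exact: cW.
    - by move=> s; rewrite mulr_ge0.
    - by move=> y s /andP[s0 st]; apply: H1; rewrite s0 (le_trans st).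
  by rewrite leeD2l// /al (EFinM (C1 * rho x)) lee_wpmul2l ?lee_fin// tint_W.
have h2 : (tint t (fun s => (q s)%:E * bconv B (fun y => V y s * om y s `^ p)%R x) <= C + be%:E)%E.
  apply: (@le_trans _ _ (C + (C1 * rho x)%:E * tint t (fun s => (q s * (c * W1 eta s))%:E))%E).
    apply: (@tint_bconv_ub _ _ _ B0 mB _ _ _ _ mX intRnE q _ _ t _
      (fun y s => V y s * om y s `^ p) (fun y s => V y s * mu y s `^ p) (fun s => c * W1 eta s) rho) => //.
    - by move=> s; exact: ltW.
    - exact: measurable_cont.
    - by apply: stmeasM => //; exact: stmeas_powR.
    - by apply: stmeasM => //; exact: stmeas_powR.
    - by apply: measurable_funM => //; apply: measurable_cont; exact: cW1.
    - by move=> y s; rewrite mulr_ge0 ?powR_ge0.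
    - by move=> y s; rewrite mulr_ge0 ?powR_ge0.
    - by move=> s; rewrite mulr_ge0.
    - by move=> y s /andP[s0 st]; apply: H2; rewrite s0 (le_trans st).
  by rewrite leeD2l// /be (EFinM (C1 * rho x)) lee_wpmul2l ?lee_fin// tint_W1.
have -> : mu x t + C1 * (m / K + c / g) * W eta t * rho x = mu x t + (al + be).
  by rewrite /al /be; ring.
rewrite -lee_fin; apply: (le_trans (om_le x tT)).
have h0 : ((v0 x)%:E <= (u0 x)%:E)%E by rewrite lee_fin.
apply: (le_trans (leeD (leeD h0 h1) h2)).
rewrite (addeA (u0 x)%:E) (addeACA ((u0 x)%:E + A)) -EFinD [leRHS]EFinD; apply: leeD => //.
exact: mu_ge.
Qed.

Let valid (eta m : R) := forall x (t : R), 0 <= t <= T ->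
  om x t <= mu x t + m * W eta t * rho x.

Local Lemma valid_le eta m m' : m <= m' -> valid eta m -> valid eta m'.
Proof.
move=> mm H x t tT; apply: le_trans (H x t tT) _; rewrite lerD2l.
by rewrite ler_wpM2r ?(ltW (rho0 x))// ler_wpM2r.
Qed.

(** No positivity of [mu] enters: subadditivity bounds the excess by its own [p]-th power. The time
    profile fits because [g * p = g - 1] and [e^(pKs) <= e^(Ks)]; [rho_abs] absorbs the growth of
    [V]. *)
Local Lemma valid_sublinear (eta m : R) : 0 <= eta -> 0 <= m -> valid eta m ->
  valid eta (C1 * (m / K + thu * m `^ p / g)).
Proof.
move=> e0 m0 H; have [p0 p1] := andP p01.
have W0 s : 0 <= L s + eta by rewrite addr_ge0.
have sub y (s : R) : 0 < s <= T -> 0 <= s <= T by move=> /andP[/ltW -> ->].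
apply: upper_step => //.
- by rewrite mulr_ge0 ?powR_ge0// ltW.
- by move=> y s st; apply: H; exact: sub.
move=> y s st; have [s0 sT] := andP st.
have z0 : 0 <= m * W eta s * rho y by rewrite mulr_ge0 ?(ltW (rho0 y))// mulr_ge0.
apply: (@le_trans _ _ (V y s * (mu y s `^ p + (m * W eta s * rho y) `^ p))).
  rewrite ler_wpM2l//; apply: le_trans (powR_subadditive p01 (mu0 y s) z0).
  by apply: powR_monotone => //; [exact: ltW|apply: H; exact: sub].
have E3 (b c d : R) : 0 <= b -> 0 <= c -> 0 <= d ->
    (b * c * d) `^ p = b `^ p * c `^ p * d `^ p.
  by move=> b0 c0 d0; rewrite powRM ?mulr_ge0// powRM.
rewrite E3 ?(ltW (rho0 y))//.
rewrite mulrDr lerD2l.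
have Wp : W eta s `^ p <= expR (K * s) * (L s + eta) `^ (g - 1).
  rewrite /W powRM ?expR_ge0 ?powR_ge0// -powRrM gp ler_wpM2r ?powR_ge0// -expRM ler_expR.
  by rewrite ler_piMr ?(ltW p1)// mulr_ge0// ltW.
apply: (@le_trans _ _ (thu * lam s * enorm y `^ sigma *
    (m `^ p * (expR (K * s) * (L s + eta) `^ (g - 1)) * rho y `^ p))).
  apply: ler_pM => //; first by rewrite !mulr_ge0 ?powR_ge0.
    exact: Vub.
  by rewrite ler_wpM2r ?powR_ge0// ler_wpM2l ?powR_ge0.
have -> : thu * lam s * enorm y `^ sigma *
    (m `^ p * (expR (K * s) * (L s + eta) `^ (g - 1)) * rho y `^ p) =
    thu * m `^ p * W1 eta s * (enorm y `^ sigma * rho y `^ p) by rewrite /W1; ring.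
by rewrite ler_wpM2l// mulr_ge0// mulr_ge0 ?powR_ge0// ltW.
Qed.

(** From [M0] on, the sublinear contribution [C1 thu m^p / g] is at most [m/2]; with the quarter
    from [K] this gives the factor [3/4]. *)
Let M0 := (2 * C1 * thu / g) `^ g.

Local Lemma M0_gt0 : 0 < M0.
Proof. by rewrite powR_gt0// divr_gt0// !mulr_gt0. Qed.

Local Lemma valid_contract (eta m : R) : 0 <= eta -> M0 <= m -> valid eta m ->
  valid eta (3 / 4 * m).
Proof.
move=> e0 Mm H; have [p0 p1] := andP p01.
have m0 : 0 < m by exact: lt_le_trans M0_gt0 Mm.
apply: valid_le (valid_sublinear e0 (ltW m0) H).
have E : m = m `^ (1 - p) * m `^ p.
  rewrite -powRD; first by rewrite subrK powRr1// ltW.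
  by rewrite (gt_eqF m0) implybT.
have h : 2 * C1 * thu / g <= m `^ (1 - p).
  have c0 : 0 <= 2 * C1 * thu / g by rewrite divr_ge0 ?(ltW g0)// !mulr_ge0// ltW.
  apply: (@le_trans _ _ (M0 `^ (1 - p))).
    by rewrite /M0 -powRrM /g mulVf ?powRr1//; apply/eqP; lra.
  by apply: powR_monotone => //; [lra|exact: ltW M0_gt0].
have h1 : 2 * C1 * thu / g * m `^ p <= m by rewrite {2}E ler_wpM2r ?powR_ge0.
have h2 : C1 / K * m <= 1 / 4 * m by rewrite ler_wpM2r ?K_quarter// ltW.
have -> : C1 * (m / K + thu * m `^ p / g) = C1 / K * m + 2 * C1 * thu / g * m `^ p / 2.
  by field; rewrite !gt_eqF.
lra.
Qed.

(** The a priori bound starts the iteration with [H / eta^g]. The contraction brings any starting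
    constant down to [M0] after finitely many rounds, and [M0] is independent of [eta]. *)
Local Lemma valid_M0 (eta : R) : 0 < eta -> valid eta M0.
Proof.
move=> e0; have [H H0 HH] := om_bound.
have eg : 0 < eta `^ g by rewrite powR_gt0.
pose m0 := H / eta `^ g.
have v0' : valid eta m0.
  move=> x t tT; have [t0 _] := andP tT.
  apply: (le_trans (HH x t tT)); apply: ler_wpDl => //.
  rewrite ler_wpM2r ?(ltW (rho0 x))//.
  have e1 : 1 <= expR (K * t) by rewrite -expR0 ler_expR mulr_ge0// ltW.
  have e2 : eta `^ g <= (L t + eta) `^ g.
    by apply: powR_monotone; rewrite ?(ltW g0) ?(ltW e0)// lerDr.
  have -> : H = m0 * (1 * eta `^ g) by rewrite /m0 mul1r divfK// gt_eqF.
  rewrite ler_wpM2l ?divr_ge0 ?(ltW eg)// /W; apply: ler_pM => //; exact: ltW.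
have claim j : valid eta (Num.max M0 ((3 / 4) ^+ j * m0)).
  elim: j => [|j IH]; first by rewrite expr0 mul1r; apply: valid_le v0'; rewrite le_max lexx orbT.
  have Mm : M0 <= Num.max M0 ((3 / 4) ^+ j * m0) by rewrite le_max lexx.
  apply: valid_le (valid_contract (ltW e0) Mm IH).
  rewrite (_ : _ ^+ j.+1 * m0 = 3 / 4 * ((3 / 4) ^+ j * m0)); last by rewrite exprS mulrA.
  move: (_ ^+ j * m0) => b.
  rewrite le_max; have [h|h] := leP M0 b; first by rewrite lexx orbT.
  by apply/orP; left; have := M0_gt0; lra.
have cv : (3 / 4) ^+ j * m0 @[j --> \oo] --> (0 : R).
  have h : `|3 / 4| < 1 :> R by rewrite ger0_norm; lra.
  have := @cvg_geometric R m0 (3 / 4) h; rewrite /geometric/=.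
  by under eq_fun do rewrite mulrC.
have /cvgrPdist_lt/(_ _ M0_gt0)/filter_ex[j] := cv.
rewrite sub0r normrN => /ltW hj; have := claim j; rewrite (max_idPl _)//.
exact: le_trans (ler_norm _) hj.
Qed.

Local Lemma valid0_M0 : valid 0 M0.
Proof.
move=> x t tT; have [t0 _] := andP tT.
(* After division by [c] the claim is a bound by [(L t)^g]; taking [g]-th roots makes the passage
   from [L t + eta] to [L t] linear in [eta]. *)
set c := M0 * expR (K * t) * rho x.
have c0 : 0 < c by rewrite mulr_gt0// mulr_gt0 ?expR_gt0// M0_gt0.
have -> : mu x t + M0 * W 0 t * rho x = mu x t + L t `^ g * c.
  by rewrite /W addr0 /c; ring.
rewrite -lerBlDl -ler_pdivrMr//; set z := (_ / c).
have hz (eta : R) : 0 < eta -> z <= (L t + eta) `^ g.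
  move=> e0; rewrite ler_pdivrMr// lerBlDl.
  by have := valid_M0 e0 x tT; rewrite (_ : M0 * W eta t * rho x = (L t + eta) `^ g * c)// /W /c; ring.
have [z0|z0] := leP z 0; first by rewrite (le_trans z0)// powR_ge0.
have -> : z = (z `^ g^-1) `^ g by rewrite -powRrM mulVf ?powRr1 ?(ltW z0)// gt_eqF.
apply: powR_monotone; [exact: ltW|exact: powR_ge0|].
apply/ler_addgt0Pr => e e0.
have -> : L t + e = ((L t + e) `^ g) `^ g^-1.
  by rewrite -powRrM mulfV ?powRr1 ?gt_eqF// addr_ge0// ltW.
by apply: powR_monotone; [rewrite invr_ge0 ltW|exact: ltW|exact: hz].
Qed.

(** Because [g (1 - p) = 1], the lower bound on [mu] gives [mu^(p-1) <= 1 / (D L |y|^sigma)]: the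
    growth of [V] cancels and [L^g] drops to [L^(g-1)], the profile of [W1]. With [eta > 0],
    dividing [(L + eta)^g] by [L] would exceed [(L + eta)^(g-1)]. *)
Local Lemma valid_linear (m : R) : 0 <= m -> valid 0 m ->
  valid 0 ((1 + C1 * r) / 2 * m).
Proof.
move=> m0 H; have [p0 p1] := andP p01.
have g0' := g0.
have sub (s : R) : 0 < s <= T -> 0 <= s <= T by move=> /andP[/ltW -> ->].
pose c := thu * p / D * m.
have c0 : 0 <= c by rewrite mulr_ge0// divr_ge0 ?(ltW D0)// mulr_ge0// ltW.
have st : valid 0 (C1 * (m / K + c / g)).
  apply: upper_step => //; first by move=> y s st; apply: H; exact: sub.
  move=> y s st; have [s0 sT] := andP st.
  have Ls := Lgt0 st; have rr := rho0 y; have ls := lam0 s.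
  (* Where the power of [|y|] vanishes, the upper bound forces [V = 0]; elsewhere [Z] is positive
     and may be divided by. *)
  have := powR_ge0 (enorm y) sigma; rewrite le_eqVlt => /orP[/eqP E0|E0].
    have Vy : V y s = 0.
      by apply/eqP; rewrite eq_le V0 andbT; have := Vub y st; rewrite -E0 mulr0.
    by rewrite Vy !mul0r add0r mulr_ge0 ?(ltW rr)// mulr_ge0.
  pose Z := D * L s * enorm y `^ sigma.
  have Z0 : 0 < Z by rewrite !mulr_gt0.
  have muZ : Z `^ g <= mu y s by apply: mu_lb; exact: sub.
  have mup : 0 < mu y s by apply: lt_le_trans muZ; rewrite powR_gt0.
  pose z := m * W 0 s * rho y.
  have z0 : 0 <= z by rewrite mulr_ge0 ?(ltW rr)// mulr_ge0.
  have muV : mu y s `^ (p - 1) <= Z^-1.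
    have -> : p - 1 = - (1 - p) by ring.
    rewrite powRN lef_pV2 ?posrE ?powR_gt0//.
    apply: (@le_trans _ _ ((Z `^ g) `^ (1 - p))).
      by rewrite -powRrM /g mulVf ?powRr1 ?(ltW Z0)//; apply/eqP; lra.
    by apply: powR_monotone => //; [lra|exact: powR_ge0].
  apply: (@le_trans _ _ (V y s * (mu y s `^ p + p * mu y s `^ (p - 1) * z))).
    rewrite ler_wpM2l//; apply: le_trans (powR_bernoulli p01 mup z0).
    by apply: powR_monotone => //; [exact: ltW|apply: H; exact: sub].
  rewrite mulrDr lerD2l.
  have h : V y s * mu y s `^ (p - 1) <= thu * lam s * enorm y `^ sigma / Z.
    by apply: ler_pM => //; [exact: powR_ge0|exact: Vub].
  have -> : V y s * (p * mu y s `^ (p - 1) * z) = V y s * mu y s `^ (p - 1) * (p * z) by ring.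
  apply: (@le_trans _ _ (thu * lam s * enorm y `^ sigma / Z * (p * z))).
    by rewrite ler_wpM2r// mulr_ge0// ltW.
  have LE : L s `^ g = L s * L s `^ (g - 1).
    rewrite -{2}[L s]powRr1 ?(ltW Ls)// -powRD ?subrKC//.
    by rewrite (gt_eqF Ls) implybT.
  rewrite /z /W /W1 !addr0 LE /c /Z le_eqVlt; apply/orP; left; apply/eqP; field.
  by rewrite !gt_eqF.
apply: valid_le st.
have -> : C1 * (m / K + c / g) = (C1 / K + C1 * r) * m.
  by rewrite /c /r; field; rewrite !gt_eqF.
by rewrite ler_wpM2r//; have := K_half; lra.
Qed.

Lemma comparison x (t : R) : 0 <= t <= T -> om x t <= mu x t.
Proof.
move=> tT; have rp : 0 <= r.
  have [p0 _] := andP p01.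
  by rewrite divr_ge0// mulr_ge0// ltW// g0.
pose th := (1 + C1 * r) / 2.
have th0 : 0 <= th by rewrite divr_ge0// addr_ge0// mulr_ge0// ltW.
have th1 : th < 1 by have := C1r; rewrite /th; lra.
have claim j : valid 0 (th ^+ j * M0).
  elim: j => [|j IH]; first by rewrite expr0 mul1r; exact: valid0_M0.
  rewrite exprS -mulrA; apply: valid_linear => //.
  by rewrite mulr_ge0 ?exprn_ge0// ltW// M0_gt0.
pose c := M0 * W 0 t * rho x.
have cv : mu x t + th ^+ j * c @[j --> \oo] --> mu x t.
  rewrite -[X in _ --> X]addr0; apply: cvgD; first exact: cvg_cst.
  have h : `|th| < 1 by rewrite ger0_norm.
  have := @cvg_geometric R c th h; rewrite /geometric/=.
  by under eq_fun do rewrite mulrC.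
rewrite -(cvg_lim _ cv)//; apply: limr_ge; first by apply/cvg_ex; exists (mu x t).
apply: nearW => j; apply: le_trans (claim j x t tT) _.
by rewrite lerD2l /c !mulrA.
Qed.

End UpperBound.

(** * Reduction of the theorem to a compact time interval *)

Lemma eq_tint (R : realType) (t : R) (F G : R -> \bar R) :
  (forall s, 0 <= s <= t -> F s = G s) -> tint t F = tint t G.
Proof. by move=> FG; apply: eq_integral => s; rewrite inE/=; exact: FG. Qed.

Theorem mainTheorem3 (R : realType) (n : nat) (p : R) (tau0 : \bar R)
  (sigma : R) (Lam : R -> R) (thl thu : R) (V : 'rV[R]_n -> R -> R)
  (B : 'rV[R]_n -> R) (a eps0 : R) (u0 v0 : 'rV[R]_n -> R)
  (u v : 'rV[R]_n -> R -> R) :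
  (1 <= n)%N -> 0 < p < 1 -> (0 < tau0)%E -> Jplus n sigma ->
  {within [set t | inI tau0 t], continuous Lam} ->
  (forall t, inI tau0 t -> 0 < Lam t) ->
  0 < thl -> 0 < thu ->
  (forall x t, inI tau0 t -> 0 <= V x t) ->
  {within [set z : 'rV[R]_n * R | inI tau0 z.2], continuous (fun z => V z.1 z.2)} ->
  (forall x t, 1 <= enorm x -> 0 < t -> (t%:E < tau0)%E ->
     thl * Lam t * enorm x `^ sigma <= V x t) ->
  (forall x t, 0 < t -> (t%:E < tau0)%E ->
     V x t <= thu * Lam t * enorm x `^ sigma) ->
  sigma / (1 - p) <= a ->
  is_bessel_kernel B ->
  0 < eps0 ->
  (forall x d, 0 <= d <= sigma * p / (1 - p) ->
     ((eps0 * enorm x `^ (sigma + d))%:E <=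
      intRn (fun y => ((if 1 <= enorm (x - y) then 1 else 0) * B y
                         * enorm (x - y) `^ (sigma + d))%:E))%E) ->
  (forall x, 0 <= u0 x) -> (forall x, 0 <= v0 x) -> BC a u0 -> BC a v0 ->
  Zspace tau0 a u -> Zspace tau0 a v ->
  (forall x t, inI tau0 t -> 0 <= u x t /\ 0 <= v x t) ->
  (forall x t, inI tau0 t ->
     ((u0 x)%:E
      + tint t (fun s => bconv B (fun y => (expR s * u y s)%R) x)
      + tint t (fun s => (expR ((1 - p) * s)%R)%:E
                * bconv B (fun y => (V y s * (expR s * u y s) `^ p)%R) x)
      <= (expR t * u x t)%:E)%E) ->
  (forall x t, inI tau0 t ->
     ((expR t * v x t)%:E <=
      (v0 x)%:E
      + tint t (fun s => bconv B (fun y => (expR s * v y s)%R) x)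
      + tint t (fun s => (expR ((1 - p) * s)%R)%:E
                * bconv B (fun y => (V y s * (expR s * v y s) `^ p)%R) x))%E) ->
  p < eps0 * thl / thu ->
  (forall x, v0 x <= u0 x) -> (exists x, u0 x != 0) ->
  forall x t, inI tau0 t -> v x t <= u x t.
Proof.
case: n V B u0 v0 u v => [|n] V B u0 v0 u v; first by [].
move=> _ p01 tau00 sJ cLam Lam0 thl0 thu0 V0 cV Vlb Vub ha hB eps00 heps u00 v00.
move=> bu0 bv0 Zu Zv uv0 Hu Hv hp v0u0 u0nz x T [T0 TT].
have [p0 p1] := andP p01.
have sigma0 : 0 <= sigma.
  by move: sJ; rewrite /Jplus; case: ifP => _ // -[->//|]; exact: le_trans.
have q1 : 0 < 1 - p by rewrite subr_gt0.
have a0 : 0 <= a by apply: le_trans ha; rewrite divr_ge0// ltW.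
have [B' [klb mB kexp bE rE]] := bessel_normalised hB.
have B'0 := kernel_nonneg klb.
have cI s : inI tau0 (clamp T s) := inI_clamp T0 TT s.
(* [T] is the time at which the conclusion is sought. The inequalities are used up to [T] only, so
   all data can be frozen outside [[0, T]]. *)
pose q (s : R) := expR ((1 - p) * s).
pose lam s := Lam (clamp T s).
pose mu (y : 'rV[R]_n.+1) s := expR (clamp T s) * u y (clamp T s).
pose om (y : 'rV[R]_n.+1) s := expR (clamp T s) * v y (clamp T s).
pose V' (y : 'rV[R]_n.+1) s := V y (clamp T s).
have cq : continuous q by move=> s; apply: der_continuous.
have q0 s : 0 < q s by exact: expR_gt0.
have clam : continuous lam by exact: (continuous_clamp_comp T0 TT cLam).
have lam0 s : 0 < lam s by exact: Lam0.
have mexp (w : 'rV[R]_n.+1 -> R -> R) : stmeas w -> stmeas (fun y s => expR (clamp T s) * w y s).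
  move=> mw; apply: (@stmeasM _ _ (fun _ s => expR (clamp T s))) => // d T' Y S mY mS.
  apply: measurableT_comp => //; apply: measurableT_comp => //.
  by apply: measurable_cont; exact: continuous_clamp.
have mmu : stmeas mu by apply: mexp; exact: (Zspace_stmeas a0 T0 TT Zu).
have mom : stmeas om by apply: mexp; exact: (Zspace_stmeas a0 T0 TT Zv).
have mV : stmeas V' by exact: (within_stmeas T0 TT cV).
have mu0 y s : 0 <= mu y s by rewrite mulr_ge0 ?expR_ge0//; case: (uv0 y _ (cI s)).
have om0 y s : 0 <= om y s by rewrite mulr_ge0 ?expR_ge0//; case: (uv0 y _ (cI s)).
have V'0 y s : 0 <= V' y s by exact: V0.
have tintE1 (w : 'rV[R]_n.+1 -> R -> R) y (t : R) : 0 <= t <= T ->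
    stmeas (fun y s => expR (clamp T s) * w y (clamp T s)) ->
    tint t (fun s => bconv B (fun y => expR s * w y s) y) =
    tint t (fun s => (1 : R)%:E * bconv B' (fun y => expR (clamp T s) * w y (clamp T s))%R y)%E.
  move=> /andP[t0 tT] mw; apply: eq_tint => s /andP[s0 st].
  rewrite mul1e -bE; last exact: (stmeas_smeas s mw).
  by rewrite clamp_id// s0 (le_trans st).
have tintE2 (w : 'rV[R]_n.+1 -> R -> R) y (t : R) : 0 <= t <= T ->
    stmeas (fun y s => expR (clamp T s) * w y (clamp T s)) ->
    tint t (fun s => (expR ((1 - p) * s)%R)%:E * bconv B (fun y => V y s * (expR s * w y s) `^ p)%R y)%E =
    tint t (fun s => (q s)%:E * bconv B' (fun y => V' y s * (expR (clamp T s) * w y (clamp T s)) `^ p)%R y)%E.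
  move=> /andP[t0 tT] mw; apply: eq_tint => s /andP[s0 st].
  rewrite -bE; last first.
    apply: (@stmeas_smeas _ _ (fun y s => V' y s * (expR (clamp T s) * w y (clamp T s)) `^ p)).
    by apply: stmeasM => //; exact: stmeas_powR.
  by rewrite /V' clamp_id// s0 (le_trans st).
have mu_ge y (t : R) : 0 <= t <= T ->
    ((u0 y)%:E + tint t (fun s => (1 : R)%:E * bconv B' (mu ^~ s) y)
     + tint t (fun s => (q s)%:E * bconv B' (fun y => V' y s * mu y s `^ p)%R y)
     <= (mu y t)%:E)%E.
  move=> tT; have := Hu y t (inI_le TT tT).
  have -> : expR t * u y t = mu y t by rewrite /mu (clamp_id tT).
  rewrite (tintE1 u y t tT mmu) (tintE2 u y t tT mmu); exact.
have om_le y (t : R) : 0 <= t <= T ->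
    ((om y t)%:E <= (v0 y)%:E + tint t (fun s => (1 : R)%:E * bconv B' (om ^~ s) y)
     + tint t (fun s => (q s)%:E * bconv B' (fun y => V' y s * om y s `^ p)%R y))%E.
  move=> tT; have := Hv y t (inI_le TT tT).
  have -> : expR t * v y t = om y t by rewrite /om (clamp_id tT).
  rewrite (tintE1 v y t tT mom) (tintE2 v y t tT mom); exact.
have It (s : R) : 0 < s <= T -> (s%:E < tau0)%E.
  by move=> /andP[_ sT]; apply: le_lt_trans TT; rewrite lee_fin.
have cid (s : R) : 0 < s <= T -> clamp T s = s.
  by move=> /andP[s0 sT]; rewrite clamp_id// ltW.
have V'lb y (s : R) : 1 <= enorm y -> 0 < s <= T -> thl * lam s * enorm y `^ sigma <= V' y s.
  by move=> y1 sT; rewrite /lam /V' cid//; apply: Vlb => //; [case/andP: sT|exact: It].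
have V'ub y (s : R) : 0 < s <= T -> V' y s <= thu * lam s * enorm y `^ sigma.
  by move=> sT; rewrite /lam /V' cid//; apply: Vub => //; [case/andP: sT|exact: It].
have cql := continuous_ql cq clam.
have ql0 s : 0 < q s * lam s by rewrite mulr_gt0.
have [L [cL [L00 Lge0] Lgt0 LM dL]] := exists_primitive cql ql0 T0.
have heps' y d : 0 <= d <= sigma * p / (1 - p) ->
    ((eps0 * enorm y `^ (sigma + d))%:E <=
     bconv B' (fun z => (if 1 <= enorm z then 1 else 0) * enorm z `^ (sigma + d))%R y)%E.
  move=> hd; apply: le_trans (heps y d hd) _; rewrite -rE.
  - rewrite le_eqVlt; apply/orP; left; apply/eqP; congr intRn; apply/funext => z.
    by congr EFin; rewrite -mulrA mulrCA.
  - apply: (smeasM (@smeas_ge1 R n)).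
    exact: (smeas_comp (measurable_powR _) (@smeas_enorm R _)).
  - by move=> z; rewrite mulr_ge0 ?powR_ge0//; case: ifP.
have [cu0 _] := bu0.
have mu_lb := lower_bound klb mB p01 sigma0 thl0 T0 cq q0 clam lam0 cL L00 Lge0 Lgt0 dL LM
  mV V'0 mmu mu0 u00 cu0 u0nz V'lb mu_ge eps00 heps'.
(* The hypothesis on [p] says exactly [r < 1]; the factor [g] inside [D] cancels against the one in
   the comparison ratio. *)
pose r := p * thu / (eps0 * thl).
have et0 : 0 < eps0 * thl by rewrite mulr_gt0.
have r01 : 0 < r < 1.
  apply/andP; split; first by rewrite divr_gt0// mulr_gt0.
  by rewrite ltr_pdivrMr// mul1r -ltr_pdivlMr.
have [rho [C1 [C10 C1r mrho rhow brho]]] := exp_weight B'0 mB kexp r01 a0.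
have rho0 y : 0 < rho y by exact: lt_le_trans (wt_gt0 a y) (rhow y).
(* Here [a >= sigma/(1-p)] enters: [rho] dominates the power [sigma/(1-p)] of [|y|], so [|y|^sigma]
   is at most [rho^(1-p)]. *)
have rho_abs y : enorm y `^ sigma * rho y `^ p <= rho y.
  have e0 : 0 <= enorm y by exact: enorm_ge0.
  have sg0 : 0 <= sigma / (1 - p) by rewrite divr_ge0// ltW.
  have h : enorm y `^ sigma <= rho y `^ (1 - p).
    apply: (@le_trans _ _ ((enorm y `^ (sigma / (1 - p))) `^ (1 - p))).
      by rewrite -powRrM divfK// gt_eqF.
    apply: powR_monotone; [exact: ltW|exact: powR_ge0|].
    apply: le_trans (rhow y); apply: (le_trans (enorm_powR_wt y sg0)).
    by apply: ler_powR; [rewrite lerDl sqr_ge0|rewrite ler_wpM2r].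
  have E : rho y = rho y `^ (1 - p) * rho y `^ p.
    rewrite -powRD; first by rewrite subrK powRr1// ltW.
    by rewrite (gt_eqF (rho0 y)) implybT.
  by rewrite {2}E ler_wpM2r ?powR_ge0.
have om_bound : exists2 H : R, 0 <= H & forall y (s : R), 0 <= s <= T -> om y s <= H * rho y.
  have [H H0 HH] := Zspace_bounded a0 T0 TT Zv.
  exists (expR T * H) => [|y s sT]; first by rewrite mulr_ge0 ?expR_ge0.
  rewrite /om (clamp_id sT) -mulrA; apply: ler_pM; rewrite ?expR_ge0//.
  - by case: (uv0 y s (inI_le TT sT)).
  - by rewrite ler_expR; case/andP: sT.
  - apply: le_trans (ler_norm _) _; apply: (le_trans (HH y s sT)).
    by rewrite ler_wpM2l.
have D0 : 0 < eps0 * thl / (1 - p)^-1 by rewrite divr_gt0// invr_gt0.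
have C1r' : C1 * (thu * p / (eps0 * thl / (1 - p)^-1 * (1 - p)^-1)) < 1.
  by rewrite divfK ?invr_neq0 ?gt_eqF// (mulrC thu).
have TT' : 0 <= T <= T by rewrite T0 lexx.
have := comparison B'0 mB p01 thu0 cq q0 clam lam0 cL L00 Lge0 Lgt0 dL mV V'0
  mmu mu0 mom om0 v0u0 V'ub mu_ge om_le mrho rho0 rho_abs C10 brho om_bound D0 C1r' mu_lb x TT'.
by rewrite /om /mu (clamp_id TT') ler_pM2l// expR_gt0.
Qed.
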